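(* Let $\omega:[0,1]\to\mathbb{R}$ be a (nonconstant) c\`adl\`ag path, with associated tree $\mathbb{T}$ and length measure $\lambda$, and let $\rho:[0,1]\to\mathbb{R}$ be a bounded Borel function which is continuous at the times of discontinuity of $\omega$. Let $\Delta\rho(\tau)=\rho(\tau^\nearrow)-\rho(\tau^\nwarrow)$, $\tau\in\mathbb{T}$, with the conventions of the context. (a) For $p,q\ge1$ with $1/p+1/q>1$ there is a constant $C=C(p,q)$ such that $$\int_{\mathbb{T}}|\Delta\rho(\tau)|\,\lambda(d\tau)\le C\,V_p(\omega)^{1/p}\bigl(V_q(\rho)^{1/q}+\sup|\rho|\bigr).$$ Thus $\int_{\mathbb{T}}|\Delta\rho|\,d\lambda<\infty$ as soon as $1/\mathcal{V}(\omega)+1/\mathcal{V}(\rho)>1$, and in this case one can define $$\int_0^1\rho\,d\omega:=\int_{\mathbb{T}}\Delta\rho(\tau)\,\lambda(d\tau).$$ Assume from now on that $1/\mathcal{V}(\omega)+1/\mathcal{V}(\rho)>1$. (b) For $1/p+1/q>1$, $\bigl|\int_0^1\rho\,d\omega\bigr|\le C\,V_p(\omega)^{1/p}\bigl(V_q(\rho)^{1/q}+\sup|\rho|\bigr)$ with $C=C(p,q)$. (c) This integral coincides with the Riemann--Stieltjes (Young) integral: $\int_0^1\rho\,d\omega=\lim\sum_i\rho(s_i)\bigl(\omega(t_{i+1})-\omega(t_i)\bigr)$, for $t_i\le s_i\le t_{i+1}$, as the mesh of the subdivision $(t_i)$ of $[0,1]$ tends to $0$. (d) For $0\le s\le t\le1$,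 the integral $\int_s^t\rho\,d\omega$ can be defined similarly by replacing $\rho$ by $\rho1_{(s,t]}$; it satisfies the Chasles relation $\int_s^t\rho\,d\omega=\int_s^u\rho\,d\omega+\int_u^t\rho\,d\omega$ for $s\le u\le t$, and, for $1/p+1/q>1$, $$V_p\Bigl(\int_0^{\cdot}\rho\,d\omega\Bigr)^{1/p}\le C\,V_p(\omega)^{1/p}\bigl(V_q(\rho)^{1/q}+\sup|\rho|\bigr),\qquad C=C(p,q).$$
   Context: Let $\omega:[0,1]\to\mathbb{R}$ be c\`adl\`ag, nonconstant, with the convention $\omega(0-)=\omega(0)$. Let $\mathbb{G}$ be the set of points $(t,x)$ with $0\le t\le1$ and $x$ between $\omega(t-)$ and $\omega(t)$ (inclusive). Define $\delta((t,x),(t,x'))=|x'-x|$ and, for $s<t$, $\delta((s,x),(t,x'))=x+x'-2\bigl(\inf_{(s,t)}\omega\wedge x\wedge x'\bigr)$. This is a semi-distance on $\mathbb{G}$, and $\mathbb{T}=(\mathbb{G}/\delta,\delta)$ is a compact real tree (any two points $\tau_1,\tau_2$ are joined by a unique arc $[\tau_1,\tau_2]$, isometric to $[0,\delta(\tau_1,\tau_2)]$). Let $\pi:\mathbb{G}\to\mathbb{T}$ be the projection, $O=\pi(U,\omega(U)\wedge\omega(U-))$ where $U$ is a time with $\omega(U)\wedge\omega(U-)=\inf\omega$, $A=\pi(0,\omega(0))$, $B=\pi(1,\omega(1))$; one has $O\in[A,B]$. The tree is rooted at $O$; a leaf is a point $\tau$ such that $\tau\notin[O,\sigma]$ for all $\sigma\neq\tau$.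 The length measure $\lambda$ is the unique measure on $\mathbb{T}$ for which the set of leaves has measure zero and the measure of each arc is its length. For $\tau\in\mathbb{T}$, $\tau^\nearrow$ and $\tau^\nwarrow$ are the infimum and the supremum of the time components of the points of $\pi^{-1}(\tau)$. For $\rho:[0,1]\to\mathbb{R}$, the convention is that $\rho(\tau^\nearrow)$ is replaced by $0$ for $\tau\in[O,A]$ and $\rho(\tau^\nwarrow)$ is replaced by $0$ for $\tau\in[O,B]$. Thus, up to $\lambda$-null sets, $\Delta\rho(\tau)=\rho(\tau^\nearrow)-\rho(\tau^\nwarrow)$ on $\mathbb{T}\setminus[A,B]$, $\Delta\rho(\tau)=-\rho(\tau^\nwarrow)$ on $[A,O]$, $\Delta\rho(\tau)=\rho(\tau^\nearrow)$ on $[O,B]$. For $p\ge1$ and a real function $f$ on $[0,1]$, $V_p(f)=\sup\sum_i|f(t_{i+1})-f(t_i)|^p$ over subdivisions $(t_i)$ of $[0,1]$, and $\mathcal{V}(f)=\inf\{p\ge1:V_p(f)<\infty\}$. *)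

(* Defs.v *)
From HB Require Import structures.
From mathcomp Require Export all_boot all_order all_algebra.
From mathcomp Require Export all_classical all_reals all_analysis.

Set Implicit Arguments.
Unset Strict Implicit.
Unset Printing Implicit Defensive.

Import Order.TTheory GRing.Theory Num.Theory.
Import numFieldNormedType.Exports.

Local Open Scope classical_set_scope.
Local Open Scope ring_scope.

(* A path [0,1] -> R is a total function R -> R of which only the values on
   [0,1] are ever used. *)

Section Paths.
Context {R : realType}.
Implicit Types (w f r : R -> R) (p t u : R) (s : seq R).

Definition cadlag w : Prop :=
  (forall t, 0 <= t < 1 -> w x @[x --> t^'+] --> w t) /\
  (forall t, 0 < t <= 1 -> cvg (w x @[x --> t^'-])).

Definition nonconstant w : Prop :=
  exists t u, [/\ 0 <= t <= 1, 0 <= u <= 1 & w t != w u].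

Definition continuous01_at f t : Prop :=
  f x @[x --> within `[0, 1] (nbhs t)] --> f t.

Definition bounded_borel r : Prop :=
  [bounded r t | t in `[0, 1]] /\ measurable_fun (`[0, 1] : set R) r.

Definition sup_norm r : \bar R :=
  ereal_sup [set `|r t|%:E | t in `[0, 1]].

(* The subdivision 0 = t_0 < ... < t_n = 1 is encoded, as in [itv_partition],
   by the sequence s = [:: t_1; ...; t_n]. *)
Definition subdiv_pt s (i : nat) : R := nth 1 (0 :: s) i.

Definition pvar p f : \bar R :=
  ereal_sup [set (\sum_(0 <= i < size s)
      `|f (subdiv_pt s i.+1) - f (subdiv_pt s i)| `^ p)%:E
    | s in itv_partition 0 1].

Definition var_index f : \bar R :=
  ereal_inf [set p%:E | p in [set p : R | 1 <= p /\ (pvar p f < +oo)%E]].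

Definition riemann_sum r w s (c : nat -> R) : R :=
  \sum_(0 <= i < size s)
    r (c i) * (w (subdiv_pt s i.+1) - w (subdiv_pt s i)).

Definition riemann_stieltjes_lim r w (l : R) : Prop :=
  forall e, 0 < e -> exists2 h, 0 < h &
    forall s (c : nat -> R), itv_partition 0 1 s ->
      (forall i, (i < size s)%N -> subdiv_pt s i.+1 - subdiv_pt s i < h) ->
      (forall i, (i < size s)%N ->
         subdiv_pt s i <= c i <= subdiv_pt s i.+1) ->
      `|riemann_sum r w s c - l| < e.

Definition left_lim w t : R :=
  if t == 0 then w 0 else lim (w x @[x --> t^'-]).

Definition lower w t : R := Num.min (left_lim w t) (w t).
Definition upper w t : R := Num.max (left_lim w t) (w t).

Definition filled_graph w : set (R * R) :=
  [set z | 0 <= z.1 <= 1 /\ lower w z.1 <= z.2 <= upper w z.1].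

Definition delta w (z z' : R * R) : R :=
  if z.1 == z'.1 then `|z'.2 - z.2| else
  z.2 + z'.2 -
    2 * Num.min (inf (w @` `]Num.min z.1 z'.1, Num.max z.1 z'.1[))
                (Num.min z.2 z'.2).

Definition delta_class w (z : R * R) : set (R * R) :=
  [set z' | filled_graph w z' /\ delta w z z' = 0].

(* A point of the tree is its own fibre under the projection. *)
Definition tree w : Type :=
  {S : set (R * R) | exists2 z, filled_graph w z & S = delta_class w z}.

Definition fibre w (tau : tree w) : set (R * R) := sval tau.

Lemma filled_graph_path w t : 0 <= t <= 1 -> filled_graph w (t, w t).
Proof.
by move=> t01; split=> //=; rewrite /lower /upper ge_min le_max lexx !orbT.
Qed.

Definition proj_in w z (Gz : filled_graph w z) : tree w :=
  exist _ (delta_class w z) (ex_intro2 _ _ z Gz erefl).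

Lemma time0_in01 : 0 <= (0 : R) <= 1. Proof. by rewrite lexx ler01. Qed.

Definition tree_A w : tree w := proj_in (filled_graph_path w time0_in01).

HB.instance Definition _ w := gen_eqMixin (tree w).
HB.instance Definition _ w := gen_choiceMixin (tree w).
HB.instance Definition _ w := isPointed.Build (tree w) (tree_A w).

(* Totalized projection; the value off the filled graph is irrelevant. *)
Definition proj w (z : R * R) : tree w :=
  if pselect (filled_graph w z) is left Gz then proj_in Gz else tree_A w.

Definition tree_B w : tree w := proj w (1, w 1).

Definition root_time w : R :=
  xget 0 [set u | 0 <= u <= 1 /\ lower w u = inf (w @` `[0, 1])].

Definition tree_O w : tree w := proj w (root_time w, lower w (root_time w)).

Definition tree_repr w (tau : tree w) : R * R := xget (0, w 0) (fibre tau).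

(* When w is cadlag, delta is a semi-distance, so that this does not depend on
   the representatives. *)
Definition tree_dist w (tau sigma : tree w) : R :=
  delta w (tree_repr tau) (tree_repr sigma).

Definition tree_open w : set (set (tree w)) :=
  [set V | forall tau, V tau ->
     exists2 e, 0 < e & forall sigma, tree_dist tau sigma < e -> V sigma].

Definition tree_geodesic w (tau sigma : tree w) (phi : R -> tree w) : Prop :=
  [/\ phi 0 = tau, phi (tree_dist tau sigma) = sigma &
      forall u v, u \in `[0, tree_dist tau sigma] ->
        v \in `[0, tree_dist tau sigma] ->
        tree_dist (phi u) (phi v) = `|u - v| ].

(* In a real tree all geodesics from tau to sigma have the same image, which
   is the arc [tau, sigma]. *)
Definition arc w (tau sigma : tree w) : set (tree w) :=
  [set x | exists2 phi, tree_geodesic tau sigma phi &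
             (phi @` `[0, tree_dist tau sigma]) x].

Definition leaves w : set (tree w) :=
  [set tau | forall sigma, sigma != tau -> ~ arc (tree_O w) sigma tau].

(* The tree with the Borel sets of its distance. *)
Definition borel_tree w := g_sigma_algebraType (@tree_open w).

Definition length_measure w
    (lam : {measure set (borel_tree w) -> \bar R}) : Prop :=
  lam (@leaves w) = 0%E /\
  forall tau sigma : tree w, lam (arc tau sigma) = (tree_dist tau sigma)%:E.

Definition first_time w (tau : tree w) : R := inf (fst @` fibre tau).
Definition last_time w (tau : tree w) : R := sup (fst @` fibre tau).

Definition Delta w r (tau : tree w) : R :=
  (if `[< arc (tree_O w) (tree_A w) tau >] then 0 else r (first_time tau)) -
  (if `[< arc (tree_O w) (tree_B w) tau >] then 0 else r (last_time tau)).

Definition tree_integrable w (lam : {measure set (borel_tree w) -> \bar R}) r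
    : Prop :=
  lam.-integrable setT (fun tau : borel_tree w => (Delta r tau)%:E).

Definition tree_integral w (lam : {measure set (borel_tree w) -> \bar R}) r
    : R :=
  \int[lam]_tau Delta r tau.

Definition tree_integral_on w
    (lam : {measure set (borel_tree w) -> \bar R}) r (s t : R) : R :=
  tree_integral lam (fun u => r u * \1_`]s, t] u).

End Paths.

(* Main.v *)
Require Import Defs.
From mathcomp Require Import ring lra measurable_realfun.

Set Implicit Arguments.
Unset Strict Implicit.
Unset Printing Implicit Defensive.

Import Order.TTheory GRing.Theory Num.Theory.
Import numFieldNormedType.Exports.

Local Open Scope classical_set_scope.
Local Open Scope ring_scope.

(* A point tau of the tree lies on [O, sigma] iff it is an ancestor of sigma
   ([tle tau sigma]), and the ancestors of sigma are parametrized by their level;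
   on such an arc the length measure is Lebesgue measure. Approximate the tree by
   the subtrees spanned by the grid nodes (k/(N+1), w(k/(N+1))), each decomposed
   into branches. Cutting every branch at distance a from its tip leaves points
   whose time intervals [first_time, last_time] separate excursions of w of
   height a, so there are at most 2 V_p(w) / a^p of them, and by Hoelder's
   inequality the sum of |Delta rho| over them is at most
   C a^(-p(1-1/q)) (V_q(rho)^(1/q) + sup |rho|). This is integrable near 0 exactly
   because 1/p + 1/q > 1, and integrating over a gives the bound (a).

   The same estimate shows that the integrals of |Delta eta| over the part of the
   tree at height less than c are uniformly small in terms of the q-variation
   and the supremum of eta, while the rest of the tree has finite measure.
   Hence the integral of |Delta eta_n| tends to 0 when the eta_n are bounded, of
   bounded q-variation, and tend to 0 off a countable set of continuity times
   of w. The integral of the indicator of ]s, t] is w t - w s, so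
   Riemann sums are integrals of step functions; they converge, as a function of
   finite q-variation has countably many discontinuities. Finally Young's
   discrete inequality bounds the integral over ]s, t] by the p-variation
   of w on [s, t], which is superadditive in the interval. *)

(** * Cadlag paths *)

(** The length measure is known only through its values on arcs and on the leaves, and a point of
    the tree is a fibre in the filled graph, so every formula must first be brought back to [w]. The
    bridge is that a level [c] lies under the branching point of two graph points exactly when both
    have level at least [c] and [w >= c] between their times. The powers fit for the following
    reason: active heights never exceed V_p(w)^(1/p), and integrating the slice bound up to there
    turns the factor V_p(w)^(1-1/q) of the count into exactly V_p(w)^(1/p), at the price of the
    constant 1/(1 - p(1-1/q)). Continuity of rho at the jumps of [w] is what makes exceptional times
    harmless: at a continuity time the filled graph has a single point, hence meets a single point
    of the tree, whereas a jump covers a whole arc. The bound (a) alone cannot give the variation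
    bound in (d), since it does not see that the integral over ]s, t] depends only on [w] on [s, t].
    Riemann sums do see it, which is why Young's inequality returns at the end. *)

Section Cousin.
Context {R : realType}.

(** Compactness of [[a, b]] as an induction on intervals. It suits cadlag paths: the local
    hypothesis concerns only intervals containing [t], where the two one-sided limits at [t] decide
    everything. *)
Lemma cousin (P : R -> R -> Prop) (a b : R) : a <= b ->
  (forall u v t, a <= u -> u <= v -> v <= t -> t <= b ->
     P u v -> P v t -> P u t) ->
  (forall t, a <= t <= b -> exists2 e, 0 < e & forall u v,
     a <= u -> u <= t -> t <= v -> v <= b -> t - e < u -> v < t + e -> P u v) ->
  P a b.
Proof.
move=> ab Ptrans Ploc.
pose S := [set v | a <= v <= b /\ P a v].
have Sa : S a.
  split; first by rewrite lexx ab.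
  have [|e e0 He] := Ploc a; first by rewrite lexx ab.
  by apply: He => //; lra.
have ubS : ubound S b by move=> v [/andP[]].
have hS : has_sup S by split; [exists a | exists b].
have s_ge : a <= sup S by apply: ub_le_sup => //; exists b.
have s_le : sup S <= b by apply: ge_sup => //; exists a.
have [|e e0 He] := Ploc (sup S); first by rewrite s_ge s_le.
have [v [/andP[av vb] Pav] sv] := sup_adherent e0 hS.
have vs : v <= sup S.
  by apply: ub_le_sup; [exists b | split=> //; rewrite av vb].
pose z := Num.min b (sup S + e / 2).
have zb : z <= b by rewrite ge_min lexx.
have sz : sup S <= z by rewrite le_min s_le /=; lra.
have zs : z < sup S + e by rewrite gt_min; apply/orP; right; lra.
have Paz : P a z.
  by apply: (Ptrans _ v) => //; [exact: le_trans vs sz | apply: He].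
have zS : z <= sup S.
  apply: ub_le_sup; first by exists b.
  by split=> //; rewrite zb (le_trans s_ge).
suff <- : z = b by [].
by move: zS; rewrite /z minEle; case: ifP => // _; lra.
Qed.

End Cousin.

Section CadlagPaths.
Context {R : realType} (w : R -> R) (cw : cadlag w).
Implicit Types (s t u v x y e d : R).

Lemma cadlag_right t e : 0 <= t -> t < 1 -> 0 < e ->
  exists2 d, 0 < d & forall u, t <= u -> u < t + d -> `|w t - w u| < e.
Proof.
move=> t0 t1 e0; have [cr _] := cw.
have /cr/cvgrPdist_lt /(_ e e0) : 0 <= t < 1 by rewrite t0 t1.
move=> -[d /= d0 Hd]; exists d => // u.
rewrite le_eqVlt => /orP[/eqP<- _|tu ud]; first by rewrite subrr normr0.
apply: Hd => //=; rewrite distrC ger0_norm; lra.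
Qed.

Lemma cadlag_left t e : 0 < t -> t <= 1 -> 0 < e ->
  exists2 d, 0 < d & forall u, t - d < u -> u < t -> `|left_lim w t - w u| < e.
Proof.
move=> t0 t1 e0; have [_ cl] := cw.
have /cl : 0 < t <= 1 by rewrite t0 t1.
rewrite /left_lim gt_eqF// => /cvgrPdist_lt /(_ e e0).
move=> -[d /= d0 Hd]; exists d => // u du ut.
apply: Hd => //=; rewrite ger0_norm; lra.
Qed.

Lemma right_gt t x : 0 <= t -> t < 1 -> x < w t ->
  exists2 d, 0 < d & forall u, t <= u -> u < t + d -> x < w u.
Proof.
move=> t0 t1 xw; have [|d d0 Hd] := @cadlag_right t (w t - x) t0 t1; first lra.
exists d => // u tu ud; have := Hd u tu ud.
by move=> /ltr_distlDr; lra.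
Qed.

Lemma left_gt t x : 0 < t -> t <= 1 -> x < left_lim w t ->
  exists2 d, 0 < d & forall u, t - d < u -> u < t -> x < w u.
Proof.
move=> t0 t1 xw; have [|d d0 Hd] := @cadlag_left t (left_lim w t - x) t0 t1.
  lra.
exists d => // u tu ud; have := Hd u tu ud.
by move=> /ltr_distlDr; lra.
Qed.

Lemma right_ge t s x : 0 <= t -> t < s -> t < 1 ->
  (forall u, t < u -> u < s -> x <= w u) -> x <= w t.
Proof.
move=> t0 ts t1 H; rewrite leNgt; apply/negP => xw.
have [|d d0 Hd] := @cadlag_right t (x - w t) t0 t1; first lra.
pose u := t + Num.min d (s - t) / 2.
have m0 : 0 < Num.min d (s - t) by rewrite lt_min d0; lra.
have md : Num.min d (s - t) <= d by rewrite ge_min lexx.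
have ms : Num.min d (s - t) <= s - t by rewrite ge_min lexx orbT.
have := H u; have := Hd u; rewrite /u => A /(_ _ _)B.
have : x <= w u by apply: B; lra.
have : `|w t - w u| < x - w t by apply: A; lra.
by rewrite distrC => /ltr_distlDr; lra.
Qed.

Lemma left_ge t s x : 0 < t -> t <= 1 -> s < t ->
  (forall u, s < u -> u < t -> x <= w u) -> x <= left_lim w t.
Proof.
move=> t0 t1 st H; rewrite leNgt; apply/negP => xw.
have [|d d0 Hd] := @cadlag_left t (x - left_lim w t) t0 t1; first lra.
pose u := t - Num.min d (t - s) / 2.
have m0 : 0 < Num.min d (t - s) by rewrite lt_min d0; lra.
have md : Num.min d (t - s) <= d by rewrite ge_min lexx.
have ms : Num.min d (t - s) <= t - s by rewrite ge_min lexx orbT.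
have : x <= w u by apply: H; rewrite /u; lra.
have : `|left_lim w t - w u| < x - left_lim w t by apply: Hd; rewrite /u; lra.
by rewrite distrC => /ltr_distlDr; lra.
Qed.

Lemma left_lim0 : left_lim w 0 = w 0.
Proof. by rewrite /left_lim eqxx. Qed.

Lemma lower_le t : lower w t <= w t.
Proof. by rewrite /lower ge_min lexx orbT. Qed.

Lemma le_upper t : w t <= upper w t.
Proof. by rewrite /upper le_max lexx orbT. Qed.

Lemma lower_le_upper t : lower w t <= upper w t.
Proof. exact: le_trans (lower_le t) (le_upper t). Qed.

(** Including the left limit makes [lower w] lower semicontinuous, which [w] need not be: near [t]
    both one-sided limits keep [w] above an intermediate [y], and left limits at nearby times
    inherit this from the values of [w] just before them. *)
Lemma lower_lsc t x : 0 <= t -> t <= 1 -> x < lower w t ->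
  exists2 e, 0 < e & forall u, 0 <= u -> u <= 1 -> t - e < u -> u < t + e ->
    x < lower w u.
Proof.
move=> t0 t1 xl; pose y := (x + lower w t) / 2.
have yl : y < left_lim w t /\ y < w t.
  have : y < lower w t by rewrite /y; lra.
  by rewrite /lower lt_min => /andP[].
have xy : x < y by rewrite /y; lra.
have [e1 e10 H1] : exists2 e, 0 < e & forall u, t <= u -> u < t + e -> u <= 1 ->
    y < w u.
  have [t1'|t1'] := ltP t 1.
    by have [e e0 H] := right_gt t0 t1' yl.2; exists e => // u *; exact: H.
  exists 1 => // u tu _ u1; suff -> : u = t by case: yl.
  by apply/eqP; rewrite eq_le tu (le_trans u1).
have [e2 e20 H2] : exists2 e, 0 < e & forall u, t - e < u -> u < t -> 0 <= u ->
    y < w u.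
  have [t0'|t0'] := ltP 0 t.
    by have [e e0 H] := left_gt t0' t1 yl.1; exists e => // u *; exact: H.
  by exists 1 => // u _ ut u0; lra.
exists (Num.min e1 e2); first by rewrite lt_min e10.
move=> u u0 u1 eu ue.
have {}eu : t - e2 < u.
  by apply: le_lt_trans eu; rewrite lerD2l lerN2 ge_min lexx orbT.
have {}ue : u < t + e1 by apply: lt_le_trans ue _; rewrite lerD2l ge_min lexx.
have wu : y < w u by have [tu|tu] := leP t u; [exact: H1 | exact: H2].
rewrite /lower lt_min (lt_trans xy wu) andbT; apply: (lt_le_trans xy).
have [u00|u00] := eqVneq u 0.
  by rewrite u00 left_lim0 ltW // -u00.
have {}u0 : 0 < u by rewrite lt_neqAle eq_sym u00.
have [->|tu] := eqVneq u t; first exact/ltW/yl.1.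
have [{}tu|{}ut] := ltP t u.
  apply: (@left_ge u t) => // v tv vu.
  by apply/ltW/H1 => //; lra.
have {}ut : u < t by rewrite lt_neqAle tu.
apply: (@left_ge u (Num.max 0 (t - e2))) => //.
  by rewrite gt_max u0 eu.
move=> v; rewrite gt_max => /andP[v0 v1] vu.
by apply/ltW/H2 => //; lra.
Qed.

Lemma lower_gt_unif a b x : 0 <= a -> a <= b -> b <= 1 ->
  (forall u, a <= u -> u <= b -> x < lower w u) ->
  exists2 y, x < y & forall u, a <= u -> u <= b -> y <= lower w u.
Proof.
move=> a0 ab b1 H.
apply: (@cousin _ (fun a b => exists2 y, x < y &
  forall u, a <= u -> u <= b -> y <= lower w u)) => //.
- move=> u v t au uv vt tb [y xy Hy] [z xz Hz].
  exists (Num.min y z); first by rewrite lt_min xy.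
  move=> r ur rt; rewrite ge_min; have [rv|vr] := leP r v.
    by rewrite Hy.
  by rewrite Hz ?orbT // ltW.
- move=> t /andP[at_ tb].
  have xt := H t at_ tb; pose y := (x + lower w t) / 2.
  have [|||e e0 He] := @lower_lsc t y; rewrite ?/y; [lra|lra|lra|].
  exists e => // u v au ut tv vb eu ve; exists y; first by rewrite /y; lra.
  by move=> r ur rv; apply/ltW/He; rewrite ?/y; lra.
Qed.

(** Plays the role of a minimum on a compact interval: at a jump [w] may approach its infimum
    without reaching it, but [lower w] reaches it. *)
Lemma lower_attain a b x : 0 <= a -> a <= b -> b <= 1 ->
  (forall e, 0 < e -> exists u, [/\ a <= u, u <= b & lower w u <= x + e]) ->
  exists u, [/\ a <= u, u <= b & lower w u <= x].
Proof.
move=> a0 ab b1 H; apply: contrapT => Hn.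
have [|y xy Hy] := @lower_gt_unif a b x a0 ab b1.
  by move=> u au ub; rewrite ltNge; apply/negP => ?; apply: Hn; exists u.
have [|u [au ub]] := H ((y - x) / 2); first lra.
by have := Hy u au ub; lra.
Qed.

(** The supremum of the hitting times before [t] is itself a hitting time, by lower
    semicontinuity. *)
Lemma left_hit t x : 0 <= t -> t <= 1 ->
  (exists u, [/\ 0 <= u, u <= t & lower w u <= x]) ->
  exists s, [/\ 0 <= s, s <= t, lower w s <= x &
    forall u, s < u -> u <= t -> x < lower w u].
Proof.
move=> t0 t1 [u [u0 ut ux]].
pose S := [set s | [/\ 0 <= s, s <= t & lower w s <= x]].
have hS : has_sup S by split; [exists u | exists t => s []].
have us : u <= sup S by apply: ub_le_sup => //; case: hS.
have st : sup S <= t by apply: ge_sup => [|s []//]; exists u.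
have Sn s : sup S < s -> s <= t -> x < lower w s.
  move=> Ss st'; rewrite ltNge; apply/negP => sx.
  have : s <= sup S by apply: ub_le_sup; [case: hS | split=> //; lra].
  lra.
exists (sup S); split=> //; first exact: le_trans us.
rewrite leNgt; apply/negP => xS.
have [||e e0 He] := lower_lsc _ _ xS; [lra|lra|].
have [s [s0 st' sx] es] := sup_adherent e0 hS.
have : s <= sup S by apply: ub_le_sup; [case: hS | ].
move=> sS; have := He s s0; suff : x < lower w s by lra.
by apply: He; lra.
Qed.

Lemma right_hit t x : 0 <= t -> t <= 1 ->
  (exists u, [/\ t <= u, u <= 1 & lower w u <= x]) ->
  exists s, [/\ t <= s, s <= 1, lower w s <= x &
    forall u, t <= u -> u < s -> x < lower w u].
Proof.
move=> t0 t1 [u [ut u1 ux]].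
pose S := [set s | [/\ t <= s, s <= 1 & lower w s <= x]].
have hS : has_inf S by split; [exists u | exists t => s []].
have us : inf S <= u by apply: ge_inf => //; case: hS.
have st : t <= inf S by apply: lb_le_inf => [|s []//]; exists u.
have Sn s : s < inf S -> t <= s -> x < lower w s.
  move=> Ss st'; rewrite ltNge; apply/negP => sx.
  have : inf S <= s by apply: ge_inf; [case: hS | split=> //; lra].
  lra.
exists (inf S); split=> //; [exact: le_trans u1 | | by move=> *; exact: Sn].
rewrite leNgt; apply/negP => xS.
have [||e e0 He] := lower_lsc _ _ xS; [lra|lra|].
have [s [s0 st' sx] es] := inf_adherent e0 hS.
have : inf S <= s by apply: ge_inf; [case: hS | ].
move=> sS; suff : x < lower w s by lra.
by apply: He; lra.
Qed.

Lemma upper_left t s x : 0 <= s -> s < t -> t <= 1 ->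
  (forall u, s < u -> u < t -> x <= w u) -> x <= upper w t.
Proof.
move=> s0 st t1 H; rewrite /upper le_max (@left_ge t s) //; lra.
Qed.

Lemma upper_right t s x : 0 <= t -> t < s -> s <= 1 ->
  (forall u, t < u -> u < s -> x <= w u) -> x <= upper w t.
Proof.
move=> s0 st t1 H; rewrite /upper le_max (@right_ge t s) ?orbT //; lra.
Qed.

Lemma cadlag_bounded : exists M, forall t, 0 <= t -> t <= 1 -> `|w t| <= M.
Proof.
apply: (@cousin _ (fun a b => exists M, forall t, a <= t -> t <= b ->
   `|w t| <= M)) => //.
- move=> u v t u0 uv vt t1 [M HM] [N HN]; exists (Num.max M N) => r ur rt.
  by rewrite le_max; have [rv|vr] := leP r v; [rewrite HM | rewrite HN ?orbT // ltW].
- move=> t /andP[t0 t1].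
  have [d1 d10 H1] : exists2 d, 0 < d & forall u, t <= u -> u < t + d ->
      u <= 1 -> `|w t - w u| < 1.
    have [t1'|t1'] := ltP t 1.
      have [d d0 H] := cadlag_right t0 t1' ltr01.
      by exists d => // u *; exact: H.
    exists 1 => // u tu _ u1; suff -> : u = t by rewrite subrr normr0.
    by apply/eqP; rewrite eq_le tu (le_trans u1).
  have [d2 d20 H2] : exists2 d, 0 < d & forall u, t - d < u -> u < t ->
      0 <= u -> `|left_lim w t - w u| < 1.
    have [t0'|t0'] := ltP 0 t.
      have [d d0 H] := cadlag_left t0' t1 ltr01.
      by exists d => // u *; exact: H.
    by exists 1 => // u _ ut u0; lra.
  exists (Num.min d1 d2); first by rewrite lt_min d10.
  move=> u v u0 ut tv v1 eu ve.
  have {}eu : t - d2 < u.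
    by apply: le_lt_trans eu; rewrite lerD2l lerN2 ge_min lexx orbT.
  have {}ve : v < t + d1 by apply: lt_le_trans ve _; rewrite lerD2l ge_min lexx.
  exists (Num.max `|w t| `|left_lim w t| + 1) => r ur rv.
  have [tr|rt] := leP t r.
    have : `|w t - w r| < 1 by apply: H1; lra.
    have := ler_normB (w t) (w t - w r); rewrite opprB addrC subrK.
    have : `|w t| <= Num.max `|w t| `|left_lim w t| by rewrite le_max lexx.
    lra.
  have : `|left_lim w t - w r| < 1 by apply: H2; lra.
  have := ler_normB (left_lim w t) (left_lim w t - w r).
  rewrite opprB addrC subrK.
  have : `|left_lim w t| <= Num.max `|w t| `|left_lim w t|.
    by rewrite le_max lexx orbT.
  lra.
Qed.

End CadlagPaths.

(** * The tree and its order *)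

Section Meet.
Context {R : realType} (w : R -> R) (cw : cadlag w).
Implicit Types (z : R * R) (c x t u : R).

(** Equivalent to [c <= meet z z'] on the filled graph ([meetP]), but free of infima. Both orders of
    the two times are allowed, so that the relation is symmetric. *)
Definition above c z z' : Prop :=
  [/\ c <= z.2, c <= z'.2 &
      forall u, z.1 < u < z'.1 \/ z'.1 < u < z.1 -> c <= w u].

(** The level of the branching point of [z] and [z'], that is, the Gromov product of [delta] up to a
    shift ([deltaE]). *)
Definition meet z z' : R :=
  if z.1 == z'.1 then Num.min z.2 z'.2 else
  Num.min (inf (w @` `]Num.min z.1 z'.1, Num.max z.1 z'.1[))
          (Num.min z.2 z'.2).

Lemma above_sym c z z' : above c z z' -> above c z' z.
Proof. by case=> a b H; split=> // u [] /andP[? ?]; apply: H; [right|left]; apply/andP. Qed.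

Lemma above_le c c' z z' : c' <= c -> above c z z' -> above c' z z'.
Proof.
move=> cc [a b H]; split; [exact: le_trans a|exact: le_trans b|].
by move=> u /H; exact: le_trans.
Qed.

Lemma above_refl z : above z.2 z z.
Proof. by split=> // u [] /andP[]; lra. Qed.

Lemma graph_time z : filled_graph w z -> 0 <= z.1 /\ z.1 <= 1.
Proof. by case=> /andP[]. Qed.

(** The time intervals in [above] are open, so gluing two of them loses the value at the common end;
    right-continuity recovers it. *)
Lemma above_mid c z' z'' : filled_graph w z' -> z'.1 < z''.1 ->
  z''.1 <= 1 -> above c z' z'' -> c <= w z'.1.
Proof.
move=> Gz ? ? [_ _ H]; have [? ?] := graph_time Gz.
apply: (@right_ge _ _ cw z'.1 z''.1) => //; first lra.
by move=> u ? ?; apply: H; left; apply/andP.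
Qed.

(** Through [meetP] this is the ultrametric inequality for [meet], that is, the four-point condition
    of a real tree. *)
Lemma above_trans c z z' z'' : filled_graph w z -> filled_graph w z' ->
  filled_graph w z'' -> above c z z' -> above c z' z'' -> above c z z''.
Proof.
move=> Gz Gz' Gz'' A A'; have [a b H] := A; have [a' b' H'] := A'.
have [? ?] := graph_time Gz; have [? ?] := graph_time Gz'.
have [? ?] := graph_time Gz''.
split=> // u hu.
have [zu|uz] := ltP z'.1 u.
  case: hu => /andP[u1 u2].
    by apply: H'; left; apply/andP.
  by apply: H; right; apply/andP.
have [zu|uz'] := ltP u z'.1.
  case: hu => /andP[u1 u2].
    by apply: H; left; apply/andP.
  by apply: H'; right; apply/andP.
have uE : u = z'.1 by apply/eqP; rewrite eq_le uz.
case: hu; rewrite uE => /andP[u1 u2]; first exact: (above_mid Gz' u2 _ A').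
exact: (above_mid Gz' u2 _ (above_sym A)).
Qed.

Lemma meetP c z z' : filled_graph w z -> filled_graph w z' ->
  c <= meet z z' <-> above c z z'.
Proof.
move=> Gz Gz'; have [? ?] := graph_time Gz; have [? ?] := graph_time Gz'.
rewrite /meet; have [zz|zz] := eqVneq z.1 z'.1.
  rewrite le_min; split=> [/andP[a b]|[-> ->]//].
  by split=> // u []; rewrite zz => /andP[]; lra.
set I := w @` _.
rewrite !le_min; split=> [/and3P[i a b]|[-> -> H]].
  split=> // u hu; apply: (le_trans i).
  have [M HM] := cadlag_bounded cw.
  apply: ge_inf.
    exists (- M) => y [v /=]; rewrite in_itv /= gt_min lt_max => /andP[v1 v2] <-.
    have [] : 0 <= v /\ v <= 1 by case/orP: v1; case/orP: v2; lra.
    by move=> /HM h /h; rewrite ler_norml => /andP[].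
  exists u => //=; rewrite in_itv /= gt_min lt_max.
  by case: hu => /andP[-> ->]; rewrite ?orbT.
rewrite !andbT; apply: lb_le_inf.
  exists (w ((z.1 + z'.1) / 2)), ((z.1 + z'.1) / 2) => //=.
  rewrite in_itv /= gt_min lt_max; case/lt_total/orP: zz => h.
    by apply/andP; split; apply/orP; [left|right]; lra.
  by apply/andP; split; apply/orP; [right|left]; lra.
move=> y [v /=]; rewrite in_itv /= gt_min lt_max => /andP[v1 v2] <-.
apply: H; case/orP: v1 => v1; case/orP: v2 => v2.
- lra.
- by left; apply/andP.
- by right; apply/andP.
- lra.
Qed.

Lemma deltaE z z' : delta w z z' = z.2 + z'.2 - 2 * meet z z'.
Proof.
rewrite /delta /meet; case: ifP => // _.
by rewrite minEle; case: (leP z.2 z'.2) => h; [rewrite ger0_norm|rewrite ltr0_norm]; lra.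
Qed.

Lemma meet_above z z' : filled_graph w z -> filled_graph w z' ->
  above (meet z z') z z'.
Proof. by move=> Gz Gz'; apply/meetP. Qed.

Lemma meetC z z' : filled_graph w z -> filled_graph w z' -> meet z z' = meet z' z.
Proof.
move=> Gz Gz'; apply/eqP; rewrite eq_le; apply/andP; split.
  by apply/meetP => //; apply/above_sym/meet_above.
by apply/meetP => //; apply/above_sym/meet_above.
Qed.

Lemma meet_le1 z z' : filled_graph w z -> filled_graph w z' -> meet z z' <= z.2.
Proof. by move=> Gz Gz'; case: (meet_above Gz Gz'). Qed.

Lemma meet_le2 z z' : filled_graph w z -> filled_graph w z' -> meet z z' <= z'.2.
Proof. by move=> Gz Gz'; case: (meet_above Gz Gz'). Qed.

Lemma meetxx z : meet z z = z.2.
Proof. by rewrite /meet eqxx minxx. Qed.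

Lemma delta0P z z' : filled_graph w z -> filled_graph w z' ->
  delta w z z' = 0 <-> z.2 = z'.2 /\ above z.2 z z'.
Proof.
move=> Gz Gz'; rewrite deltaE; have := meet_le1 Gz Gz'; have := meet_le2 Gz Gz'.
split=> [h|[e /meetP]]; last by move=> /(_ Gz Gz'); lra.
split; first lra.
by apply/meetP => //; lra.
Qed.

End Meet.

Section Tree.
Context {R : realType} (w : R -> R) (cw : cadlag w).
Implicit Types (z : R * R) (c x t u : R) (tau sigma : tree w).

Definition level tau : R := (tree_repr tau).2.
Definition rtime tau : R := (tree_repr tau).1.
Definition tmeet tau sigma : R := meet w (tree_repr tau) (tree_repr sigma).

Lemma delta_class_refl z : filled_graph w z -> delta_class w z z.
Proof. by move=> Gz; split=> //; rewrite deltaE meetxx; lra. Qed.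

Lemma fibre_repr tau : fibre tau (tree_repr tau).
Proof.
rewrite /tree_repr; case: xgetP => [z _ //|].
move=> H; have [z Gz E] := svalP tau.
by case: (H z); rewrite /fibre E; exact: delta_class_refl.
Qed.

Lemma repr_graph tau : filled_graph w (tree_repr tau).
Proof.
have := fibre_repr tau; rewrite /fibre; case: (svalP tau) => z Gz -> [] //.
Qed.

Lemma fibreP tau z : fibre tau z <->
  filled_graph w z /\ delta w (tree_repr tau) z = 0.
Proof.
have := fibre_repr tau; rewrite /fibre; case: (svalP tau) => z0 Gz0 ->.
have Gr := repr_graph tau; case=> _ /(delta0P cw Gz0 Gr) [e A].
split=> -[Gz /(delta0P cw _ Gz)].
  move=> /(_ Gz0) [e' A']; split=> //; apply/(delta0P cw) => //.
  split; first by rewrite -e.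
  by rewrite -e; apply: (above_trans cw _ Gz0) => //; exact: above_sym.
move=> /(_ Gr) [e' A']; split=> //; apply/(delta0P cw) => //.
split; first by rewrite e.
by apply: (above_trans cw _ Gr) => //; rewrite e.
Qed.

Lemma fibreE tau z : fibre tau z <->
  [/\ filled_graph w z, z.2 = level tau & above w (level tau) (tree_repr tau) z].
Proof.
rewrite fibreP; split.
  by move=> [Gz /(delta0P cw (repr_graph tau) Gz)[]].
by move=> [Gz e A]; split=> //; apply/(delta0P cw (repr_graph tau) Gz).
Qed.

Lemma tree_distE tau sigma :
  tree_dist tau sigma = level tau + level sigma - 2 * tmeet tau sigma.
Proof. by rewrite /tree_dist deltaE. Qed.

Lemma tree_eqP tau sigma : tree_dist tau sigma = 0 -> tau = sigma.
Proof.
move=> /(delta0P cw (repr_graph _) (repr_graph _)) [e A].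
have F : fibre tau = fibre sigma.
  have Gt := repr_graph tau; have Gs := repr_graph sigma.
  have A' := A; rewrite e in A'.
  apply/seteqP; split=> z /fibreE [Gz e' B]; apply/fibreE; split=> //.
  - by rewrite /level -e.
  - rewrite /level -e; exact: (above_trans cw Gs Gt Gz (above_sym A) B).
  - by rewrite /level e.
  - by rewrite /level e; exact: (above_trans cw Gt Gs Gz A' B).
case: tau sigma F {e A} => S HS [S' HS'] /= F; rewrite /fibre /= in F.
by subst S'; congr exist; exact: Prop_irrelevance.
Qed.

Lemma tree_dist_sym tau sigma : tree_dist tau sigma = tree_dist sigma tau.
Proof.
by rewrite !tree_distE /tmeet (meetC cw (repr_graph _) (repr_graph _)); lra.
Qed.

Lemma tmeetC tau sigma : tmeet tau sigma = tmeet sigma tau.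
Proof. by rewrite /tmeet (meetC cw (repr_graph _) (repr_graph _)). Qed.

Lemma tmeet_le1 tau sigma : tmeet tau sigma <= level tau.
Proof. exact: (meet_le1 cw (repr_graph _) (repr_graph _)). Qed.

Lemma tmeet_le2 tau sigma : tmeet tau sigma <= level sigma.
Proof. exact: (meet_le2 cw (repr_graph _) (repr_graph _)). Qed.

Lemma tmeetxx tau : tmeet tau tau = level tau.
Proof. exact: meetxx. Qed.

Lemma tmeetP c tau sigma : c <= tmeet tau sigma <->
  above w c (tree_repr tau) (tree_repr sigma).
Proof. exact: (meetP cw _ (repr_graph _) (repr_graph _)). Qed.

Lemma tmeet_ultra tau sigma nu c : c <= tmeet tau sigma -> c <= tmeet sigma nu ->
  c <= tmeet tau nu.
Proof.
move=> /tmeetP A /tmeetP B; apply/tmeetP.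
exact: (above_trans cw (repr_graph _) (repr_graph sigma) (repr_graph _) A B).
Qed.

Lemma tree_dist_ge tau sigma : `|level tau - level sigma| <= tree_dist tau sigma.
Proof.
rewrite tree_distE; have := tmeet_le1 tau sigma; have := tmeet_le2 tau sigma.
by rewrite ler_norml => *; apply/andP; split; lra.
Qed.

Lemma tree_dist_triangle tau sigma nu :
  tree_dist tau nu <= tree_dist tau sigma + tree_dist sigma nu.
Proof.
rewrite !tree_distE.
have [h|/ltW h] := leP (tmeet tau sigma) (tmeet sigma nu).
  have := tmeet_ultra (lexx _) h; have := tmeet_le1 sigma nu; lra.
have := tmeet_ultra h (lexx _); have := tmeet_le2 tau sigma; lra.
Qed.

Definition tle tau sigma : Prop := level tau <= tmeet tau sigma.

Lemma tlexx tau : tle tau tau.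
Proof. by rewrite /tle tmeetxx. Qed.

Lemma tle_level tau sigma : tle tau sigma -> level tau <= level sigma.
Proof. by move=> h; apply: le_trans h (tmeet_le2 _ _). Qed.

Lemma tle_dist tau sigma : tle tau sigma <->
  tree_dist tau sigma = level sigma - level tau.
Proof.
rewrite /tle tree_distE; have := tmeet_le1 tau sigma; have := tmeet_le2 tau sigma.
by split=> *; lra.
Qed.

Lemma tle_trans sigma tau nu : tle tau sigma -> tle sigma nu -> tle tau nu.
Proof.
move=> h1 h2; apply: (tmeet_ultra h1); apply: le_trans h2; exact: tle_level.
Qed.

Lemma tle_chain tau tau' sigma : tle tau sigma -> tle tau' sigma ->
  level tau <= level tau' -> tle tau tau'.
Proof.
move=> h h' ll; apply: (tmeet_ultra h); rewrite tmeetC; apply: le_trans ll h'.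
Qed.

Lemma tle_eq tau sigma : tle tau sigma -> level tau = level sigma -> tau = sigma.
Proof. by move=> /tle_dist h e; apply: tree_eqP; rewrite h e subrr. Qed.

Lemma tle_uniq tau tau' sigma : tle tau sigma -> tle tau' sigma ->
  level tau = level tau' -> tau = tau'.
Proof. by move=> h h' e; apply: tle_eq => //; apply: (tle_chain h h'); rewrite e. Qed.

Lemma fibre_proj z : filled_graph w z -> fibre (proj w z) z.
Proof.
by move=> Gz; rewrite /proj; case: pselect => // ?; exact: delta_class_refl.
Qed.

Lemma level_fibre tau z : fibre tau z -> z.2 = level tau.
Proof. by move=> /fibreE[]. Qed.

Lemma fibre_graph tau z : fibre tau z -> filled_graph w z.
Proof. by move=> /fibreE[]. Qed.

Lemma level_proj z : filled_graph w z -> level (proj w z) = z.2.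
Proof. by move=> /fibre_proj/level_fibre. Qed.

(** Frees the later arguments from the chosen representatives: the meet can be read off any points
    of the two fibres. *)
Lemma tmeet_fibre tau sigma z z' c : fibre tau z -> fibre sigma z' ->
  c <= tmeet tau sigma <-> above w c z z'.
Proof.
move=> /fibreE[Gz ez Az] /fibreE[Gz' ez' Az']; rewrite tmeetP.
have Gt := repr_graph tau; have Gs := repr_graph sigma.
split=> A; have [c1 c2 _] := A.
  have B := above_trans cw Gz Gt Gs (above_le c1 (above_sym Az)) A.
  exact: (above_trans cw Gz Gs Gz' B (above_le c2 Az')).
rewrite ez in c1; rewrite ez' in c2.
have B := above_trans cw Gt Gz Gz' (above_le c1 Az) A.
exact: (above_trans cw Gt Gz' Gs B (above_le c2 (above_sym Az'))).
Qed.

Lemma tle_fibre tau sigma z z' : fibre tau z -> fibre sigma z' ->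
  tle tau sigma <-> above w z.2 z z'.
Proof.
by move=> hz hz'; rewrite /tle (tmeet_fibre _ hz hz') (level_fibre hz).
Qed.

Lemma fibre_eq tau sigma z : fibre tau z -> fibre sigma z -> tau = sigma.
Proof.
move=> h h'; apply: tle_eq; last by rewrite -(level_fibre h) (level_fibre h').
by apply/(tle_fibre h h'); exact: above_refl.
Qed.

Lemma path_graph t : 0 <= t -> t <= 1 -> filled_graph w (t, w t).
Proof. by move=> t0 t1; apply: filled_graph_path; rewrite t0 t1. Qed.

Definition node t : tree w := proj w (t, w t).

Lemma fibre_node t : 0 <= t -> t <= 1 -> fibre (node t) (t, w t).
Proof. by move=> *; apply/fibre_proj/path_graph. Qed.

Lemma level_node t : 0 <= t -> t <= 1 -> level (node t) = w t.
Proof. by move=> *; rewrite level_proj //; exact: path_graph. Qed.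

Lemma tree_A_node : tree_A w = node 0.
Proof.
apply: (@fibre_eq _ _ (0, w 0)); last by apply: fibre_node.
apply: delta_class_refl; exact: path_graph.
Qed.

Lemma tree_B_node : tree_B w = node 1.
Proof. by []. Qed.

Definition minw : R := inf (w @` `[0, 1]).

Lemma minw_le t : 0 <= t -> t <= 1 -> minw <= w t.
Proof.
move=> t0 t1; apply: ge_inf; last by exists t => //=; rewrite in_itv /= t0.
have [M HM] := cadlag_bounded cw; exists (- M) => y [v /=].
rewrite in_itv /= => /andP[v0 v1] <-.
by have := HM v v0 v1; rewrite ler_norml => /andP[].
Qed.

Lemma minw_le_left t : 0 <= t -> t <= 1 -> minw <= left_lim w t.
Proof.
move=> t0 t1; have [->|tn] := eqVneq t 0; first by rewrite left_lim0 minw_le.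
have t0' : 0 < t by rewrite lt_neqAle eq_sym tn.
by apply: (@left_ge _ _ cw t 0) => // u u0 ut; apply: minw_le; lra.
Qed.

Lemma minw_le_lower t : 0 <= t -> t <= 1 -> minw <= lower w t.
Proof. by move=> *; rewrite /lower le_min minw_le ?minw_le_left. Qed.

Lemma minw_graph z : filled_graph w z -> minw <= z.2.
Proof.
move=> [/andP[t0 t1] /andP[a _]]; apply: le_trans a; exact: minw_le_lower.
Qed.

Lemma minw_approx e : 0 < e -> exists u, [/\ 0 <= u, u <= 1 & w u < minw + e].
Proof.
move=> e0; have hi : has_inf (w @` `[0, 1]).
  split; first by exists (w 0), 0 => //=; rewrite in_itv /= lexx ler01.
  by exists minw => y [v /=]; rewrite in_itv /= => /andP[? ?] <-; exact: minw_le.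
have [y [u /=]] := inf_adherent e0 hi.
by rewrite in_itv /= => /andP[u0 u1] <- h; exists u.
Qed.

Lemma root_timeP : 0 <= root_time w <= 1 /\ lower w (root_time w) = minw.
Proof.
rewrite /root_time; case: xgetP => [u _ //|H].
have [||||u [u0 u1 lu]] := @lower_attain _ _ cw 0 1 minw => //.
  move=> e e0; have [u [u0 u1 /ltW h]] := minw_approx e0.
  by exists u; split=> //; exact: le_trans (lower_le _ _) h.
case: (H u); split; first by rewrite u0.
by apply/eqP; rewrite eq_le lu minw_le_lower.
Qed.

Lemma root_graph : filled_graph w (root_time w, lower w (root_time w)).
Proof. by have [h _] := root_timeP; split=> //=; rewrite lexx lower_le_upper. Qed.

Lemma level_root : level (tree_O w) = minw.
Proof. by rewrite level_proj /=; [case: root_timeP | exact: root_graph]. Qed.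

Lemma minw_level tau : minw <= level tau.
Proof. exact: minw_graph (repr_graph tau). Qed.

Lemma minw_tmeet tau sigma : minw <= tmeet tau sigma.
Proof.
apply/tmeetP; split; [exact: minw_level|exact: minw_level|].
have [? ?] := graph_time (repr_graph tau).
have [? ?] := graph_time (repr_graph sigma).
by move=> u [] /andP[? ?]; apply: minw_le; lra.
Qed.

Lemma root_tle tau : tle (tree_O w) tau.
Proof. by rewrite /tle level_root; exact: minw_tmeet. Qed.

(** If [x] lies on the vertical segment at the time of [sigma], that time works. Otherwise move to
    the nearest time, on one side, at which [lower w] is at most [x]: the path stays above [x] in
    between, so the point of level [x] there belongs to the filled graph and is below [sigma]. *)
Lemma ancestor_exists sigma x : minw <= x -> x <= level sigma ->
  exists tau, tle tau sigma /\ level tau = x.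
Proof.
move=> mx xs; have Fs := fibre_repr sigma; have [t0 t1] := graph_time (repr_graph sigma).
move: Fs (repr_graph sigma) xs t0 t1; rewrite /level.
case: (tree_repr sigma) => t y /= Fs Gs xs t0 t1.
suff [s [Gz A]] : exists s, filled_graph w (s, x) /\ above w x (s, x) (t, y).
  exists (proj w (s, x)); split; last by rewrite -/(level _) level_proj.
  by apply/(tle_fibre (fibre_proj Gz) Fs).
have [lx|xl] := leP (lower w t) x.
  exists t; split; last by split=> //= u [] /andP[]; lra.
  by split=> /=; rewrite ?t0 // lx (le_trans xs) //; case: Gs => _ /andP[].
have [||||u [u0 u1 lu]] := @lower_attain _ _ cw 0 1 x => //.
  move=> e e0; have [u [u0 u1 /ltW h]] := minw_approx e0.
  by exists u; split=> //; apply: le_trans (lower_le _ _) _; lra.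
have [ut|tu] := leP u t.
  have [|s [s0 st ls Hs]] := @left_hit _ _ cw t x t0 t1; first by exists u.
  have sn : s < t by rewrite lt_neqAle st andbT; apply/eqP => E; move: xl; rewrite -E; lra.
  have Hw v : s < v -> v < t -> x <= w v.
    by move=> sv vt; apply/ltW/(lt_le_trans (Hs v sv (ltW vt)))/lower_le.
  exists s; split.
    split=> /=; first by rewrite s0; lra.
    by rewrite ls (@upper_right _ _ cw s t).
  by split=> //= v [] /andP[v1 v2]; [exact: Hw | lra].
have [|s [st s1 ls Hs]] := @right_hit _ _ cw t x t0 t1; first by exists u; split=> //; lra.
have sn : t < s by rewrite lt_neqAle st andbT; apply/eqP => E; move: xl; rewrite E; lra.
have Hw v : t < v -> v < s -> x <= w v.
  by move=> tv vs; apply/ltW/(lt_le_trans (Hs v (ltW tv) vs))/lower_le.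
exists s; split.
  split=> /=; first by rewrite s1; lra.
  by rewrite ls (@upper_left _ _ cw s t).
by split=> //= v [] /andP[v1 v2]; [lra | exact: Hw].
Qed.

Definition anc sigma x : tree w := xget (tree_O w) [set tau | tle tau sigma /\ level tau = x].

Lemma ancP sigma x : minw <= x -> x <= level sigma ->
  tle (anc sigma x) sigma /\ level (anc sigma x) = x.
Proof.
move=> mx xs; rewrite /anc; case: xgetP => [tau _ //|H].
by have [tau /H] := ancestor_exists mx xs.
Qed.

Lemma ancE tau sigma : tle tau sigma -> anc sigma (level tau) = tau.
Proof.
move=> h; have [h1 h2] := ancP (minw_level tau) (tle_level h).
exact: (tle_uniq h1 h).
Qed.

Lemma dist_chain tau tau' sigma : tle tau sigma -> tle tau' sigma ->
  tree_dist tau tau' = `|level tau - level tau'|.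
Proof.
move=> h h'; have [ll|/ltW ll] := leP (level tau) (level tau').
  by have /tle_dist -> := tle_chain h h' ll; rewrite distrC ger0_norm; lra.
by rewrite tree_dist_sym; have /tle_dist -> := tle_chain h' h ll; rewrite ger0_norm; lra.
Qed.

(** Distances to the root are differences of levels. Hence a point of a geodesic from the root to
    [sigma] is at distance [level sigma - level tau] from [sigma], which is [tle] by [tle_dist].
    Conversely the ancestors of [sigma], listed by level, form a geodesic. *)
Lemma arc_rootP sigma tau : arc (tree_O w) sigma tau <-> tle tau sigma.
Proof.
have H0 : tree_dist (tree_O w) sigma = level sigma - minw.
  by have /tle_dist := root_tle sigma; rewrite level_root.
have Hs := minw_level sigma.
split.
  rewrite /arc /= => -[phi [p0 p1 pd] [u]] /=; rewrite H0 in p1 pd *.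
  rewrite in_itv /= => /andP[u0 u1] <-.
  have /tle_dist := root_tle (phi u); rewrite level_root => L.
  have I0 : 0 \in `[0, level sigma - minw] by rewrite in_itv /= lexx; lra.
  have I1 : level sigma - minw \in `[0, level sigma - minw] by rewrite in_itv /= lexx andbT; lra.
  have Iu : u \in `[0, level sigma - minw] by rewrite in_itv /= u0.
  have := pd _ _ I0 Iu; have := pd _ _ Iu I1; rewrite p0 p1 L.
  by move=> A B; apply/tle_dist; rewrite A; move: B; rewrite !ler0_norm; lra.
move=> h; rewrite /arc /=; exists (fun u => anc sigma (minw + u)).
  split; rewrite ?H0.
  - rewrite addr0; apply: (@tle_uniq _ _ sigma); last by rewrite level_root; case: (@ancP sigma minw).
      by case: (@ancP sigma minw).
    exact: root_tle.
  - rewrite addrC subrK; apply: (@tle_uniq _ _ sigma) (tlexx _) _.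
      by case: (@ancP sigma (level sigma)).
    by case: (@ancP sigma (level sigma)).
  - move=> u v; rewrite !in_itv /= => /andP[u0 u1] /andP[v0 v1].
    have [||tu lu] := @ancP sigma (minw + u); [lra|lra|].
    have [||tv lv] := @ancP sigma (minw + v); [lra|lra|].
    by rewrite (dist_chain tu tv) lu lv; congr `| _ |; lra.
exists (level tau - minw) => /=.
  by rewrite H0 in_itv /=; have := minw_level tau; have := tle_level h; lra.
by rewrite addrC subrK ancE.
Qed.

Lemma arc_point tau : arc tau tau = [set tau].
Proof.
have d0 : tree_dist tau tau = 0 by rewrite tree_distE tmeetxx; lra.
apply/seteqP; split=> x.
  move=> [phi [p0 _ _] [u]] /=; rewrite d0 in_itv /= => /andP[u0 u1] <-.
  by have -> : u = 0 by lra.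
move=> ->; exists (fun=> tau).
  by split=> //; rewrite d0 => u v /=; rewrite !in_itv /= => ? ?;
    have -> : u - v = 0; [lra|rewrite normr0].
by exists 0 => //=; rewrite d0 in_itv /= lexx.
Qed.

End Tree.

(** * Measurability *)

Section TreeMeasurable.
Context {R : realType} (w : R -> R) (cw : cadlag w).
Implicit Types (z : R * R) (c x t u : R) (tau sigma : tree w).

Lemma closed_measurable (D : set (tree w)) :
  (forall tau, (forall e, 0 < e -> exists2 sigma, D sigma & tree_dist sigma tau < e) ->
     D tau) ->
  measurable (D : set (borel_tree w)).
Proof.
move=> Dcl; rewrite -(setCK D); apply: measurableC.
apply: sub_sigma_algebra => tau nD; apply: contrapT => H; apply: nD; apply: Dcl.
move=> e e0; apply: contrapT => H'; apply: H; exists e => // sigma d Ds.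
by apply: H'; exists sigma => //; rewrite tree_dist_sym.
Qed.

Lemma measurable_level : measurable_fun setT (@level R w : borel_tree w -> R).
Proof.
apply: (measurability _ (RGenCInfty.measurableE R)) => _ -[_ [x ->] <-].
rewrite setTI; apply: closed_measurable => tau H /=.
rewrite in_itv /= andbT; apply/ler_addgt0Pr => e /H[sigma /=].
rewrite in_itv /= andbT => xs /(le_lt_trans (tree_dist_ge cw _ _)).
by move=> /ltr_distlDr; lra.
Qed.

Lemma measurable_tle sigma : measurable ([set tau | tle tau sigma] : set (borel_tree w)).
Proof.
apply: closed_measurable => tau H /=; rewrite /tle.
apply/ler_addgt0Pr => e e0; have [|tau' /= /(tle_dist cw) h d] := H (e); first lra.
have := tree_dist_triangle cw tau tau' sigma; have := tree_dist_ge cw tau' tau.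
rewrite [tree_dist tau tau'](tree_dist_sym cw) h [tree_dist tau sigma](tree_distE tau sigma).
move=> /(le_lt_trans) /(_ d); rewrite ltr_norml => /andP[]; lra.
Qed.

Lemma measurable_arc sigma :
  measurable (arc (tree_O w) sigma : set (borel_tree w)).
Proof.
rewrite (_ : arc _ _ = [set tau | tle tau sigma]); first exact: measurable_tle.
by apply/seteqP; split=> tau /(arc_rootP cw).
Qed.

Lemma measurable_point tau : measurable ([set tau] : set (borel_tree w)).
Proof.
apply: closed_measurable => sigma H /=; apply/esym/(tree_eqP cw).
apply/eqP; rewrite eq_le (le_trans (normr_ge0 _) (tree_dist_ge cw _ _)) andbT.
by apply/ler_addgt0Pr => e /H[_ -> /ltW]; rewrite add0r.
Qed.

Lemma fibre_between tau (c x u : R) (y z : R * R) : fibre tau y -> fibre tau z ->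
  y.1 < u -> u < z.1 -> level tau <= w u.
Proof.
move=> Fy Fz yu uz; have : tle tau tau by apply: tlexx.
move=> /(tle_fibre cw Fy Fz)[_ _ H]; rewrite -(level_fibre cw Fy).
by apply: H; left; apply/andP.
Qed.

Lemma fibre_intro tau s : 0 <= s -> s <= 1 -> lower w s <= level tau ->
  level tau <= upper w s ->
  (forall u, s < u < rtime tau \/ rtime tau < u < s -> level tau <= w u) ->
  fibre tau (s, level tau).
Proof.
move=> s0 s1 ls us H; apply/(fibreE cw); split=> //=.
  by split=> /=; rewrite ?s0 // ls.
by split=> //= u [] ?; apply: H; [right|left].
Qed.

Lemma rtime01 tau : 0 <= rtime tau /\ rtime tau <= 1.
Proof. exact: graph_time (repr_graph tau). Qed.

Lemma fibre_lower tau z : fibre tau z -> lower w z.1 <= level tau <= upper w z.1.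
Proof. by move=> F; rewrite -(level_fibre cw F); case: (fibre_graph cw F). Qed.

Lemma first_time_le tau z : fibre tau z -> first_time tau <= z.1.
Proof.
move=> F; apply: ge_inf; last by exists z.
by exists 0 => _ [y /(fibre_graph cw)/graph_time[y0 _] <-].
Qed.

Lemma last_time_ge tau z : fibre tau z -> z.1 <= last_time tau.
Proof.
move=> F; apply: ub_le_sup; last by exists z.
by exists 1 => _ [y /(fibre_graph cw)/graph_time[_ y0] <-].
Qed.

(** The infimum is attained: otherwise the fibre accumulates at [s] from the right, where lower
    semicontinuity gives [lower w s <= x] and the values of [w] just after [s] give
    [x <= upper w s]. *)
Lemma fibre_first_time tau : fibre tau (first_time tau, level tau).
Proof.
set s := first_time tau; set x := level tau.
have [r0 r1] := rtime01 tau; have Fr := fibre_repr tau.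
have sr : s <= rtime tau := first_time_le Fr.
have hi : has_inf (fst @` fibre tau).
  split; first by exists (rtime tau), (tree_repr tau).
  by exists 0 => _ [y /(fibre_graph cw)/graph_time[y0 _] <-].
have s0 : 0 <= s.
  by apply: lb_le_inf => [|_ [y /(fibre_graph cw)/graph_time[y0 _] <-]//]; case: hi.
have [[z Fz zs]|Hn] := pselect (exists2 z, fibre tau z & z.1 = s).
  by rewrite -zs /x -(level_fibre cw Fz); case: z Fz {zs}.
have Happ e : 0 < e -> exists z, [/\ fibre tau z, s < z.1 & z.1 < s + e].
  move=> e0; have [_ [z Fz <-] ze] := inf_adherent e0 hi.
  exists z; split=> //; rewrite lt_neqAle (first_time_le Fz) andbT.
  by apply/eqP => E; apply: Hn; exists z.
have rs : s < rtime tau.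
  by rewrite lt_neqAle sr andbT; apply/eqP => E; apply: Hn; exists (tree_repr tau).
have Hw u : s < u -> u < rtime tau -> x <= w u.
  move=> su ur; have [|z [Fz sz zu]] := Happ (u - s); first lra.
  by apply: (@fibre_between tau 0 0 u z (tree_repr tau)) => //; lra.
apply: fibre_intro => //; first lra.
- rewrite leNgt; apply/negP => xl.
  have [||e e0 He] := lower_lsc cw _ _ xl; [lra|lra|].
  have [z [Fz sz ze]] := Happ e e0.
  have /andP[+ _] := fibre_lower Fz; rewrite leNgt => /negP; apply.
  by have [? ?] := graph_time (fibre_graph cw Fz); apply: He; lra.
- exact: (upper_right cw _ rs r1).
- by move=> u [] /andP[u1 u2]; [exact: Hw | lra].
Qed.

Lemma fibre_last_time tau : fibre tau (last_time tau, level tau).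
Proof.
set s := last_time tau; set x := level tau.
have [r0 r1] := rtime01 tau; have Fr := fibre_repr tau.
have sr : rtime tau <= s := last_time_ge Fr.
have hi : has_sup (fst @` fibre tau).
  split; first by exists (rtime tau), (tree_repr tau).
  by exists 1 => _ [y /(fibre_graph cw)/graph_time[_ y0] <-].
have s0 : s <= 1.
  by apply: ge_sup => [|_ [y /(fibre_graph cw)/graph_time[_ y0] <-]//]; case: hi.
have [[z Fz zs]|Hn] := pselect (exists2 z, fibre tau z & z.1 = s).
  by rewrite -zs /x -(level_fibre cw Fz); case: z Fz {zs}.
have Happ e : 0 < e -> exists z, [/\ fibre tau z, z.1 < s & s - e < z.1].
  move=> e0; have [_ [z Fz <-] ze] := sup_adherent e0 hi.
  exists z; split=> //; rewrite lt_neqAle (last_time_ge Fz) andbT.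
  by apply/eqP => E; apply: Hn; exists z.
have rs : rtime tau < s.
  by rewrite lt_neqAle sr andbT; apply/eqP => E; apply: Hn; exists (tree_repr tau).
have Hw u : u < s -> rtime tau < u -> x <= w u.
  move=> su ur; have [|z [Fz sz zu]] := Happ (s - u); first lra.
  by apply: (@fibre_between tau 0 0 u (tree_repr tau) z) => //; lra.
apply: fibre_intro => //; first lra.
- rewrite leNgt; apply/negP => xl.
  have [||e e0 He] := lower_lsc cw _ _ xl; [lra|lra|].
  have [z [Fz sz ze]] := Happ e e0.
  have /andP[+ _] := fibre_lower Fz; rewrite leNgt => /negP; apply.
  by have [? ?] := graph_time (fibre_graph cw Fz); apply: He; lra.
- by apply: (upper_left cw r0 rs s0) => *; apply: Hw.
- by move=> u [] /andP[u1 u2]; [lra | exact: Hw].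
Qed.

Lemma first_time01 tau : 0 <= first_time tau <= 1.
Proof. by have [-> ->] := graph_time (fibre_graph cw (fibre_first_time tau)). Qed.

Lemma last_time01 tau : 0 <= last_time tau <= 1.
Proof. by have [-> ->] := graph_time (fibre_graph cw (fibre_last_time tau)). Qed.

Lemma first_le_last tau : first_time tau <= last_time tau.
Proof. exact: (first_time_le (fibre_last_time tau)). Qed.

(** Turns closeness in the tree into a statement about one graph point with slack [e]; letting [e]
    tend to 0 shows that the sets defining the first and last times are closed. *)
Lemma approx_fibre tau (D : set R) :
  (forall e, 0 < e -> exists2 sigma, (exists2 z, fibre sigma z & D z.1) &
     tree_dist sigma tau < e) ->
  forall e, 0 < e -> exists z, [/\ D z.1, filled_graph w z,
    z.2 <= level tau + e & above w (level tau - e) z (tree_repr tau)].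
Proof.
move=> H e /H[sigma [z Fz Dz] d]; exists z.
have Gz := fibre_graph cw Fz; split=> //.
  rewrite (level_fibre cw Fz); have := tree_dist_ge cw sigma tau.
  by move=> /le_lt_trans/(_ d); rewrite ltr_norml => /andP[]; lra.
apply/(tmeet_fibre cw _ Fz (fibre_repr tau)).
move: d; rewrite tree_distE; have := tmeet_le1 cw sigma tau; lra.
Qed.

Lemma measurable_first_time : measurable_fun setT (@first_time R w : borel_tree w -> R).
Proof.
(* As the infimum is attained, this set is that of [first_time tau <= c]. It is closed, so
   [first_time] is lower semicontinuous; dually [last_time] is upper semicontinuous. *)
suff Hm c : measurable ([set tau | exists2 z, fibre tau z & z.1 <= c] : set (borel_tree w)).
  apply: (measurability _ (RGenOInfty.measurableE R)) => _ -[_ [c ->] <-].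
  rewrite setTI -(setCK (_ @^-1` _)); apply: measurableC.
  rewrite (_ : ~` _ = [set tau | exists2 z, fibre tau z & z.1 <= c]) //.
  apply/seteqP; split=> tau /=; rewrite in_itv /= andbT.
    move=> /negP; rewrite -leNgt => h; exists (first_time tau, level tau) => //.
    exact: fibre_first_time.
  by case=> z /first_time_le h zc; apply/negP; rewrite -leNgt; lra.
apply: closed_measurable => tau H /=; have A := @approx_fibre tau (fun s => s <= c) H.
have [Hrc|crt] := leP (rtime tau) c; first by exists (tree_repr tau) => //; exact: fibre_repr.
have [r0 r1] := rtime01 tau.
have Hw u : c < u -> u < rtime tau -> level tau <= w u.
  move=> cu ur; apply/ler_addgt0Pr => e /A[z [zc _ _ [_ _ K]]].
  by have := K u; rewrite -/(rtime tau) => /(_ (or_introl _)) h;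
    have : level tau - e <= w u; [apply: h; apply/andP; split=> //; lra | lra].
have c0 : 0 <= c.
  by have [z [zc /graph_time[z0 _] _ _]] := A 1 ltr01; lra.
(* The approximating graph points have times before [c] that need not converge to a point of the
   fibre; a time where [lower w] attains the level, and then the last one before [c], supplies
   it. *)
have [||||u [u0 uc lu]] := @lower_attain _ _ cw 0 c (level tau) => //; first lra.
  move=> e /A[z [zc Gz zl _]]; have [? ?] := graph_time Gz.
  by exists z.1; split=> //; apply: le_trans zl; case: Gz => _ /andP[].
have [|| s [s0 sc ls Hs]] := @left_hit _ _ cw c (level tau) c0; [lra|by exists u|].
exists (s, level tau) => //=.
have [sc'|cs] := ltP s c.
  apply: fibre_intro => //; first lra.
    apply: (upper_right cw s0 sc'); first lra.
    by move=> v sv vc; apply/ltW/(lt_le_trans (Hs v sv (ltW vc)))/lower_le.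
  move=> v [] /andP[sv vr]; last lra.
  have [vc|cv] := leP v c; last exact: Hw.
  by apply/ltW/(lt_le_trans (Hs v sv vc))/lower_le.
have E : s = c by apply/eqP; rewrite eq_le sc.
rewrite E; apply: fibre_intro => //; [lra|by rewrite -E| |].
  exact: (upper_right cw c0 crt r1).
by move=> v [] /andP[sv vr]; [exact: Hw | lra].
Qed.

Lemma measurable_last_time : measurable_fun setT (@last_time R w : borel_tree w -> R).
Proof.
suff Hm c : measurable ([set tau | exists2 z, fibre tau z & c <= z.1] : set (borel_tree w)).
  apply: (measurability _ (RGenCInfty.measurableE R)) => _ -[_ [c ->] <-].
  rewrite setTI.
  rewrite (_ : _ @^-1` _ = [set tau | exists2 z, fibre tau z & c <= z.1]) //.
  apply/seteqP; split=> tau /=; rewrite in_itv /= andbT.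
    by move=> h; exists (last_time tau, level tau) => //; exact: fibre_last_time.
  by case=> z /last_time_ge h zc; lra.
apply: closed_measurable => tau H /=; have A := @approx_fibre tau (fun s => c <= s) H.
have [Hrc|crt] := leP c (rtime tau); first by exists (tree_repr tau) => //; exact: fibre_repr.
have [r0 r1] := rtime01 tau.
have Hw u : rtime tau < u -> u < c -> level tau <= w u.
  move=> cu ur; apply/ler_addgt0Pr => e /A[z [zc _ _ [_ _ K]]].
  by have := K u; rewrite -/(rtime tau) => /(_ (or_intror _)) h;
    have : level tau - e <= w u; [apply: h; apply/andP; split=> //; lra | lra].
have c1 : c <= 1.
  by have [z [zc /graph_time[_ z1] _ _]] := A 1 ltr01; lra.
have [||||u [u0 uc lu]] := @lower_attain _ _ cw c 1 (level tau) => //; first lra.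
  move=> e /A[z [zc Gz zl _]]; have [? ?] := graph_time Gz.
  by exists z.1; split=> //; apply: le_trans zl; case: Gz => _ /andP[].
have [|||s [s0 sc ls Hs]] := @right_hit _ _ cw c (level tau); [lra|done|by exists u|].
exists (s, level tau) => //=.
have [sc'|cs] := ltP c s.
  apply: fibre_intro => //; first lra.
    apply: (upper_left cw _ sc' sc); first lra.
    by move=> v sv vc; apply/ltW/(lt_le_trans (Hs v (ltW sv) vc))/lower_le.
  move=> v [] /andP[sv vr]; first lra.
  have [vc|cv] := leP c v; last exact: Hw.
  by apply/ltW/(lt_le_trans (Hs v vc vr))/lower_le.
have E : s = c by apply/eqP; rewrite eq_le cs.
rewrite E; apply: fibre_intro => //; [lra|by rewrite -E| |].
  by apply: (upper_left cw r0 crt c1) => *; apply: Hw.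
by move=> v [] /andP[sv vr]; [lra | exact: Hw].
Qed.

Lemma measurable_Delta rho : measurable_fun (`[0, 1] : set R) rho ->
  measurable_fun setT (Delta rho : borel_tree w -> R).
Proof.
move=> mrho.
have aux (sigma : tree w) (f : borel_tree w -> R) : measurable_fun setT f -> (forall tau, 0 <= f tau <= 1) ->
    measurable_fun setT (fun tau : borel_tree w =>
      if `[< arc (tree_O w) sigma tau >] then 0 else rho (f tau)).
  move=> mf f01; have mA := measurable_arc sigma.
  rewrite (_ : (fun _ => _) = (rho \o f) \* \1_(~` (arc (tree_O w) sigma))).
    apply: measurable_funM; last by apply: measurable_indic; exact: measurableC.
    apply: (measurable_comp _ _ mrho mf) => //.
    by move=> _ [tau _ <-] /=; rewrite in_itv /=.
  apply/funext => tau /=; rewrite indicE; case: asboolP => h.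
    by rewrite memNset ?mulr0 //= => /(_ h).
  by rewrite mem_set ?mulr1.
apply: measurable_funB.
  by apply: aux => [|tau]; [exact: measurable_first_time | exact: first_time01].
by apply: aux => [|tau]; [exact: measurable_last_time | exact: last_time01].
Qed.

End TreeMeasurable.

(** * The length measure on arcs *)

Section ArcMeasure.
Context {R : realType} (w : R -> R) (cw : cadlag w).
Context (lam : {measure set (borel_tree w) -> \bar R}) (hlam : length_measure lam).
Implicit Types (z : R * R) (c x t u : R) (tau sigma : tree w).
Local Notation mu := (@lebesgue_measure R).

Lemma lam_tle sigma :
  lam [set tau | tle tau sigma] = (level sigma - minw w)%:E.
Proof.
have [_ /(_ (tree_O w) sigma)] := hlam.
rewrite (_ : arc _ _ = [set tau | tle tau sigma]); last first.
  by apply/seteqP; split=> tau /(arc_rootP cw).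
by move=> ->; have /(tle_dist cw) -> := root_tle cw sigma; rewrite level_root.
Qed.

Lemma lam_point tau : lam [set tau] = 0%E.
Proof.
have [_ /(_ tau tau)] := hlam; rewrite arc_point // => ->.
by rewrite tree_distE tmeetxx; congr EFin; lra.
Qed.

(* The value off [O, sigma] only has to be negative. *)
Definition depth sigma (tau : borel_tree w) : R :=
  (level sigma - level tau + 1) * \1_[set tau | tle tau sigma] tau - 1.

Lemma depthE sigma tau : tle tau sigma -> depth sigma tau = level sigma - level tau.
Proof. by move=> h; rewrite /depth indicE mem_set // mulr1 addrK. Qed.

Lemma depthN sigma tau : ~ tle tau sigma -> depth sigma tau = -1.
Proof. by move=> h; rewrite /depth indicE memNset // mulr0 add0r. Qed.

Lemma measurable_depth sigma : measurable_fun setT (depth sigma).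
Proof.
apply: measurable_funB => //; apply: measurable_funM.
  apply: measurable_funD => //; apply: measurable_funB => //.
  exact: measurable_level.
by apply: measurable_indic; exact: measurable_tle.
Qed.

(** The points at depth at least [y] are the ancestors of one point, hence an arc from the root,
    whose measure is prescribed. In the degenerate cases the set is the root alone or empty. *)
Lemma depth_ray sigma y :
  lam (depth sigma @^-1` (`[y, +oo[ `&` `[0, level sigma - minw w])) =
  mu (`[y, +oo[ `&` `[0, level sigma - minw w]).
Proof.
set H := level sigma - minw w.
have H0 : 0 <= H by rewrite subr_ge0; exact: minw_level.
have -> : `[y, +oo[ `&` `[0, H] = `[Num.max 0 y, H]%classic.
  apply/seteqP; split=> a /=; rewrite !in_itv /= ge_max andbT.
    by case=> -> /andP[-> ->].
  by move=> /andP[/andP[-> ->] ->].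
rewrite lebesgue_measure_itv /= lte_fin.
case: ltP => [yH|Hy].
  have m0 : 0 <= Num.max 0 y by rewrite le_max lexx.
  have [||tx lx] := @ancP _ _ cw sigma (level sigma - Num.max 0 y).
  - by rewrite /H in yH; lra.
  - by lra.
  rewrite [X in lam X](_ : _ = [set tau | tle tau (anc sigma (level sigma - Num.max 0 y))]).
    by rewrite lam_tle lx -EFinB; congr EFin; rewrite /H; lra.
  apply/seteqP; split=> tau /=; rewrite in_itv /=.
    have [h|h] := pselect (tle tau sigma).
      by rewrite depthE // => /andP[h1 h2]; apply: (tle_chain cw h tx); rewrite lx; lra.
    by rewrite depthN // => /andP[] *; exfalso; lra.
  move=> h; have h' := tle_trans cw h tx; rewrite depthE //.
  have := tle_level cw h; rewrite lx; have := minw_level cw tau; rewrite /H.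
  by move=> ? ?; apply/andP; split; lra.
have [yH|yH] := eqVneq (Num.max 0 y) H.
  rewrite yH [X in lam X](_ : _ = [set tree_O w]) ?lam_point //.
  apply/seteqP; split=> tau /=; rewrite in_itv /=.
    have [h|h] := pselect (tle tau sigma).
      rewrite depthE // => /andP[h1 h2].
      apply: (tle_uniq cw h (root_tle cw sigma)); rewrite level_root //.
      by move: h1 h2; rewrite /H; lra.
    by rewrite depthN // => /andP[] *; exfalso; lra.
  by move=> ->; rewrite depthE ?level_root ?lexx //; exact: root_tle.
rewrite [X in lam X](_ : _ = set0) ?measure0 //; apply/seteqP; split=> // tau /=.
rewrite in_itv /= => /andP[h1 h2].
by move/negP: yH; apply; rewrite eq_le Hy (le_trans h1 h2).
Qed.

(** Both measures agree on the rays, which are stable under intersection and generate the Borel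
    sets. Restricting to [[0, H]] makes them finite there, as uniqueness demands. *)
Lemma depth_pushforward sigma (X : set R) : measurable X ->
  X `<=` `[0, level sigma - minw w] -> pushforward lam (depth sigma) X = mu X.
Proof.
set H := level sigma - minw w.
move=> mX XH; have mI : measurable (`[0, H]%classic : set (measurableTypeR R)) by [].
pose nu : {measure set (measurableTypeR R) -> \bar R} :=
  pushforward lam (depth sigma : _ -> measurableTypeR R).
pose nu' := nu (measurable_depth sigma).
pose m1 : {measure set (measurableTypeR R) -> \bar R} := mrestr nu' mI.
pose m2 : {measure set (measurableTypeR R) -> \bar R} := mrestr mu mI.
have key A : measurable A -> m1 A = m2 A.
  apply: (@measure_unique _ R (measurableTypeR R) [set A | exists x, A = `[x, +oo[%classic]
     (fun n => `[- n%:R, +oo[%classic) _ _ _ _ m1 m2).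
  - exact: RGenCInfty.measurableE.
  - move=> _ _ [x ->] [y ->]; exists (Num.max x y).
    by apply/seteqP; split=> a /=; rewrite !in_itv /= !andbT ge_max => /andP.
  - by move=> n; exists (- n%:R).
  - apply/seteqP; split=> // a _; exists (Num.truncn `|a|).+1 => //=.
    rewrite in_itv /= andbT lerNl; apply: (le_trans (ler_norm _)).
    by rewrite normrN; apply/ltW/truncnS_gt.
  - move=> _ [y ->]; exact: depth_ray.
  - move=> n; rewrite [X in (X < _)%E](_ : _ = mu (`[- n%:R, +oo[ `&` `[0, H])).
      apply: (@le_lt_trans _ _ (mu `[0, H])).
        by apply: le_measure; rewrite ?inE //; first [exact: measurableI | exact: subIsetr].
      by rewrite lebesgue_measure_itv /=; case: ifP; rewrite -?EFinB ltry.
    exact: depth_ray.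
by have := key X mX; rewrite /m1 /m2 /= /mrestr (setIidl XH).
Qed.

(** The parametrization of an arc by depth is an isometry, so preimages of open sets are open. *)
Lemma measurable_anc sigma l : l <= level sigma - minw w ->
  measurable_fun `]0, l[ (fun a => anc sigma (level sigma - a) : borel_tree w).
Proof.
move=> lH; apply: (@measurability _ _ R (borel_tree w) `]0, l[ _ (@tree_open R w) erefl) => _ [V Vo <-].
apply: open_measurable; rewrite openE => a /= []; rewrite in_itv /= => /andP[a0 al] Va.
have [e e0 He] := Vo _ Va.
rewrite /interior; near=> b.
have ba : `|a - b| < Num.min e (Num.min a (l - a)).
  near: b; apply: nbhsx_ballx; rewrite !lt_min e0; lra.
move: ba; rewrite !lt_min => /and3P[be b0 bl].
have [b0' bl'] : 0 < b /\ b < l.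
  by move: b0 bl; rewrite !ltr_norml => /andP[] ? ? /andP[]; lra.
split=> /=; first by rewrite in_itv /= b0' bl'.
apply: He.
have [||ta la] := @ancP _ _ cw sigma (level sigma - a); [lra|lra|].
have [||tb lb] := @ancP _ _ cw sigma (level sigma - b); [lra|lra|].
rewrite (dist_chain cw ta tb) la lb distrC.
by have -> : level sigma - b - (level sigma - a) = a - b by lra.
Unshelve. all: by end_near. Qed.

Lemma arc_integral sigma l (f : borel_tree w -> \bar R) :
  l <= level sigma - minw w -> measurable_fun setT f -> (forall tau, 0 <= f tau)%E ->
  (\int[lam]_(tau in [set tau | tle tau sigma /\ (0 < level sigma - level tau < l)%R]) f tau
   = \int[mu]_(a in `]0%R, l[) f (anc sigma (level sigma - a)%R))%E.
Proof.
move=> lH mf f0.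
pose g a := f (anc sigma (level sigma - a)).
have mg : measurable_fun `]0, l[ g.
  by apply: (measurable_comp _ _ mf (measurable_anc lH)).
have -> : [set tau | tle tau sigma /\ 0 < level sigma - level tau < l] =
    depth sigma @^-1` `]0, l[.
  apply/seteqP; split=> tau /=; rewrite in_itv /=.
    by move=> [h]; rewrite depthE.
  have [h|h] := pselect (tle tau sigma); first by rewrite depthE.
  by rewrite depthN // => /andP[] *; exfalso; lra.
transitivity (\int[lam]_(tau in depth sigma @^-1` `]0%R, l[) (g \o depth sigma) tau)%E.
  apply: eq_integral => tau; rewrite inE /= in_itv /=.
  have [h|h] := pselect (tle tau sigma); last by rewrite depthN // => /andP[] *; exfalso; lra.
  rewrite /g /= depthE // => _; congr (f _).
  by have -> : level sigma - (level sigma - level tau) = level tau; [lra | rewrite ancE].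
pose nu : {measure set (measurableTypeR R) -> \bar R} :=
  pushforward lam (depth sigma : _ -> measurableTypeR R).
transitivity (\int[nu (measurable_depth sigma)]_(a in `]0%R, l[) g a)%E.
  by rewrite (@ge0_integral_pushforward _ _ _ (measurableTypeR R) _ _
    (measurable_depth sigma)) // => y _; exact: f0.
apply: (@eq_measure_integral _ (measurableTypeR R) R _ mu (nu (measurable_depth sigma))) => A mA Al.
apply: depth_pushforward => // a /Al /=.
by rewrite !in_itv /= => /andP[? ?]; apply/andP; split; lra.
Qed.

End ArcMeasure.

(** * Subtrees spanned by grid nodes *)

Section Grid.
Context {R : realType} (w : R -> R) (cw : cadlag w).
Implicit Types (z : R * R) (a c x t u : R) (tau sigma : tree w) (N : nat).

Definition gtime N (k : 'I_N.+2) : R := k%:R / N.+1%:R.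
Arguments gtime : clear implicits.

Lemma gtime01 N k : 0 <= gtime N k /\ gtime N k <= 1.
Proof.
rewrite /gtime; split; first exact: divr_ge0.
by rewrite ler_pdivrMr ?ltr0n // mul1r ler_nat -ltnS.
Qed.

Lemma gtime_lt N (j k : 'I_N.+2) : (j < k)%N -> gtime N j < gtime N k.
Proof. by move=> jk; rewrite /gtime ltr_pM2r ?ltr_nat // invr_gt0 ltr0n. Qed.

Definition gnode N k : tree w := node w (gtime N k).
Definition glevel N k : R := w (gtime N k).
Arguments gnode : clear implicits.
Arguments glevel : clear implicits.

Lemma level_gnode N k : level (gnode N k) = glevel N k.
Proof. by have [? ?] := gtime01 k; rewrite level_node. Qed.

(* The grid nodes are ordered by decreasing level. Branch [k] goes from node [k]
   down to level [branch k], where it meets the subtree spanned by the nodes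
   preceding it; the branches fill the subtree spanned by all grid nodes, and
   [active N a k] says that branch [k] is longer than [a]. *)
Definition prec N (j k : 'I_N.+2) : bool :=
  (glevel N k < glevel N j) || ((glevel N j == glevel N k) && (j < k)%N).

Definition branch N (k : 'I_N.+2) : R :=
  \big[Num.max/minw w]_(j | prec j k) tmeet (gnode N j) (gnode N k).
Arguments branch : clear implicits.

Definition active N a k : bool := a < glevel N k - branch N k.
Arguments active : clear implicits.

Lemma minw_branch N k : minw w <= branch N k.
Proof. exact: bigmax_ge_id. Qed.

Lemma tmeet_branch N j k : prec j k -> tmeet (gnode N j) (gnode N k) <= branch N k.
Proof.
by move=> jk; apply: (le_bigmax_cond _ (fun j => tmeet (gnode N j) (gnode N k))).
Qed.

Lemma prec_total N (j k : 'I_N.+2) : (j < k)%N -> prec j k || prec k j.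
Proof.
move=> jk; rewrite /prec; case: (ltgtP (glevel N j) (glevel N k)) => //= _.
by rewrite jk.
Qed.

(** Whichever node comes second for [prec] is the lower one, and its branch starts at or above the
    meet of the two. Being active, it has its level minus [a] above that meet, so [w] drops below
    this value between the two times; the same value serves for the higher node. *)
Lemma active_separated N a (j k : 'I_N.+2) : 0 <= a -> (j < k)%N ->
  active N a j -> active N a k -> exists u, [/\ gtime N j < u, u < gtime N k,
    w u < glevel N j - a & w u < glevel N k - a].
Proof.
move=> a0 jk aj ak; have tjk := gtime_lt jk.
have [j0 j1] := gtime01 j; have [k0 k1] := gtime01 k.
have Fj := fibre_node w j0 j1; have Fk := fibre_node w k0 k1.
have key x : x <= glevel N j - a -> x <= glevel N k - a ->
    tmeet (gnode N j) (gnode N k) < x ->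
    exists u, [/\ gtime N j < u, u < gtime N k,
      w u < glevel N j - a & w u < glevel N k - a].
  move=> xj xk; apply: contraPP => H; apply/negP; rewrite -leNgt.
  apply/(tmeet_fibre cw _ Fj Fk); split => /=.
  - by rewrite -/(glevel N j); lra.
  - by rewrite -/(glevel N k); lra.
  - move=> u [] /andP[u1 u2]; last by have := lt_trans u1 u2; rewrite ltNge ltW.
    rewrite leNgt; apply/negP => ux; apply: H; exists u.
    by split=> //; apply: lt_le_trans ux _.
move: aj ak; rewrite /active.
have /orP[h|h] := prec_total jk.
  have hb := tmeet_branch h; have hl : glevel N k <= glevel N j.
    by case/orP: h => [/ltW //|/andP[/eqP -> _]].
  move=> _ ak; apply: (key (glevel N k - a)) => //; first by rewrite lerD2r.
  by apply: (le_lt_trans hb); rewrite ltrBrDl -ltrBrDr.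
have hb := tmeet_branch h; have hl : glevel N j <= glevel N k.
  by case/orP: h => [/ltW //|/andP[/eqP -> _]].
rewrite (tmeetC cw (gnode N k) (gnode N j)) in hb.
move=> aj _; apply: (key (glevel N j - a)) => //; first by rewrite lerD2r.
by apply: (le_lt_trans hb); rewrite ltrBrDl -ltrBrDr.
Qed.

(** Among the nodes above [tau], take the first for [prec]: maximal level, then least index. A
    predecessor meeting it at [tau] or higher would itself be above [tau], against the choice. *)
Lemma branch_cover N tau : minw w < level tau ->
  (exists k, tle tau (gnode N k) /\ level tau < glevel N k) ->
  exists k, [/\ tle tau (gnode N k), level tau < glevel N k &
    branch N k < level tau].
Proof.
move=> mt [k0 [/asboolP P0 l0]].
case: (@Order.TotalTheory.arg_maxP _ _ _ k0 (fun k => `[< tle tau (gnode N k) >])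
  (glevel N) P0) => k1 P1 max1.
have Q1 : `[< tle tau (gnode N k1) >] && (glevel N k1 == glevel N k1) by rewrite P1 eqxx.
case: (@arg_minnP _ k1 (fun k => `[< tle tau (gnode N k) >] &&
  (glevel N k == glevel N k1)) (fun k => nat_of_ord k) Q1) => k /andP[Pk /eqP lk] mink.
exists k; split; first exact/asboolP.
  by rewrite lk; apply: (lt_le_trans l0); exact: max1.
apply: bigmax_lt => // j pjk; rewrite ltNge; apply/negP => h.
have tj : tle tau (gnode N j).
  by apply: (tmeet_ultra cw) (_ : level tau <= tmeet (gnode N k) _);
    [exact/asboolP | rewrite tmeetC].
have /asboolP Pj := tj; have lj := max1 j Pj.
case/orP: pjk => [|/andP[/eqP e jk]]; first by rewrite lk; move: lj => /=; rewrite leNgt => /negP.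
by have := mink j; rewrite Pj e lk eqxx => /(_ isT); rewrite leqNgt jk.
Qed.

Lemma grid_in_itv (al be : R) : 0 <= al -> al < be -> be <= 1 ->
  exists N0, forall N, (N0 <= N)%N -> exists k, al < gtime N k /\ gtime N k < be.
Proof.
move=> a0 ab b1; exists (Num.truncn (be - al)^-1) => N HN.
have N0 : (0 : R) < N.+1%:R by rewrite ltr0n.
have hN : 1 < (be - al) * N.+1%:R.
  rewrite -ltr_pdivrMl ?mulr1 ?subr_gt0 //; apply: (lt_le_trans (truncnS_gt _)).
  by rewrite ler_nat.
have aN : 0 <= al * N.+1%:R by rewrite mulr_ge0 // ltW.
have := truncn_itv aN; set m := Num.truncn _ => /andP[m1 m2].
have mb : m.+1%:R < be * N.+1%:R.
  by move: hN m1; rewrite -natr1 mulrBl; set A := al * _; set B := be * _; lra.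
have mN : (m.+1 < N.+2)%N.
  rewrite ltnS -(ler_nat R); apply: ltW; apply: (lt_le_trans mb).
  by rewrite ler_piMl // ltW.
exists (Ordinal mN); rewrite /gtime /=.
by rewrite ltr_pdivlMr // ltr_pdivrMr.
Qed.

Definition nonleaf tau : Prop := exists sigma, tle tau sigma /\ level tau < level sigma.

(** Next to the time of [sigma], on the side where [w] or its left limit exceeds the level of [tau],
    there is an interval on which [w] exceeds it, and every fine enough grid meets that interval.
    The only case without such an interval is the time 1, which is always in the grid. *)
Lemma nonleaf_grid tau : nonleaf tau -> exists N0, forall N, (N0 <= N)%N ->
  exists k, tle tau (gnode N k) /\ level tau < glevel N k.
Proof.
move=> [sigma [ts ls]]; set x := level tau in ls *.
have Fs := fibre_repr sigma; have [s0 s1] := rtime01 sigma.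
have key t : 0 <= t -> t <= 1 -> x < w t ->
    (forall u, rtime sigma < u < t \/ t < u < rtime sigma -> x <= w u) ->
    tle tau (node w t).
  move=> t0 t1 xt H; apply: (tmeet_ultra cw ts).
  apply/(tmeet_fibre cw _ Fs (fibre_node w t0 t1)); split=> //=; exact: ltW.
have key2 al be : 0 <= al -> al < be -> be <= 1 ->
    (forall t, al < t -> t < be -> x < w t) ->
    (al = rtime sigma \/ be = rtime sigma) ->
    exists N0, forall N, (N0 <= N)%N ->
      exists k, tle tau (gnode N k) /\ x < glevel N k.
  move=> a0 ab b1 H ars; have [N0 HN] := grid_in_itv a0 ab b1; exists N0 => N /HN[k [k1 k2]].
  have xk := H _ k1 k2; have [? ?] := gtime01 k; exists k; split=> //; apply: key => //.
  by move=> u hu; apply/ltW/H; case: hu => /andP[? ?]; case: ars => E; lra.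
have : x < upper w (rtime sigma).
  by apply: (lt_le_trans ls); have /andP[] := fibre_lower cw Fs.
rewrite /upper lt_max => /orP[xl|xw].
  have [s00|sn0] := eqVneq (rtime sigma) 0.
    move: xl; rewrite s00 left_lim0 // => xw; have [d d0 Hd] := right_gt cw (lexx 0) ltr01 xw.
    apply: (key2 0 (Num.min d 1)) => //.
    - by rewrite lt_min d0 ltr01.
    - by rewrite ge_min lexx orbT.
    - by move=> t t0; rewrite lt_min => /andP[td _]; apply: Hd; lra.
    - by left.
  have s0' : 0 < rtime sigma by rewrite lt_neqAle eq_sym sn0.
  have [d d0 Hd] := left_gt cw s0' s1 xl.
  apply: (key2 (Num.max 0 (rtime sigma - d)) (rtime sigma)) => //.
  - by rewrite le_max lexx.
  - by rewrite gt_max s0'; lra.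
  - by move=> t; rewrite gt_max => /andP[t0 td] ts'; apply: Hd.
  - by right.
have [s11|sn1] := eqVneq (rtime sigma) 1.
  exists 0%N => N _; exists ord_max.
  have E : gtime N ord_max = 1 by rewrite /gtime /= divff // pnatr_eq0.
  rewrite /gnode /glevel E; rewrite s11 in xw key; split=> //.
  by apply: key => // u [] /andP[]; lra.
have s1' : rtime sigma < 1 by rewrite lt_neqAle sn1.
have [d d0 Hd] := right_gt cw s0 s1' xw.
apply: (key2 (rtime sigma) (Num.min (rtime sigma + d) 1)) => //.
- by rewrite lt_min s1'; lra.
- by rewrite ge_min lexx orbT.
- by move=> t t0; rewrite lt_min => /andP[td _]; apply: Hd => //; exact: ltW.
- by left.
Qed.

Definition below N : set (tree w) :=
  [set tau | exists k, tle tau (gnode N k) /\ level tau < glevel N k].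

Lemma measurable_below N : measurable (below N : set (borel_tree w)).
Proof.
rewrite (_ : below N = \bigcup_(k in [set: 'I_N.+2])
  ([set tau | tle tau (gnode N k)] `&` [set tau | level tau < glevel N k])).
  apply: fin_bigcup_measurable => // k _; apply: measurableI.
    exact: measurable_tle.
  rewrite -[X in measurable X]setTI.
  rewrite (_ : [set tau | level tau < glevel N k] =
     (@level R w : borel_tree w -> R) @^-1` `]-oo, glevel N k[).
    exact: measurable_level.
  by apply/seteqP; split=> tau /=; rewrite in_itv.
by apply/seteqP; split=> [tau [k [? ?]]|tau [k _ [? ?]]]; exists k.
Qed.

Lemma nonleafE : nonleaf = \bigcup_N below N.
Proof.
apply/seteqP; split=> [tau /nonleaf_grid[N H]|tau [N _ [k [? ?]]]].
  by exists N => //; exact: (H N).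
by exists (gnode N k); rewrite level_gnode.
Qed.

Lemma measurable_nonleaf : measurable (nonleaf : set (borel_tree w)).
Proof. by rewrite nonleafE; apply: bigcupT_measurable => N; exact: measurable_below. Qed.

Lemma leavesE : leaves (w := w) = ~` nonleaf.
Proof.
apply/seteqP; split=> tau H.
  move=> [sigma [ts ls]]; apply: (H sigma); last exact/(arc_rootP cw).
  by apply/eqP => E; move: ls; rewrite E ltxx.
move=> sigma st /(arc_rootP cw) ts; apply: H; exists sigma; split=> //.
rewrite lt_neqAle (tle_level cw ts) andbT; apply: contra_neq st => e.
by rewrite (tle_eq cw ts e).
Qed.

End Grid.
Arguments gtime {R} N k.
Arguments gnode {R} w N k.
Arguments glevel {R} w N k.
Arguments branch {R} w N k.
Arguments active {R} w N a k.

Section Slice.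
Context {R : realType} (w : R -> R) (cw : cadlag w).
Context (lam : {measure set (borel_tree w) -> \bar R}) (hlam : length_measure lam).
Local Notation mu := (@lebesgue_measure R).

Lemma lam_leaves_root : lam ((~` @nonleaf R w) `|` [set tree_O w]) = 0%E.
Proof.
have mN := measurableC (measurable_nonleaf cw).
have h1 : lam (~` @nonleaf R w) = 0%E by rewrite -leavesE //; case: hlam => ->.
have h2 : lam [set tree_O w] = 0%E by apply: lam_point.
have : (lam ((~` @nonleaf R w) `|` [set tree_O w]) <=
    lam (~` @nonleaf R w) + lam [set tree_O w])%E.
  exact: (measureU2 lam mN (measurable_point cw (tree_O w))).
rewrite h1 h2 adde0 => h; apply/eqP; rewrite eq_le h measure_ge0 //.
Qed.

(** The open branches [S k] cover the part of the subtree above the root, so [f] is at most the sum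
    of its restrictions to them. On each branch [arc_integral] passes to the distance [a] from the
    tip; exchanging sum and integral leaves the active branches at each [a]. *)
Lemma slice_below N (f : borel_tree w -> \bar R) (g : R -> \bar R) :
  measurable_fun setT f -> (forall tau, 0 <= f tau)%E ->
  measurable_fun (`]0, +oo[ : set R) g ->
  (forall a, 0 < a -> (\sum_(k | active w N a k)
     f (anc (gnode w N k) (glevel w N k - a)%R) <= g a)%E) ->
  (\int[lam]_(tau in [set tau | (minw w < level tau)%R] `&` below (w := w) N) f tau <=
   \int[mu]_(a in `]0%R, +oo[) g a)%E.
Proof.
move=> mf f0 mg fg.
pose S k : set (borel_tree w) := [set tau | tle tau (gnode w N k) /\
  0 < level (gnode w N k) - level tau < glevel w N k - branch w N k].
have lH k : glevel w N k - branch w N k <= level (gnode w N k) - minw w.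
  by rewrite level_gnode // lerD2l lerN2 minw_branch.
have mS k : measurable (S k).
  rewrite (_ : S k = depth (gnode w N k) @^-1` `]0, glevel w N k - branch w N k[).
    by rewrite -[X in measurable X]setTI; exact: measurable_depth.
  apply/seteqP; split=> tau; rewrite /S /= in_itv /=; first by case=> h; rewrite depthE.
  have [h|h] := pselect (tle tau (gnode w N k)); first by rewrite depthE.
  by rewrite depthN // => /andP[] *; exfalso; lra.
pose F k a := ((fun a => f (anc (gnode w N k) (level (gnode w N k) - a))) \_
  `]0, glevel w N k - branch w N k[) a.
have mT : measurable ([set tau | (minw w < level tau)%R] `&` below (w := w) N : set (borel_tree w)).
  apply: measurableI; last exact: measurable_below.
  rewrite -[X in measurable X]setTI.
  rewrite (_ : [set tau | minw w < level tau] =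
     (@level R w : borel_tree w -> R) @^-1` `]minw w, +oo[).
    exact: measurable_level.
  by apply/seteqP; split=> tau /=; rewrite in_itv /= andbT.
have mfS k : measurable_fun setT (f \_ (S k)).
  by apply/measurable_restrict => //; rewrite ?setTI //; exact: measurable_funS mf.
have fS0 k tau : (0 <= (f \_ (S k)) tau)%E by rewrite patchE; case: ifP.
apply: (@le_trans _ _ (\int[lam]_tau (\sum_k (f \_ (S k)) tau))%E).
  rewrite integral_mkcond; apply: ge0_le_integral => //.
  - by move=> tau _; rewrite patchE; case: ifP.
  - by apply/measurable_restrict => //; rewrite ?setTI //; exact: measurable_funS mf.
  - exact: emeasurable_sum.
  move=> tau _; rewrite patchE; case: ifPn => [|_]; last by apply: sume_ge0.
  rewrite inE /= => -[mt bt].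
  have [k [tk lk bk]] := branch_cover cw mt bt.
  have Sk : S k tau.
    by split; [exact: tk | rewrite (level_gnode cw) subr_gt0 lk /= ltrD2l ltrN2].
  have fS : (f \_ (S k)) tau = f tau.
    rewrite patchE.
    by rewrite (mem_set Sk).
  rewrite -fS.
  rewrite (bigD1 k isT).
  apply: leeDl.
  by apply: sume_ge0 => i _; exact: fS0.
rewrite ge0_integral_sum //.
rewrite (eq_bigr (fun k => \int[mu]_(a in `]0%R, +oo[) F k a)%E); last first.
  move=> k _; rewrite -integral_mkcond arc_integral //.
  rewrite [RHS]integral_mkcond [LHS]integral_mkcond; apply: eq_integral => a _.
  rewrite /F !patchE; case: ifPn => // ha; last by rewrite if_same.
  rewrite mem_set //=; rewrite in_itv /= andbT.
  by move: ha; rewrite inE /= in_itv /= => /andP[].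
have mF k : measurable_fun (`]0, +oo[ : set R) (F k).
  apply/measurable_restrict => //; rewrite setIidr; last first.
    by move=> a /=; rewrite !in_itv /= => /andP[->].
  exact: (measurable_comp _ _ mf (measurable_anc cw (lH k))).
have F0 k a : (0 <= F k a)%E by rewrite /F patchE; case: ifP.
rewrite -ge0_integral_sum //.
apply: ge0_le_integral => //.
- by move=> a _; exact: sume_ge0.
- exact: emeasurable_sum.
move=> a /=; rewrite in_itv /= andbT => a0; apply: le_trans (fg a a0).
rewrite [leRHS]big_mkcond /=; apply: lee_sum => k _.
rewrite /F patchE level_gnode // /active; case: ifPn.
  by rewrite inE /= in_itv /= => /andP[_ ->].
by case: ifP.
Qed.

(* The measure of the subtree spanned by the grid is the sum of the Lebesgue
   measures of its branches, parametrized by the distance [a] to the tip; these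
   subtrees increase to the set of non-leaves up to the root. *)
Lemma slice_integral (f : borel_tree w -> \bar R) (g : R -> \bar R) :
  measurable_fun setT f -> (forall tau, 0 <= f tau)%E ->
  measurable_fun (`]0, +oo[ : set R) g ->
  (forall N a, 0 < a -> (\sum_(k | active w N a k)
     f (anc (gnode w N k) (glevel w N k - a)%R) <= g a)%E) ->
  (\int[lam]_tau f tau <= \int[mu]_(a in `]0%R, +oo[) g a)%E.
Proof.
move=> mf f0 mg fg.
pose Z : set (borel_tree w) := (~` @nonleaf R w) `|` [set tree_O w].
have mZ : measurable (Z : set (borel_tree w)).
  by apply: measurableU; [apply: measurableC; exact: measurable_nonleaf | exact: measurable_point].
pose T N : set (borel_tree w) := [set tau | (minw w < level tau)%R] `&` below (w := w) N.
have mT N : measurable (T N).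
  apply: measurableI; last exact: measurable_below.
  rewrite -[X in measurable X]setTI.
  rewrite (_ : [set tau | minw w < level tau] =
     (@level R w : borel_tree w -> R) @^-1` `]minw w, +oo[).
    exact: measurable_level.
  by apply/seteqP; split=> tau /=; rewrite in_itv /= andbT.
have mfT N : measurable_fun setT (f \_ (T N)).
  by apply/measurable_restrict => //; rewrite ?setTI //; exact: measurable_funS mf.
have fT0 N tau : (0 <= (f \_ (T N)) tau)%E by rewrite patchE; case: ifP.
rewrite (ge0_negligible_integral mZ) //; last exact: lam_leaves_root.
have mD : measurable (setT `\` Z : set (borel_tree w)) by exact: measurableD.
(* Successive grids are not nested, so [T N] need not be monotone in [N]. But each non-leaf other
   than the root belongs to [T N] for all large [N], which is enough for Fatou's lemma. *)
rewrite (eq_integral (fun tau => limn_einf (fun N => (f \_ (T N)) tau))); last first.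
  move=> tau; rewrite inE => -[_]; rewrite /Z /setU /= => /not_orP[/contrapT tn tO].
  have mt : minw w < level tau.
    rewrite lt_neqAle minw_level // andbT; apply/eqP => e; apply: tO.
    by apply/esym/(tle_eq cw (root_tle cw tau)); rewrite level_root.
  have [N0 HN] := nonleaf_grid cw tn.
  have cv : (f \_ (T N)) tau @[N --> \oo] --> f tau.
    apply: cvg_near_cst; exists N0 => // N /= /HN bt.
    by rewrite patchE mem_set.
  by have [-> _] := cvg_limn_einf_sup cv.
have mfD N : measurable_fun (setT `\` Z : set (borel_tree w)) (f \_ (T N)) by exact: measurable_funS (mfT N).
apply: (le_trans (fatou lam mD mfD _)); first by move=> N tau _; exact: fT0.
rewrite limn_einf_lim; apply: lime_le; first exact: is_cvg_einfs.
apply: nearW => N; apply: (@le_trans _ _ (\int[lam]_(tau in setT `\` Z) (f \_ (T N)) tau)%E).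
  by apply: ereal_inf_lbound; exists N; [exact: leqnn | ].
apply: (@le_trans _ _ (\int[lam]_tau (f \_ (T N)) tau)%E).
  by apply: ge0_subset_integral => //.
by rewrite -integral_mkcond; apply: slice_below => //; exact: fg.
Qed.

End Slice.

(** * Variation *)

Section VariationSums.
Context {R : realType} (p : R) (p0 : 0 < p).
Implicit Types (f : R -> R) (x y : R) (s : seq R).

(** The sums of [pvar] with an arbitrary starting point, meant for weakly increasing lists: these
    can be concatenated and mapped by monotone functions. Dropping repetitions ([vsum_strict]) leads
    back to [pvar]. *)
Fixpoint vsum f x s : R :=
  if s is y :: s' then `|f y - f x| `^ p + vsum f y s' else 0.

Lemma vsum_ge0 f x s : 0 <= vsum f x s.
Proof. by elim: s x => //= y s IH x; rewrite addr_ge0 // powR_ge0. Qed.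

Lemma vsum_cat f x s1 s2 : vsum f x (s1 ++ s2) = vsum f x s1 + vsum f (last x s1) s2.
Proof. by elim: s1 x => /= [|y s1 IH] x; rewrite ?add0r // IH addrA. Qed.

Lemma vsum_nth f x s : \sum_(0 <= i < size s)
  `|f (nth 1 (x :: s) i.+1) - f (nth 1 (x :: s) i)| `^ p = vsum f x s.
Proof.
elim: s x => [|y s IH] x; first by rewrite big_nil.
by rewrite [size _]/= big_nat_recl //= -IH.
Qed.

Lemma powR_diff0 x : `|x - x| `^ p = 0.
Proof. by rewrite subrr normr0 powR0 // gt_eqF. Qed.

Lemma vsum_strict f x s : path <=%R x s ->
  exists s', [/\ path <%R x s', last x s' = last x s & vsum f x s' = vsum f x s].
Proof.
elim: s x => [|y s IH] x /=; first by exists [::].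
rewrite le_eqVlt => /andP[/orP[/eqP <-|xy] /IH[s' [h1 h2 h3]]].
  by exists s'; rewrite powR_diff0 add0r.
by exists (y :: s'); rewrite /= xy h3.
Qed.

Lemma vsum_pvar f x s : 0 <= x -> path <=%R x s -> last x s <= 1 ->
  ((vsum f x s)%:E <= pvar p f)%E.
Proof.
move=> x0 xs l1.
have [|s' [h1 h2 h3]] := @vsum_strict f 0 (x :: rcons s 1).
  by rewrite /= x0 rcons_path xs.
apply: (@le_trans _ _ (vsum f 0 s')%:E).
  rewrite lee_fin h3 /= -cats1 vsum_cat; have := powR_ge0 `|f x - f 0| p.
  by have := vsum_ge0 f (last x s) [:: 1]; lra.
apply: ereal_sup_ubound; exists s' => /=; last by rewrite /subdiv_pt vsum_nth.
by split=> //; rewrite h2 /= last_rcons.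
Qed.

Lemma pvar_le f (C : R) :
  (forall s, path <=%R 0 s -> last 0 s = 1 -> vsum f 0 s <= C) ->
  (pvar p f <= C%:E)%E.
Proof.
move=> H; apply: ge_ereal_sup => _ [s [ps /eqP ls] <-].
rewrite /subdiv_pt vsum_nth lee_fin; apply: H => //.
by apply: sub_path ps => ? ? /ltW.
Qed.

Lemma pvar_ge0 f : (0 <= pvar p f)%E.
Proof. by have := @vsum_pvar f 0 [::] (lexx 0) isT ler01. Qed.

Definition vbounded f (B : R) : Prop :=
  forall x s, 0 <= x -> path <=%R x s -> last x s <= 1 -> vsum f x s <= B.

Lemma pvar_vbounded f (B : R) : (pvar p f <= B%:E)%E <-> vbounded f B.
Proof.
split=> [h x s x0 xs ls|H]; last by apply: pvar_le => s ps ls; apply: H; rewrite // ls.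
by rewrite -lee_fin; apply: le_trans h; apply: vsum_pvar.
Qed.

(** The [p]-variation of [f] on [[x, y]]; its superadditivity ([lvar_add]) drives all counting
    arguments. *)
Definition lvar f x y : R :=
  sup [set vsum f x s | s in [set s | path <=%R x s /\ last x s = y]].

Section Bounded.
Context (f : R -> R) (B : R) (fB : vbounded f B).

Lemma vbounded_ge0 : 0 <= B.
Proof. exact: (fB (x := 0) (s := [::])). Qed.

Lemma lvar_has_sup x y : 0 <= x -> x <= y -> y <= 1 ->
  has_sup [set vsum f x s | s in [set s | path <=%R x s /\ last x s = y]].
Proof.
move=> x0 xy y1; split; first by exists (vsum f x [:: y]), [:: y] => //=; rewrite xy.
by exists B => _ [s [ps ls] <-]; apply: fB; rewrite // ls.
Qed.

Lemma lvar_ge x s : 0 <= x -> path <=%R x s -> last x s <= 1 ->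
  vsum f x s <= lvar f x (last x s).
Proof.
move=> x0 xs l1; apply: ub_le_sup; last by exists s.
by exists B => _ [s' [ps ls] <-]; apply: fB; rewrite // ls.
Qed.

Lemma lvar_le x y : 0 <= x -> x <= y -> y <= 1 -> lvar f x y <= B.
Proof.
move=> x0 xy y1; have [ne _] := lvar_has_sup x0 xy y1.
by apply: ge_sup => // _ [s [ps ls] <-]; apply: fB; rewrite // ls.
Qed.

Lemma lvar_ge0 x y : 0 <= x -> x <= y -> y <= 1 -> 0 <= lvar f x y.
Proof.
move=> x0 xy y1; have := @lvar_ge x [:: y] x0; rewrite /= xy => /(_ isT y1).
exact: le_trans (vsum_ge0 _ _ [:: y]).
Qed.

Lemma lvar_step x y : 0 <= x -> x <= y -> y <= 1 ->
  `|f y - f x| `^ p <= lvar f x y.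
Proof.
by move=> x0 xy y1; have := @lvar_ge x [:: y] x0; rewrite /= xy addr0; apply.
Qed.

Lemma lvar_add x y z : 0 <= x -> x <= y -> y <= z -> z <= 1 ->
  lvar f x y + lvar f y z <= lvar f x z.
Proof.
move=> x0 xy yz z1.
have [ne1 _] := lvar_has_sup x0 xy (le_trans yz z1).
have [ne2 _] := lvar_has_sup (le_trans x0 xy) yz z1.
rewrite -lerBrDr; apply: ge_sup => // _ [s1 [ps1 ls1] <-].
rewrite lerBrDr -lerBrDl; apply: ge_sup => // _ [s2 [ps2 ls2] <-].
rewrite lerBrDl -[in vsum f y]ls1 -vsum_cat.
have <- : last x (s1 ++ s2) = z by rewrite last_cat ls1.
by apply: lvar_ge => //; rewrite ?cat_path ?last_cat ls1 ?ps1 // ls2.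
Qed.

(** [e] is the induction parameter: everything to the left of it has been spent on earlier
    intervals. *)
Lemma sum_disjoint_intervals (I : Type) (l : seq I) (g d : I -> R) (e : R) :
  (forall k, 0 <= g k /\ g k <= d k /\ d k <= 1) ->
  pairwise (fun j k => d j <= g k) l -> 0 <= e -> e <= 1 ->
  all (fun k => e <= g k) l ->
  \sum_(k <- l) `|f (d k) - f (g k)| `^ p <= lvar f e 1.
Proof.
move=> gd; elim: l e => [|k l IH] e; first by rewrite big_nil => *; exact: lvar_ge0.
rewrite big_cons /= => /andP[kl pl] e0 e1 /andP[ek el].
have [g0 [gdk d1]] := gd k; have d0 := le_trans g0 gdk.
have h1 := lvar_add e0 ek (le_trans gdk d1) (lexx 1).
have h2 := lvar_add g0 gdk d1 (lexx 1).
have h3 := lvar_step g0 gdk d1; have h4 := IH _ pl d0 d1 kl.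
have h5 := lvar_ge0 e0 ek (le_trans gdk d1); lra.
Qed.

(** From each drop [u] to the next peak [T k] the path rises by at least [a], and these intervals do
    not overlap. No drop is known before the first peak, so [k0] is not counted. *)
Lemma count_separated (I : Type) (l : seq I) (k0 : I) (T th : I -> R) (a : R) :
  0 <= a ->
  (forall k, 0 <= T k /\ T k <= 1) ->
  all (fun k => th k + a <= f (T k)) (k0 :: l) ->
  pairwise (fun j k => `[< exists u, [/\ T j <= u, u <= T k, f u <= th j & f u <= th k] >])
    (k0 :: l) ->
  (size l)%:R * a `^ p <= lvar f (T k0) 1.
Proof.
move=> a0 T01; elim: l k0 => [|k1 l IH] k0.
  by move=> *; rewrite mul0r; have [? ?] := T01 k0; apply: lvar_ge0.
move=> /andP[_ al] /andP[/andP[/asboolP[u [ju uk _ uth]] _] pl].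
have [? ?] := T01 k0; have [? ?] := T01 k1.
have u0 : 0 <= u by exact: le_trans ju.
have u1 : u <= 1 by exact: le_trans uk _.
have /andP[hk1 _] := al.
have h1 := IH k1 al pl.
have h2 : a `^ p <= lvar f u (T k1).
  apply: le_trans (lvar_step u0 uk _) => //.
  apply: ge0_ler_powR; rewrite ?nnegrE ?(ltW p0) ?normr_ge0 //.
  by apply: le_trans (ler_norm _); lra.
have h3 := @lvar_add (T k0) u 1 _ ju u1 (lexx 1).
have h4 := @lvar_add u (T k1) 1 u0 uk _ (lexx 1).
have h5 : 0 <= lvar f (T k0) u by exact: lvar_ge0.
rewrite [size _]/= -natr1 mulrDl mul1r.
by have := h3 _; have := h4 _; lra.
Qed.

End Bounded.

Lemma vbounded_comp f (h : R -> R) B : vbounded f B ->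
  (forall x y, 0 <= x -> x <= y -> y <= 1 -> h x <= h y) ->
  (forall x, 0 <= x -> x <= 1 -> 0 <= h x /\ h x <= 1) ->
  vbounded (f \o h) B.
Proof.
move=> fB hm h01 x s x0 xs ls.
have E y t : vsum (f \o h) y t = vsum f (h y) (map h t).
  by elim: t y => //= z t IH y; rewrite IH.
have lst y t : last (h y) (map h t) = h (last y t) by rewrite last_map.
have aux : path <=%R (h x) (map h s) /\ x <= last x s.
  elim: s x x0 xs ls {E lst} => [|y s IH] x x0 //= /andP[xy ys] ls.
  have [h1 h2] := IH y (le_trans x0 xy) ys ls.
  by rewrite h1 andbT hm // ?(le_trans xy) // (le_trans h2).
case: aux => ps xl.
have [||_ hl1] := h01 (last x s) => //; first exact: le_trans xl.
have [||hx0 _] := h01 x => //; first exact: le_trans ls.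
by rewrite E; apply: fB => //; rewrite lst.
Qed.

Lemma powR_normD (x y : R) : `|x + y| `^ p <= 2 `^ p * (`|x| `^ p + `|y| `^ p).
Proof.
wlog xy : x y / `|x| <= `|y|.
  move=> H; have [|/ltW] := leP `|x| `|y|; first exact: H.
  by rewrite addrC [X in _ * X]addrC; exact: H.
apply: (@le_trans _ _ ((2 * `|y|) `^ p)).
  apply: ge0_ler_powR; rewrite ?nnegrE ?(ltW p0) ?mulr_ge0 //.
  by have := ler_normD x y; lra.
rewrite powRM // ler_pM2l ?powR_gt0 //.
by have := powR_ge0 `|x| p; lra.
Qed.

Lemma vbounded_sub f g B C : vbounded f B -> vbounded g C ->
  vbounded (f \- g) (2 `^ p * (B + C)).
Proof.
move=> fB gC x s x0 xs ls.
apply: (@le_trans _ _ (2 `^ p * (vsum f x s + vsum g x s))).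
  elim: s x {x0 xs ls} => [|y s IH] x /=; first by rewrite addr0 mulr0.
  have := powR_normD (f y - f x) (- (g y - g x)); have := IH y.
  rewrite normrN (_ : f y - f x + - (g y - g x) = f y - g y - (f x - g x)); last by lra.
  by rewrite !mulrDr; lra.
by rewrite ler_wpM2l ?powR_ge0 // lerD ?fB ?gC.
Qed.

(** A step that crosses neither [a] nor [b] costs at most the same step of [f]. Each crossing costs
    at most [M ^ p] more, and the crossings are counted by telescoping the indicators [J a] and
    [J b], which jump once each. *)
Lemma vbounded_restrict f (B M a b : R) : vbounded f B -> 0 <= M -> a <= b ->
  (forall x, 0 <= x -> x <= 1 -> `|f x| <= M) ->
  vbounded (fun x => f x * \1_`]a, b] x) (B + 2 * M `^ p).
Proof.
move=> fB M0 ab fM x s x0 xs ls.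
pose J (c y : R) : R := (c < y)%R%:R.
have JE c y : J c y = (c < y)%R%:R by [].
have IE y : \1_`]a, b]%classic y = J a y - J b y :> R.
  rewrite !JE indicE mem_setE in_itv /= [y <= b]leNgt.
  case: (ltP a y) => ay /=; case: (ltP b y) => yb /=; rewrite ?subrr ?subr0 //.
  by lra.
have J01 c y : 0 <= J c y <= 1 by rewrite JE; case: (c < y); rewrite /= ?lexx ?ler01.
suff H : vsum (fun x => f x * \1_`]a, b] x) x s <=
    vsum f x s + M `^ p * ((J a (last x s) - J a x) + (J b (last x s) - J b x)).
  apply: (le_trans H); rewrite lerD ?fB // mulrC ler_wpM2r ?powR_ge0 //.
  have /andP[? ?] := J01 a (last x s); have /andP[? ?] := J01 b (last x s).
  have /andP[? ?] := J01 a x; have /andP[? ?] := J01 b x; lra.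
elim: s x x0 xs ls => [|y s IH] x x0 /=.
  by move=> _ _; rewrite !subrr addr0 mulr0 addr0.
move=> /andP[xy ys] ls; have y0 := le_trans x0 xy.
have y1 : y <= 1.
  apply: le_trans ls; have /allP := order_path_min le_trans ys.
  by case: s ys {IH} => //= z s _; apply; rewrite mem_last.
have x1 := le_trans xy y1.
have := IH y y0 ys ls.
suff : `|f y * \1_`]a, b] y - f x * \1_`]a, b] x| `^ p <=
    `|f y - f x| `^ p + M `^ p * ((J a y - J a x) + (J b y - J b x)).
  have -> : J a (last y s) - J a x + (J b (last y s) - J b x) =
    (J a y - J a x + (J b y - J b x)) +
    (J a (last y s) - J a y + (J b (last y s) - J b y)) by lra.
  by rewrite [M `^ p * (_ + _)]mulrDr; lra.
have Mp := powR_ge0 M p; have fp := powR_ge0 `|f y - f x| p.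
have mono c : J c x <= J c y.
  by rewrite !JE ler_nat; case: (ltP c x) => // cx; rewrite (lt_le_trans cx xy).
have := mono a; have := mono b.
rewrite !IE !JE.
have pw z : 0 <= z -> z <= 1 -> `|f z| `^ p <= M `^ p.
  move=> z0 z1; apply: ge0_ler_powR; rewrite ?nnegrE ?(ltW p0) //; exact: fM.
have hx := pw x x0 x1; have hy := pw y y0 y1.
have zp : (0 : R) `^ p = 0 by rewrite powR0 // gt_eqF.
case: (ltP a x) => ax; case: (ltP b x) => bx; case: (ltP a y) => ay; case: (ltP b y) => by_ /=;
  rewrite ?subrr ?subr0 ?mulr1 ?mulr0 ?sub0r ?normrN ?normr0 ?zp ?add0r ?addr0 ?mulr1 //; try lra.
by rewrite subr0; lra.
Qed.

End VariationSums.

(** * Integrals of powers near 0 *)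

Section PowerIntegral.
Context {R : realType}.
Local Notation mu := (@lebesgue_measure R).

Lemma integral_powR_away (b e D : R) : 0 < b -> 0 < e -> e < D ->
  (\int[mu]_(x in `[e, D]) (x `^ (b - 1))%:E <= (b^-1 * D `^ b)%:E)%E.
Proof.
move=> b0 e0 eD.
have cont (a x : R) : 0 < x -> y `^ a @[y --> x] --> x `^ a.
  move=> x0; have : derivable (fun y : R => y `^ a) x 1.
    by apply: derivable_powR; rewrite in_itv /= x0.
  by move=> /derivable1_diffP/differentiable_continuous.
pose F := fun x : R => b^-1 * x `^ b.
have dF (x : R) : 0 < x -> is_derive x 1 F (x `^ (b - 1)).
  move=> x0; have H := is_derive1_powR b x0.
  have := @is_deriveZ R _ _ (fun y => y `^ b) b^-1 x 1 _ H.
  by rewrite /GRing.scale /= mulrA mulVf ?gt_eqF // mul1r.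
rewrite (continuous_FTC2 (F := F) eD).
- rewrite -EFinB lee_fin lerBlDr lerDl mulr_ge0 ?powR_ge0 // invr_ge0 ltW //.
- apply/(continuous_within_itvP _ eD); split.
  + by move=> x; rewrite in_itv /= => /andP[ex _]; apply: cont; lra.
  + by apply: cvg_at_right_filter; exact: cont.
  + by apply: cvg_at_left_filter; apply: cont; lra.
- have cF (x : R) : 0 < x -> F y @[y --> x] --> F x.
    by move=> x0; apply: cvgM; [exact: cvg_cst | exact: cont].
  split.
  + by move=> x; rewrite in_itv /= => /andP[ex _]; apply: (ex_derive (is_derive := dF x _)); lra.
  + by apply: cvg_at_right_filter; exact: cF.
  + by apply: cvg_at_left_filter; apply: cF; lra.
- move=> x; rewrite in_itv /= => /andP[ex _]; rewrite derive1E.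
  by have x0 : 0 < x by [lra]; have [_ ->] := dF x x0.
Qed.

Lemma integral_powR_le (b D : R) : 0 < b -> 0 < D ->
  (\int[mu]_(x in `]0%R, D]) (x `^ (b - 1))%:E <= (b^-1 * D `^ b)%:E)%E.
Proof.
move=> b0 D0.
(* [n.+2] keeps the left end strictly below [D], as [integral_powR_away] requires. *)
have U : \bigcup_n `[D / n.+2%:R, D]%classic = (`]0, D]%classic : set R).
  apply/seteqP; split=> [x [n _]|x] /=; rewrite !in_itv /= => /andP[h1 h2].
    by rewrite h2 andbT; apply: lt_le_trans h1; rewrite divr_gt0.
  exists (Num.truncn (D / x)) => //=; rewrite in_itv /= h2 andbT.
  rewrite ler_pdivrMr ?ltr0n // mulrC -ler_pdivrMr //; apply: ltW.
  by apply: (lt_le_trans (truncnS_gt _)); rewrite ler_nat.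
have mp : measurable_fun (`]0, D]%classic : set R) (fun x => (x `^ (b - 1))%:E).
  by apply/measurable_EFinP; apply: measurable_funTS; exact: measurable_powR.
have nd : nondecreasing_seq (fun n => `[D / n.+2%:R, D]%classic : set R).
  move=> m n mn; rewrite subsetEset => x /=; rewrite !in_itv /= => /andP[h ->].
  rewrite andbT; apply: le_trans h; rewrite ler_pM2l // lef_pV2 ?posrE ?ltr0n //.
  by rewrite ler_nat !ltnS.
have := @ge0_nondecreasing_set_cvg_integral _ (measurableTypeR R) R _ (fun x => (x `^ (b - 1))%:E) mu nd.
rewrite U => H.
have {}H : (\int[mu]_(x in `[(D / n.+2%:R)%R, D]) (x `^ (b - 1))%:E)%E @[n --> \oo] -->
    (\int[mu]_(x in `]0%R, D]) (x `^ (b - 1))%:E)%E.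
  apply: H => [i|i|i x _]; [exact: measurable_itv| |by rewrite lee_fin powR_ge0].
  apply: measurable_funS mp; first exact: measurable_itv.
  by rewrite -U => x ?; exists i.
rewrite -(cvg_lim _ H) //; apply: lime_le; first by apply/cvg_ex; eexists; exact: H.
apply: nearW => n; apply: integral_powR_away => //; first by rewrite divr_gt0.
by rewrite ltr_pdivrMr ?ltr0n // ltr_pMr // ltr1n.
Qed.

End PowerIntegral.

Section SumBounds.
Context {R : realType}.

Lemma vbounded_step (p : R) (f : R -> R) (B x y : R) : vbounded p f B ->
  0 <= x <= 1 -> 0 <= y <= 1 -> `|f y - f x| `^ p <= B.
Proof.
move=> fB; wlog xy : x y / x <= y.
  by move=> H hx hy; have [|/ltW] := leP x y => h; [exact: H | rewrite distrC; exact: H].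
move=> /andP[x0 x1] /andP[y0 y1].
by have := fB x [:: y] x0; rewrite /= addr0 xy; apply.
Qed.

Lemma pairwise_filter_ord n (P : pred 'I_n) (r : rel 'I_n) :
  (forall j k : 'I_n, (j < k)%N -> P j -> P k -> r j k) ->
  pairwise r [seq k <- enum 'I_n | P k].
Proof.
move=> H; apply: (@sub_in_pairwise _ P (fun j k : 'I_n => (j < k)%N)).
- by move=> j k Pj Pk jk; apply: H.
- exact: filter_all.
apply: pairwise_filter; have := iota_ltn_sorted 0 n; rewrite -val_enum_ord.
by rewrite (sorted_pairwise ltn_trans) pairwise_map.
Qed.

(* A substitute for Hoelder's inequality: [y <= c + y^q c^(1-q)] for every
   [c > 0], summed over [y] with the optimal [c]. *)
Lemma sum_le_powR (I : Type) (l : seq I) (y : I -> R) (q n B : R) : 1 <= q ->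
  (forall k, 0 <= y k) -> 0 < n -> (size l)%:R <= n ->
  \sum_(k <- l) y k `^ q <= B ->
  \sum_(k <- l) y k <= 2 * (n `^ (1 - q^-1) * B `^ q^-1).
Proof.
move=> q1 y0 n0 sn sB; have q0 : 0 < q by lra.
have B0 : 0 <= B by apply: le_trans sB; apply: sumr_ge0 => k _; exact: powR_ge0.
have [BE|Bn0] := eqVneq B 0.
  rewrite BE powR0 ?invr_eq0 ?gt_eqF // !mulr0.
  elim: l sB {sn} => [|k l IH]; rewrite ?big_nil // !big_cons BE => sB.
  have h1 := powR_ge0 (y k) q.
  have h2 : 0 <= \sum_(j <- l) y j `^ q by apply: sumr_ge0 => j _; exact: powR_ge0.
  have yk : y k = 0 by apply: (@powR_eq0_eq0 _ _ q); lra.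
  by rewrite yk add0r; apply: IH; rewrite BE; lra.
have {Bn0}B0 : 0 < B by rewrite lt_neqAle eq_sym Bn0.
(* This [c] equalizes the two totals [n * c] and [B * c ^ (1 - q)], both being
   [n ^ (1 - 1/q) * B ^ (1/q)]; hence the factor 2. *)
pose c := (B / n) `^ q^-1.
have c0 : 0 < c by apply: powR_gt0; apply: divr_gt0.
have cq : c `^ q = B / n by rewrite /c -powRrM mulVf ?gt_eqF // powRr1 // divr_ge0 // ltW.
have key k : y k <= c + y k `^ q * c `^ (1 - q).
  have [yc|cy] := leP (y k) c.
    by apply: (le_trans yc); rewrite lerDl mulr_ge0 ?powR_ge0.
  have yk0 : 0 < y k by exact: lt_trans cy.
  have E : y k = y k `^ q * y k `^ (1 - q).
    by rewrite -powRD ?(gt_eqF yk0) ?implybT // addrC subrK powRr1 // ltW.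
  rewrite [leLHS]E; apply: (@le_trans _ _ (y k `^ q * c `^ (1 - q))); last by rewrite lerDr ltW.
  rewrite ler_wpM2l ?powR_ge0 // -[1 - q]opprB !powRN lef_pV2 ?posrE ?powR_gt0 ?divr_gt0 //.
  by apply: ge0_ler_powR; rewrite ?nnegrE ?subr_ge0 // ltW.
have cB : B * c `^ (1 - q) = n * c.
  rewrite powRD ?(gt_eqF c0) ?implybT // powRr1 ?(ltW c0) // powRN cq invf_div.
  by field; rewrite gt_eqF.
have nc : n * c = n `^ (1 - q^-1) * B `^ q^-1.
  rewrite /c powRM ?invr_ge0 ?(ltW B0) ?(ltW n0) //.
  rewrite powRD ?(gt_eqF n0) ?implybT // powRr1 ?(ltW n0) // -!mulrA; congr (_ * _).
  by rewrite mulrC powRN; congr (_ * _); rewrite -powR_inv1 ?(ltW n0) // -powRrM mulN1r powRN.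
have H1 : \sum_(k <- l) y k <= \sum_(k <- l) (c + y k `^ q * c `^ (1 - q)).
  by apply: ler_sum => i _; exact: key.
apply: (le_trans H1).
rewrite big_split /= -mulr_suml -nc big_const_seq count_predT iter_addr_0.
rewrite -mulr_natl.
have : (size l)%:R * c <= n * c by rewrite ler_wpM2r // ltW.
have : (\sum_(k <- l) y k `^ q) * c `^ (1 - q) <= n * c.
  by rewrite -cB ler_wpM2r ?powR_ge0.
lra.
Qed.

(** An entry followed by another one cannot satisfy [P], so at most the last entry does; this will
    bound the number of cut points on [[O, B]]. *)
Lemma sum_pairwise_last (I : Type) (l : seq I) (P : pred I) :
  pairwise (fun j _ => ~~ P j) l -> \sum_(k <- l) (P k)%:R <= 1 :> R.
Proof.
elim: l => [|k l IH]; rewrite ?big_nil ?big_cons //= => /andP[h /IH h2].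
case: l h h2 {IH} => [|j l]; first by rewrite big_nil addr0 lern1 leq_b1.
by move=> /= /andP[/negbTE -> _]; rewrite add0r.
Qed.

Lemma sum_pairwise_first (I : Type) (l : seq I) (P : pred I) :
  pairwise (fun _ k => ~~ P k) l -> \sum_(k <- l) (P k)%:R <= 1 :> R.
Proof.
case: l => [|k l]; rewrite ?big_nil ?big_cons //= => /andP[h _].
suff -> : \sum_(j <- l) (P j)%:R = 0 :> R by rewrite addr0 lern1 leq_b1.
elim: l h => [|j l IH]; rewrite ?big_nil ?big_cons //= => /andP[/negbTE -> /IH ->].
by rewrite addr0.
Qed.

End SumBounds.

(** * The bound on the total integral *)

Section Active.
Context {R : realType} (w : R -> R) (cw : cadlag w) (N : nat) (a : R) (a0 : 0 < a).
Implicit Types (j k : 'I_N.+2) (u t : R).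

Definition threshold k : R := glevel w N k - a.
Definition cut k : tree w := anc (gnode w N k) (threshold k).
Definition actives : seq 'I_N.+2 := [seq k <- enum 'I_N.+2 | active w N a k].

Lemma active_cut k : active w N a k ->
  [/\ tle (cut k) (gnode w N k), level (cut k) = threshold k &
      minw w < threshold k].
Proof.
move=> ak; have mt : minw w < threshold k.
  by apply: (le_lt_trans (minw_branch w k)); rewrite /threshold ltrBrDl -ltrBrDr.
have [||h1 h2] := @ancP _ _ cw (gnode w N k) (threshold k) => //.
- exact: ltW.
- by rewrite level_gnode // /threshold gerBl ltW.
Qed.

Lemma active_cut_node k t u : active w N a k -> 0 <= t -> t <= 1 ->
  tle (cut k) (node w t) ->
  gtime N k < u < t \/ t < u < gtime N k -> threshold k <= w u.
Proof.
move=> ak t0 t1 h; have [h1 h2 _] := active_cut ak; have [g0 g1] := @gtime01 R N k.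
rewrite /tle h2 in h h1.
have : threshold k <= tmeet (gnode w N k) (node w t).
  by apply: (tmeet_ultra cw) h; rewrite tmeetC.
by move/(tmeet_fibre cw _ (fibre_node w g0 g1) (fibre_node w t0 t1)) => [_ _]; apply.
Qed.

Lemma active_cut_fibre k z u : active w N a k -> fibre (cut k) z ->
  gtime N k < u < z.1 \/ z.1 < u < gtime N k -> threshold k <= w u.
Proof.
move=> ak Fz; have [h1 h2 _] := active_cut ak; have [g0 g1] := @gtime01 R N k.
have := proj1 (tle_fibre cw Fz (fibre_node w g0 g1)) h1.
rewrite (level_fibre cw Fz) h2 => -[_ _ H] hu; apply: H.
by case: hu; [right | left].
Qed.

(** The peaks [T k] need not be the grid times: with [T = gtime N] and [c = a] this counts active
    branches, with other peaks it counts the cut points in [deep c]. The drop separating two grid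
    times also separates the peaks, because [w] stays above the threshold between a grid time and
    its peak. *)
Lemma active_count (P : pred 'I_N.+2) (p V c : R) (T : 'I_N.+2 -> R) :
  (forall k, P k -> active w N a k) -> 0 < p -> vbounded p w V ->
  0 <= c -> (forall k, 0 <= T k /\ T k <= 1) ->
  (forall k, P k -> tle (cut k) (node w (T k)) /\ threshold k + c <= w (T k)) ->
  (size [seq k <- enum 'I_N.+2 | P k])%:R * c `^ p <= 2 * V /\
  ([seq k <- enum 'I_N.+2 | P k] <> [::] -> c `^ p <= V).
Proof.
move=> PA p0 wV c0 T01 HT.
have V0 := vbounded_ge0 wV.
(* The fall from one peak to a time where [w] is below the threshold already costs [c ^ p]. This
   pays for the first peak, which [count_separated] leaves out; hence [2 * V]. *)
have one k : P k -> c `^ p <= V.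
  move=> Pk; have [_ h] := HT k Pk; have [_ _ mt] := active_cut (PA _ Pk).
  have [|u [u0 u1 wu]] := minw_approx cw (e := threshold k - minw w); first lra.
  have [t0 t1] := T01 k.
  have : `|w (T k) - w u| `^ p <= V.
    by apply: (vbounded_step wV); apply/andP.
  apply: le_trans; apply: ge0_ler_powR; rewrite ?nnegrE ?(ltW p0) //.
  by apply: le_trans (ler_norm _); lra.
have all_act : all P [seq k <- enum 'I_N.+2 | P k] by exact: filter_all.
have pw : pairwise (fun j k => `[< exists u, [/\ T j <= u, u <= T k,
    w u <= threshold j & w u <= threshold k] >]) [seq k <- enum 'I_N.+2 | P k].
  apply: pairwise_filter_ord => j k jk Pj Pk; apply/asboolP.
  have aj := PA _ Pj; have ak := PA _ Pk.
  have [u [ju uk wj wk]] := active_separated cw (ltW a0) jk aj ak.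
  have [tj0 tj1] := T01 j; have [tk0 tk1] := T01 k.
  exists u; split; [| |exact: ltW|exact: ltW].
    rewrite leNgt; apply/negP => uT; have [h _] := HT j Pj.
    have := active_cut_node aj tj0 tj1 h (or_introl (introT andP (conj ju uT))).
    by rewrite leNgt wj.
  rewrite leNgt; apply/negP => uT; have [h _] := HT k Pk.
  have := active_cut_node ak tk0 tk1 h (or_intror (introT andP (conj uT uk))).
  by rewrite leNgt wk.
case: [seq k <- _ | P k] all_act pw => [|k0 l] al pw.
  by split=> //; rewrite mul0r mulr_ge0.
have ak0 : P k0 by case/andP: al.
split=> [|_]; last exact: one ak0.
have := @count_separated _ p p0 w V wV _ l k0 T threshold c c0 T01 _ pw.
have -> : all (fun k => threshold k + c <= w (T k)) (k0 :: l).
  by apply: sub_all al => k /HT[].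
move=> /(_ isT) h; have [t0 t1] := T01 k0.
have := lvar_le wV t0 t1 (lexx 1); have := one _ ak0.
by rewrite [size _]/= -natr1 mulrDl mul1r; lra.
Qed.

Lemma active_Delta (q : R) (rho : R -> R) (B M n : R) : 1 <= q ->
  vbounded q rho B -> (forall t, 0 <= t -> t <= 1 -> `|rho t| <= M) ->
  1 <= n -> (size actives)%:R <= n ->
  \sum_(k <- actives) `|Delta rho (cut k)| <=
    2 * n `^ (1 - q^-1) * (B `^ q^-1 + M).
Proof.
move=> q1 rB rM n1 sn; have q0 : 0 < q by lra.
have M0 : 0 <= M by apply: le_trans (rM 0 _ _).
pose inA k := `[< arc (tree_O w) (tree_A w) (cut k) >].
pose inB k := `[< arc (tree_O w) (tree_B w) (cut k) >].
pose g k := first_time (cut k); pose d k := last_time (cut k).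
have gd k : 0 <= g k /\ g k <= d k /\ d k <= 1.
  have /andP[? ?] := first_time01 cw (cut k); have /andP[? ?] := last_time01 cw (cut k).
  by split=> //; split=> //; exact: first_le_last.
(* Each replacement of a value of [rho] by 0 costs at most [M], and the two sums below show that
   each convention applies to at most one active cut. *)
have bound k : `|Delta rho (cut k)| <= `|rho (d k) - rho (g k)| + M * (inA k)%:R + M * (inB k)%:R.
  have [g0 [gdk d1]] := gd k.
  have hg := rM _ g0 (le_trans gdk d1); have hd := rM _ (le_trans g0 gdk) d1.
  rewrite /Delta -/(inA k) -/(inB k) -/(g k) -/(d k).
  case: (inA k); case: (inB k); rewrite ?mulr1 ?mulr0 ?addr0 ?subr0 ?sub0r ?subrr ?normr0 ?normrN.
  - by rewrite !addr_ge0.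
  - by apply: (le_trans hd); rewrite lerDr.
  - by apply: (le_trans hg); rewrite lerDr.
  - by rewrite distrC.
apply: (@le_trans _ _ (\sum_(k <- actives)
   (`|rho (d k) - rho (g k)| + M * (inA k)%:R + M * (inB k)%:R))).
  by apply: ler_sum => k _; exact: bound.
rewrite !big_split /= -!mulr_sumr.
(* If the cut of a later active node were on [[O, A]], the path would stay above its threshold from
   time 0 to its grid time, yet it drops below it after the grid time of an earlier active node. *)
have hA : \sum_(k <- actives) (inA k)%:R <= 1 :> R.
  apply: sum_pairwise_first; apply: pairwise_filter_ord => j k jk aj ak.
  apply/asboolP => /(arc_rootP cw); rewrite tree_A_node // => h.
  have [u [ju uk wj wk]] := active_separated cw (ltW a0) jk aj ak.
  have [gj0 _] := @gtime01 R N j.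
  have := active_cut_node ak (lexx 0) ler01 h (or_intror (introT andP (conj (le_lt_trans gj0 ju) uk))).
  by rewrite leNgt wk.
have hB : \sum_(k <- actives) (inB k)%:R <= 1 :> R.
  apply: sum_pairwise_last; apply: pairwise_filter_ord => j k jk aj ak.
  apply/asboolP => /(arc_rootP cw); rewrite tree_B_node // => h.
  have [u [ju uk wj wk]] := active_separated cw (ltW a0) jk aj ak.
  have [_ gk1] := @gtime01 R N k.
  have := active_cut_node aj ler01 (lexx 1) h (or_introl (introT andP (conj ju (lt_le_trans uk gk1)))).
  by rewrite leNgt wj.
have hS : \sum_(k <- actives) `|rho (d k) - rho (g k)| `^ q <= B.
  apply: (le_trans (y := lvar q rho 0 1)); last exact: (lvar_le rB).
  apply: (sum_disjoint_intervals rB gd) => //.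
    apply: pairwise_filter_ord => j k jk aj ak.
    have [u [ju uk wj wk]] := active_separated cw (ltW a0) jk aj ak.
    apply: (@le_trans _ _ u); rewrite leNgt; apply/negP => h.
      have := active_cut_fibre aj (fibre_last_time cw (cut j)) (or_introl (introT andP (conj ju h))).
      by rewrite leNgt wj.
    have := active_cut_fibre ak (fibre_first_time cw (cut k)) (or_intror (introT andP (conj h uk))).
    by rewrite leNgt wk.
  by apply/allP => k _; case: (gd k).
have n0 : 0 < n by lra.
have := sum_le_powR q1 (fun k => normr_ge0 (rho (d k) - rho (g k))) n0 sn hS.
(* Absorbs the two isolated terms [M] into the power of [n]. *)
have nn : 1 <= n `^ (1 - q^-1).
  rewrite -[leLHS](powRr0 n); apply: ler_powR => //.
  by rewrite subr_ge0 invf_le1.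
have : M * \sum_(k <- actives) (inA k)%:R <= M * 1 by rewrite ler_wpM2l.
have : M * \sum_(k <- actives) (inB k)%:R <= M * 1 by rewrite ler_wpM2l.
have : M * 1 <= M * n `^ (1 - q^-1) by rewrite ler_wpM2l.
rewrite mulr1 [in X in _ -> _ -> _ -> _ -> X]mulrDr -[2 * _ * M]mulrA [_ * M]mulrC mulrA.
lra.
Qed.

End Active.

Section MainBound.
Context {R : realType} (w : R -> R) (cw : cadlag w).
Context (lam : {measure set (borel_tree w) -> \bar R}) (hlam : length_measure lam).
Context (p : R) (p1 : 1 <= p) (V : R) (V0 : 0 < V) (wV : vbounded p w V).
Local Notation mu := (@lebesgue_measure R).

Let p0 : 0 < p. Proof. exact: lt_le_trans ltr01 p1. Qed.

Lemma active_height N a k : 0 < a -> active w N a k ->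
  a <= V `^ p^-1 /\ (size (actives w N a))%:R <= 2 * V / a `^ p.
Proof.
move=> a0 ak; have ap : 0 < a `^ p by exact: powR_gt0.
have [||||h1 h2] := @active_count _ _ cw N a a0 (active w N a) p V a (gtime N) _ p0 wV _ _ _ => //.
- exact: ltW.
- exact: gtime01.
- move=> j aj; have [h _ _] := active_cut cw a0 aj; split=> //.
  by rewrite /threshold subrK.
have {}h2 : a `^ p <= V.
  apply: h2 => E; have : k \in [seq k <- enum 'I_N.+2 | active w N a k].
    by rewrite mem_filter ak mem_enum.
  by rewrite E.
split; last by rewrite ler_pdivlMr.
have := @ge0_ler_powR _ p^-1 _ (a `^ p) V.
rewrite !nnegrE -powRrM divff ?gt_eqF // powRr1 ?(ltW a0) //; apply => //.
- by rewrite invr_ge0 ltW.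
- exact: powR_ge0.
- exact: ltW.
Qed.

Lemma sum_actives N a (h : 'I_N.+2 -> \bar R) :
  (\sum_(k | active w N a k) h k = \sum_(k <- actives w N a) h k)%E.
Proof. by rewrite /actives big_filter big_enum_cond; apply: eq_bigl. Qed.

(** [D] bounds the heights of the slices that meet [F]. The whole tree with [D = V ^ (1/p)] gives
    the total bound; the complement of [deep c] with [D = c] gives a bound that vanishes with [c],
    uniformly in [rho]. *)
Lemma Delta_bound (q B M D : R) (rho : R -> R) (F : set (borel_tree w)) :
  1 <= q -> 1 < p^-1 + q^-1 -> vbounded q rho B ->
  (forall t, 0 <= t -> t <= 1 -> `|rho t| <= M) ->
  measurable_fun (`[0, 1] : set R) rho -> measurable F -> 0 < D ->
  (forall N a k, 0 < a -> active w N a k -> F (cut w a k) -> a <= D) ->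
  (\int[lam]_(tau in F) `|Delta rho tau|%:E <=
   (2 * (2 * V) `^ (1 - q^-1) * (B `^ q^-1 + M) *
    ((1 - p * (1 - q^-1))^-1 * D `^ (1 - p * (1 - q^-1))))%:E)%E.
Proof.
move=> q1 pq rB rM mrho mF D0 FD; have q0 : 0 < q by lra.
set g1 := 1 - p * (1 - q^-1).
(* [g1 = p * (1/p + 1/q - 1)], so its positivity is exactly the hypothesis on the exponents. *)
have g10 : 0 < g1.
  rewrite /g1 subr_gt0 mulrBr mulr1 ltrBlDr -ltrBlDl.
  by rewrite -(ltr_pM2l p0) mulrDr divff ?gt_eqF // mulr1 in pq; lra.
have B0 := vbounded_ge0 rB.
have M0 : 0 <= M by apply: le_trans (rM 0 _ _).
set K := 2 * (2 * V) `^ (1 - q^-1) * (B `^ q^-1 + M).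
have K0 : 0 <= K by rewrite !mulr_ge0 ?powR_ge0 // addr_ge0 // powR_ge0.
pose g a := ((fun a => (K * a `^ (g1 - 1))%:E) \_ (`]0, D]%classic : set R)) a.
have mp : measurable_fun (setT : set R) (fun a : R => (K * a `^ (g1 - 1))%:E).
  apply/measurable_EFinP; apply: measurable_funM => //; exact: measurable_powR.
have mD : measurable_fun setT (fun tau : borel_tree w => `|Delta rho tau|%:E).
  by apply/measurable_EFinP; apply: measurableT_comp => //; exact: measurable_Delta.
have g0 a : (0 <= g a)%E by rewrite /g patchE; case: ifP => // _; rewrite lee_fin mulr_ge0 ?powR_ge0.
have mg : measurable_fun (`]0, +oo[ : set R) g.
  apply: measurable_funTS; apply/measurable_restrict => //; rewrite setTI.
  exact: measurable_funS mp.
rewrite integral_mkcond.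
apply: (@le_trans _ _ (\int[mu]_(a in `]0%R, +oo[) g a)%E).
  apply: slice_integral => //.
  - by apply/measurable_restrict => //; rewrite setTI; exact: measurable_funS mD.
  - by move=> tau; rewrite patchE; case: ifP.
  move=> N a a0; rewrite sum_actives.
  have [aD|Da] := leP a D; last first.
    rewrite big_seq big1 ?g0 // => k; rewrite mem_filter => /andP[ak _].
    rewrite patchE; case: ifPn => //; rewrite inE => Fk.
    by have := FD N a k a0 ak Fk; rewrite leNgt Da.
  rewrite /g patchE mem_set /= ?in_itv /= ?a0 //.
  apply: (@le_trans _ _ (\sum_(k <- actives w N a) `|Delta rho (cut w a k)|%:E)%E).
    by apply: lee_sum => k _; rewrite patchE; case: ifP => // _; rewrite lee_fin.
  rewrite sumEFin lee_fin.
  case E : (actives w N a) => [|k0 l].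
    by rewrite big_nil; apply: mulr_ge0 => //; exact: powR_ge0.
  have k0a : active w N a k0.
    have : k0 \in actives w N a by rewrite E mem_head.
    by rewrite mem_filter => /andP[].
  rewrite -E; have [_ hn] := active_height a0 k0a.
  have n1 : 1 <= 2 * V / a `^ p.
    by apply: le_trans hn; rewrite E ler1n.
  apply: (le_trans (active_Delta cw a0 q1 rB rM n1 hn)).
  rewrite le_eqVlt; apply/orP; left; apply/eqP.
  have nE : (2 * V / a `^ p) `^ (1 - q^-1) = (2 * V) `^ (1 - q^-1) * a `^ (g1 - 1).
    rewrite powRM ?mulr_ge0 ?invr_ge0 ?powR_ge0 ?(ltW V0) //; congr (_ * _).
    rewrite -powR_inv1 ?powR_ge0 // -!powRrM.
    by congr (_ `^ _); rewrite /g1; lra.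
  by rewrite nE /K; ring.
have -> : (\int[mu]_(a in `]0%R, +oo[) g a = \int[mu]_(a in `]0%R, D]) (K * a `^ (g1 - 1))%:E)%E.
  rewrite [LHS]integral_mkcond [RHS]integral_mkcond; apply: eq_integral => a _.
  rewrite /g !patchE; case: ifPn => // ha; case: ifPn => //.
  rewrite inE /= in_itv /= => /andP[a0 _]; move: ha; rewrite notin_setE /= in_itv /= andbT.
  by move=> /(_ a0).
under eq_integral do rewrite EFinM.
rewrite ge0_integralZl //.
- by rewrite [leRHS]EFinM; apply: lee_wpmul2l => //; exact: integral_powR_le.
- by apply: measurable_funTS; apply/measurable_EFinP; exact: measurable_powR.
- by move=> a _; rewrite lee_fin powR_ge0.
Qed.

(* A set of finite measure off which all active heights are at most [c]. *)
Definition deep (c : R) : set (borel_tree w) :=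
  [set tau | exists N k, tle tau (gnode w N k) /\ level tau + c <= glevel w N k].

Lemma measurable_deep c : measurable (deep c).
Proof.
rewrite (_ : deep c = \bigcup_N \bigcup_(k in [set: 'I_N.+2])
  ([set tau | tle tau (gnode w N k)] `&` [set tau | level tau + c <= glevel w N k])).
  apply: bigcupT_measurable => N; apply: fin_bigcup_measurable => // k _.
  apply: measurableI; first exact: measurable_tle.
  rewrite -[X in measurable X]setTI.
  rewrite (_ : [set tau | _] = (@level R w : borel_tree w -> R) @^-1` `]-oo, glevel w N k - c]).
    exact: measurable_level.
  by apply/seteqP; split=> tau /=; rewrite in_itv /= lerBrDr.
apply/seteqP; split=> [tau [N [k [? ?]]]|tau [N _ [k _ [? ?]]]].
  by exists N => //; exists k.
by exists N, k.
Qed.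

Lemma shallow_active c N a k : 0 < a -> active w N a k ->
  (~` deep c) (cut w a k) -> a <= c.
Proof.
move=> a0 ak; apply: contra_notP => /negP; rewrite -ltNge => ca.
have [h1 h2 _] := active_cut cw a0 ak; exists N, k; split=> //.
rewrite h2 /threshold; have : glevel w N k - a + c <= glevel w N k - a + a by rewrite lerD2l ltW.
by rewrite subrK.
Qed.

(** At every height [a] the active cuts in [deep c] have peaks at least [c] above them, so there are
    at most [2 * V / c ^ p] of them whatever [a] is, and none beyond [a = V ^ (1/p)]. *)
Lemma lam_deep_fin c : 0 < c -> (lam (deep c) < +oo)%E.
Proof.
move=> c0; have cp : 0 < c `^ p by exact: powR_gt0.
rewrite -[X in lam X]setIT -integral_indic //; last exact: measurable_deep.
pose D := V `^ p^-1.
pose g a := ((fun _ : R => (2 * V / c `^ p)%:E) \_ (`]0, D]%classic : set R)) a.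
have V1 : 0 <= 2 * V / c `^ p by rewrite divr_ge0 ?mulr_ge0 // ltW.
have g0 a : (0 <= g a)%E by rewrite /g patchE; case: ifP => // _; rewrite lee_fin.
have mD := measurable_deep c.
apply: (@le_lt_trans _ _ (\int[mu]_(a in `]0%R, +oo[) g a)%E).
  apply: slice_integral => //.
  - by apply/measurable_EFinP; exact: measurable_indic.
  - by apply: measurable_funTS; apply/measurable_restrict => //; exact: measurable_cst.
  move=> N a a0.
  pose P k := active w N a k && `[< deep c (cut w a k) >].
  have E : (\sum_(k | active w N a k) (\1_(deep c) (cut w a k))%:E =
      ((size [seq k <- enum 'I_N.+2 | P k])%:R : R)%:E)%E.
    rewrite size_filter -sum1_count natr_sum -sumEFin big_enum_cond /=.
    rewrite [RHS](eq_bigl P) // /P big_mkcondr /=; apply: eq_bigr => k ak.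
    by rewrite indicE; case: asboolP => h; [rewrite mem_set | rewrite memNset].
  rewrite E.
  have [z|nz] := eqVneq [seq k <- enum 'I_N.+2 | P k] [::]; first by rewrite z.
  have [k0 Pk0] : exists k0, P k0.
    have : has P (enum 'I_N.+2) by rewrite has_filter.
    by case/hasP => k0 _ ?; exists k0.
  have [ak0 _] := andP Pk0; have [aD _] := active_height a0 ak0.
  rewrite /g patchE mem_set /= ?in_itv /= ?a0 // lee_fin ler_pdivlMr //.
  pose T (k : 'I_N.+2) : R := xget 0 [set t | [/\ 0 <= t, t <= 1, tle (cut w a k) (node w t) &
    threshold w a k + c <= w t]].
  have T01 k : 0 <= T k /\ T k <= 1.
    by rewrite /T; case: xgetP => [t _ [] //|]; rewrite ler01 lexx.
  have HT k : P k -> tle (cut w a k) (node w (T k)) /\ threshold w a k + c <= w (T k).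
    move=> /andP[ak /asboolP[N' [k' [h1 h2]]]]; have [_ h3 _] := active_cut cw a0 ak.
    rewrite /T; case: xgetP => [t _ [] //|H]; exfalso; apply: (H (gtime N' k')).
    by have [? ?] := @gtime01 R N' k'; split=> //; rewrite -h3.
  have PA k : P k -> active w N a k by case/andP.
  by have [] := active_count cw a0 PA p0 wV (ltW c0) T01 HT.
apply: (@le_lt_trans _ _ (\int[mu]_(a in `]0%R, D]) (2 * V / c `^ p)%:E)%E).
  rewrite integral_mkcond [leRHS]integral_mkcond; apply: ge0_le_integral => //.
  - by move=> a _; rewrite patchE; case: ifP.
  - apply/measurable_restrict => //; rewrite ?setTI //; apply: measurable_funTS.
    by apply/measurable_restrict => //; exact: measurable_cst.
  - by apply/measurable_restrict => //; exact: measurable_cst.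
  by move=> a _; rewrite patchE; case: ifP => // _; rewrite patchE; case: ifP.
rewrite integral_cst //= lebesgue_measure_itv /=.
by case: ifP => _; rewrite ?mule0 ?ltry // -EFinD -EFinM ltry.
Qed.

End MainBound.

Lemma lt_lower (R : realType) (w : R -> R) (t x : R) :
  (x < lower w t) = (x < left_lim w t) && (x < w t).
Proof. by rewrite /lower lt_min. Qed.

Lemma jump_continuous (R : realType) (w : R -> R) (u : R) : left_lim w u = w u ->
  lower w u = w u /\ upper w u = w u.
Proof. by rewrite /lower /upper => ->; rewrite minxx maxxx. Qed.

(* Conversion between [tle tau (node w s)] and [tle tau (node w t)] would
   otherwise unfold down to the choice of representatives. *)
Opaque level lower upper left_lim first_time last_time tle node gnode glevel.

(** * Step functions and vanishing *)

Section Step.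
Context {R : realType} (w : R -> R) (cw : cadlag w).
Implicit Types (t u : R) (tau : tree w).

Lemma fibre_via tau z t : fibre tau z -> 0 <= t -> t <= 1 -> level tau <= w t ->
  (forall u, z.1 < u < t \/ t < u < z.1 -> level tau <= w u) -> tle tau (node w t).
Proof.
move=> Fz t0 t1 lt H; apply/(tle_fibre cw Fz (fibre_node w t0 t1)).
by rewrite (level_fibre cw Fz); split=> //; rewrite (level_fibre cw Fz).
Qed.

Lemma via_fibre tau z t u : fibre tau z -> 0 <= t -> t <= 1 -> tle tau (node w t) ->
  z.1 < u < t \/ t < u < z.1 -> level tau <= w u.
Proof.
move=> Fz t0 t1 /(tle_fibre cw Fz (fibre_node w t0 t1)) [_ _ H] /H.
by rewrite (level_fibre cw Fz).
Qed.

Lemma tle_node_level tau t : 0 <= t -> t <= 1 -> tle tau (node w t) -> level tau <= w t.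
Proof. by move=> t0 t1 /(tle_level cw); rewrite level_node. Qed.

(** The path stays above [tau] between its first and last times, and also back to 0 or on to 1 in
    the two exceptional cases. The inequality with the last time is strict because [w t] is
    recovered from values to the right of [t]. *)
Lemma tle_node_of_times tau t : 0 <= t -> t <= 1 ->
  first_time tau <= t \/ tle tau (node w 0) ->
  t < last_time tau \/ tle tau (node w 1) -> tle tau (node w t).
Proof.
move=> t0 t1; set x := level tau.
have Fg := fibre_first_time cw tau; have Fd := fibre_last_time cw tau.
have /andP[g0 _] := first_time01 cw tau; have /andP[d0 d1] := last_time01 cw tau.
have [td gA _|dt _] := ltP t (last_time tau).
  have Hw u : t < u -> u < last_time tau -> x <= w u.
    move=> tu ud; case: gA => [gt|A].
      by apply: (@fibre_between _ _ cw tau 0 0 u _ _ Fg Fd) => //=; lra.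
    by apply: (via_fibre Fd (lexx 0) ler01 A); right => /=; apply/andP; split; lra.
  apply: (fibre_via Fd) => //.
    by apply: (right_ge cw t0 td) => //; lra.
  by move=> u /= [] /andP[? ?]; [lra | exact: Hw].
case=> [|B]; first by lra.
have xw1 : x <= w 1 := tle_node_level ler01 (lexx 1) B.
have Hw u : last_time tau < u -> u < 1 -> x <= w u.
  by move=> du u1; apply: (via_fibre Fd ler01 (lexx 1) B); left; rewrite /= du u1.
have [->//|tn1] := eqVneq t 1.
have t1' : t < 1 by rewrite lt_neqAle tn1.
apply: (fibre_via Fd) => //.
  by apply: (right_ge cw t0 t1') => // u tu u1; apply: Hw; lra.
by move=> u /= [] /andP[? ?]; [apply: Hw; lra | lra].
Qed.

Lemma node_level_lt tau t : 0 <= t -> t <= 1 -> tle tau (node w t) ->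
  tau <> node w t -> level tau < w t.
Proof.
move=> t0 t1 h ne; rewrite lt_neqAle tle_node_level // andbT.
by apply/eqP => e; apply: ne; apply: (tle_eq cw h); rewrite level_node.
Qed.

(** Off [[O, A]] the path is below the level of [tau] at some time before [t]; the last time up to
    [t] at which [lower w] is at most that level gives a point of the fibre. *)
Lemma first_time_le_of_tle tau t : 0 <= t -> t <= 1 -> tle tau (node w t) ->
  tau <> node w t -> ~ tle tau (node w 0) -> first_time tau <= t.
Proof.
move=> t0 t1 h ne nA; rewrite leNgt; apply/negP => tg; set x := level tau.
have Fg := fibre_first_time cw tau; have /andP[_ g1] := first_time01 cw tau.
have xt := node_level_lt t0 t1 h ne.
have Hw u : t < u -> u < first_time tau -> x <= w u.
  by move=> tu ug; apply: (via_fibre Fg t0 t1 h); right; rewrite /= tu ug.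
have [u [u0 ut wu]] : exists u, [/\ 0 <= u, u <= t & w u < x].
  apply: contrapT => H; apply: nA.
  have Hx u : 0 <= u -> u <= t -> x <= w u.
    by move=> u0 ut; rewrite leNgt; apply/negP => wu; apply: H; exists u.
  apply: (fibre_via Fg) => //; first exact: Hx.
  move=> u /= [] /andP[u1 u2]; first lra.
  by have [ut|tu] := leP u t; [apply: Hx; lra | exact: Hw].
have [|s [s0 st ls Hs]] := @left_hit _ _ cw t x t0 t1.
  by exists u; split; [exact: u0 | exact: ut | exact: le_trans (lower_le w u) (ltW wu)].
have Fs : fibre tau (s, x).
  have cross v : s < v -> v < first_time tau -> x <= w v.
    move=> sv vg; have [vt|tv] := leP v t; last exact: Hw.
    by apply/ltW/(lt_le_trans (Hs v sv vt)); exact: lower_le.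
  have Gs : filled_graph w (s, x).
    split; first by rewrite /= s0; lra.
    rewrite /= ls /=; have [st'|ts] := ltP s t.
      by apply: (upper_right cw s0 st' t1) => v sv vt; apply: cross; lra.
    have -> : s = t by apply/eqP; rewrite eq_le st.
    exact: le_trans (ltW xt) (le_upper _ _).
  apply/(fibreE cw); split; [exact: Gs | by [] | ].
  have A : above w x (s, x) (first_time tau, x).
    by split; [exact: lexx | exact: lexx | move=> v /= [] /andP[? ?]; [exact: cross | lra]].
  have /(fibreE cw)[Gg _ A'] := Fg.
  exact: (above_trans cw (repr_graph tau) Gg Gs A' (above_sym A)).
by have := first_time_le cw Fs; rewrite /=; lra.
Qed.

Lemma last_time_gt_of_tle tau t : 0 <= t -> t <= 1 -> tle tau (node w t) ->
  tau <> node w t -> ~ tle tau (node w 1) -> t < last_time tau.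
Proof.
move=> t0 t1 h ne nB; rewrite ltNge; apply/negP => dt; set x := level tau.
have Fd := fibre_last_time cw tau; have /andP[d0 d1] := last_time01 cw tau.
have xt := node_level_lt t0 t1 h ne.
have Hw u : last_time tau < u -> u < t -> x <= w u.
  by move=> tu ug; apply: (via_fibre Fd t0 t1 h); left; rewrite /= tu ug.
have t1' : t < 1.
  by rewrite lt_neqAle t1 andbT; apply/eqP => e; apply: nB; rewrite -e.
have [u [tu u1 wu]] : exists u, [/\ t <= u, u <= 1 & w u < x].
  apply: contrapT => H; apply: nB.
  have Hx u : t <= u -> u <= 1 -> x <= w u.
    by move=> u0 ut; rewrite leNgt; apply/negP => wu; apply: H; exists u.
  apply: (fibre_via Fd) => //; first exact: Hx.
  move=> u /= [] /andP[u1 u2]; last lra.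
  by have [ut|tu] := leP t u; [apply: Hx; lra | exact: Hw].
have xy : x < (x + w t) / 2 by rewrite -/x in xt; lra.
have [e e0 He] : exists2 e, 0 < e & forall v, t <= v -> v < t + e -> (x + w t) / 2 < w v.
  by apply: (right_gt cw t0 t1'); rewrite -/x in xt; lra.
have eu : t + e <= u.
  by rewrite leNgt; apply/negP => ut; have := He u tu ut; lra.
(* Strictness is gained by searching from [t']: the path is still strictly above the level there, so
   the hitting time lies strictly after [t]. *)
pose t' := t + e / 2.
have [tt' t'e] : t < t' /\ t' < t + e by rewrite /t'; split; lra.
have t'1 : t' <= 1 by lra.
have [|||s [ts s1 ls Hs]] := @right_hit _ _ cw t' x; [lra|lra| |].
  by exists u; split; [lra | exact: u1 | exact: le_trans (lower_le w u) (ltW wu)].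
have lt' : x < lower w t'.
  rewrite lt_lower (lt_trans xy (He _ (ltW tt') t'e)) andbT; apply: (lt_le_trans xy).
  apply: (@left_ge _ _ cw t' t); [lra | exact: t'1 | exact: tt' | ].
  by move=> v tv vt; apply/ltW/He; lra.
have t's : t' < s.
  by rewrite lt_neqAle ts andbT; apply/eqP => E; move: ls; rewrite -E leNgt lt'.
have cross v : last_time tau < v -> v < s -> x <= w v.
  move=> dv vs; have [vt|tv] := ltP v t; first exact: Hw.
  have [vt'|tv'] := ltP v t'.
    by have := He v tv; rewrite -/x in xt; have : v < t + e by [lra]; move=> h1 /(_ h1); lra.
  by apply/ltW/(lt_le_trans (Hs v tv' vs)); exact: lower_le.
have Gs : filled_graph w (s, x).
  split; first by rewrite /= s1 andbT; lra.
  rewrite /= ls /=; apply: (@upper_left _ _ cw s t'); [lra | exact: t's | exact: s1 | ].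
  by move=> v tv vs; apply: cross; lra.
have Fs : fibre tau (s, x).
  apply/(fibreE cw); split; [exact: Gs | by [] | ].
  have A : above w x (last_time tau, x) (s, x).
    by split; [exact: lexx | exact: lexx | move=> v /= [] /andP[? ?]; [exact: cross | lra]].
  have /(fibreE cw)[Gd _ A'] := Fd.
  exact: (above_trans cw (repr_graph tau) Gd Gs A' A).
by have := last_time_ge cw Fs; rewrite /=; lra.
Qed.

(* [g]: the first time is at most [t]; [d]: the last time is after [t];
   [A], [B], [T]: the point lies on [O, A], on [O, B], on the arc from [O] to
   the node of [t]. *)
Lemma Delta_le_bool (g d A B T : bool) : (~~ g -> d) ->
  (g || A -> d || B -> T) -> (T -> ~~ A -> g) -> (T -> ~~ B -> d) ->
  (if A then 0 else g%:R) - (if B then 0 else (~~ d)%:R) = T%:R - A%:R :> R.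
Proof.
case: g; case: d; case: A; case: B; case: T => //= h1 h2 h3 h4;
  rewrite ?subrr ?subr0 ?sub0r //; by [have := h1 isT | have := h2 isT isT | have := h3 isT isT | have := h4 isT isT].
Qed.

(** The term at [node w 0] is the trace of the convention on [[O, A]]; it cancels for the indicator
    of []s, t]], leaving the difference of two arcs from the root. *)
Lemma Delta_le t tau : 0 <= t -> t <= 1 -> tau <> node w t ->
  Delta (fun x => (x <= t)%R%:R) tau =
  `[< tle tau (node w t) >]%:R - `[< tle tau (node w 0) >]%:R :> R.
Proof.
move=> t0 t1 ne; rewrite /Delta.
have EA : `[< arc (tree_O w) (tree_A w) tau >] = `[< tle tau (node w 0) >].
  by apply/asbool_equiv_eq; rewrite tree_A_node //; exact: arc_rootP.
have EB : `[< arc (tree_O w) (tree_B w) tau >] = `[< tle tau (node w 1) >].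
  by apply/asbool_equiv_eq; rewrite tree_B_node //; exact: arc_rootP.
rewrite EA EB.
rewrite [last_time tau <= t]leNgt; apply: Delta_le_bool.
- by move=> tg; apply: lt_le_trans (first_le_last cw tau); rewrite ltNge.
- move=> gA dB; apply/asboolP; apply: tle_node_of_times => //.
    by case/orP: gA => [?|/asboolP ?]; [left | right].
  by case/orP: dB => [?|/asboolP ?]; [left | right].
- by move=> /asboolP h /asboolP nA; exact: first_time_le_of_tle.
- by move=> /asboolP h /asboolP nB; exact: last_time_gt_of_tle.
Qed.

Lemma indic_oc (s t x : R) : s <= t ->
  \1_`]s, t] x = (x <= t)%R%:R - (x <= s)%R%:R :> R.
Proof.
move=> st; rewrite indicE mem_setE in_itv /= ltNge.
case: (leP x s) => xs /=; first by rewrite (le_trans xs st) subrr.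
by rewrite subr0.
Qed.

Lemma DeltaD (r r' : R -> R) tau : Delta (r \+ r') tau = Delta r tau + Delta r' tau.
Proof. by rewrite /Delta; case: ifP; case: ifP; rewrite /=; lra. Qed.

Lemma DeltaB (r r' : R -> R) tau : Delta (r \- r') tau = Delta r tau - Delta r' tau.
Proof. by rewrite /Delta; case: ifP; case: ifP; rewrite /=; lra. Qed.

Lemma DeltaZ (c : R) (r : R -> R) tau : Delta (fun x => c * r x) tau = c * Delta r tau.
Proof. by rewrite /Delta mulrBr; case: ifP; case: ifP; rewrite /= ?mulr0. Qed.

Lemma indic_asbool (T : Type) (A : set T) (x : T) : \1_A x = `[< A x >]%:R :> R.
Proof. by rewrite indicE. Qed.

Lemma subrBB (a b c : R) : a - c - (b - c) = a - b.
Proof. by rewrite opprB addrA subrK. Qed.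

Lemma Delta_indic (s t : R) tau : 0 <= s -> s <= t -> t <= 1 ->
  tau <> node w s -> tau <> node w t ->
  Delta \1_`]s, t] tau =
  `[< tle tau (node w t) >]%:R - `[< tle tau (node w s) >]%:R :> R.
Proof.
move=> s0 st t1 ns nt.
have -> : \1_`]s, t] = (fun x => (x <= t)%R%:R) \- (fun x => (x <= s)%R%:R) :> (R -> R).
  by apply/funext => x; rewrite indic_oc.
rewrite DeltaB (Delta_le (le_trans s0 st) t1 nt) (Delta_le s0 (le_trans st t1) ns).
exact: subrBB.
Qed.

Context (lam : {measure set (borel_tree w) -> \bar R}) (hlam : length_measure lam).

Lemma integrable_tle sigma : lam.-integrable setT
  (fun tau : borel_tree w => (\1_[set tau | tle tau sigma] tau)%:E).
Proof.
have mA := measurable_tle cw sigma.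
apply/integrableP; split; first by apply/measurable_EFinP; exact: measurable_indic.
under eq_integral do rewrite abse_EFin ger0_norm //.
by rewrite integral_indic // setIT lam_tle // ltry.
Qed.

Lemma integral_tle_node u : 0 <= u -> u <= 1 ->
  (\int[lam]_tau (\1_[set tau | tle tau (node w u)] (tau : borel_tree w))%:E =
   (w u - minw w)%:E)%E.
Proof.
move=> u0 u1; rewrite integral_indic //; last exact: measurable_tle.
by rewrite setIT lam_tle // level_node.
Qed.

Lemma step_integral (s t : R) : 0 <= s -> s <= t -> t <= 1 ->
  (\int[lam]_tau (Delta \1_`]s, t] tau)%:E = (w t - w s)%:E)%E.
Proof.
move=> s0 st t1.
have mr : measurable_fun (`[0, 1] : set R) (\1_`]s, t] : R -> R) by exact: measurable_indic.
rewrite (ae_eq_integral (fun tau : borel_tree w => (\1_[set tau | tle tau (node w t)] tau)%:E -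
   (\1_[set tau | tle tau (node w s)] tau)%:E)%E) //.
- rewrite integralB //; [|exact: integrable_tle|exact: integrable_tle].
  transitivity ((w t - minw w)%:E - (w s - minw w)%:E)%E; last first.
    by rewrite -EFinB; congr EFin; exact: subrBB.
  by congr (_ - _)%E; apply: integral_tle_node; lra.
- by apply/measurable_EFinP; exact: measurable_Delta.
- apply: emeasurable_funB; apply/measurable_EFinP; apply: measurable_indic; exact: measurable_tle.
exists ([set node w s] `|` [set node w t]); split.
- by apply: measurableU; exact: measurable_point.
- apply/eqP; rewrite eq_le measure_ge0 andbT.
  have h u : lam [set node w u] = 0%E by apply: lam_point.
  have : (lam ([set node w s] `|` [set node w t]) <= lam [set node w s] + lam [set node w t])%E.
    by apply: (measureU2 lam); exact: measurable_point.
  by rewrite (h s) (h t) adde0.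
move=> tau /= H; apply: contrapT => /not_orP[ns nt]; apply: H => _.
have E u : (`[< tle tau (node w u) >]%:R : R) = \1_[set tau | tle tau (node w u)] tau.
  exact: esym (indic_asbool _ _).
by rewrite -EFinB (Delta_indic s0 st t1 ns nt); congr (_ - _)%:E; exact: E.
Qed.

End Step.

Lemma continuous01P (R : realType) (f : R -> R) (t : R) : continuous01_at f t <->
  forall e, 0 < e -> exists2 d, 0 < d & forall u, 0 <= u -> u <= 1 ->
    `|t - u| < d -> `|f t - f u| < e.
Proof.
split=> [/cvgrPdist_lt H e e0|H].
  have [d /= d0 Hd] := H e e0; exists d => // u u0 u1 tu.
  by apply: Hd => //=; rewrite in_itv /= u0.
apply/cvgrPdist_lt => e /H[d d0 Hd]; exists d => //= u tu.
by rewrite in_itv /= => /andP[u0 u1]; exact: Hd.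
Qed.

(** * Countability of the discontinuities *)

Section Discontinuities.
Context {R : realType}.

(** The variation function [L] is monotone, so it has countably many discontinuities, and its
    increments dominate those of [f] to the power [q], so [f] is continuous wherever [L] is. The
    clamp [c] extends [L] beyond [[0, 1]], which makes the end points interior. *)
Lemma countable_discontinuity01 (q : R) (f : R -> R) (B : R) : 0 < q ->
  vbounded q f B -> countable [set u | 0 <= u <= 1 /\ ~ continuous01_at f u].
Proof.
move=> q0 fB.
pose c (t : R) := Num.min 1 (Num.max 0 t).
have c0 t : 0 <= c t by rewrite le_min ler01 le_max lexx.
have c1 t : c t <= 1 by rewrite ge_min lexx.
have cm s t : s <= t -> c s <= c t.
  move=> st; rewrite le_min ge_min lexx /= ge_min; apply/orP; right.
  by rewrite ge_max !le_max lexx st orbT.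
have cid t : 0 <= t -> t <= 1 -> c t = t.
  by move=> t0 t1; rewrite /c max_r // min_r.
pose L t := lvar q f 0 (c t).
have Lstep s t : s <= t -> L s + `|f (c t) - f (c s)| `^ q <= L t.
  move=> st; have h := lvar_add fB (lexx 0) (c0 s) (cm _ _ st) (c1 t).
  by apply: le_trans h; rewrite lerD2l (lvar_step fB) ?cm.
have Lm s t : s <= t -> L s <= L t.
  by move=> st; apply: le_trans (Lstep _ _ st); rewrite lerDl powR_ge0.
have nd : {in `[(-1 : R), 2] &, nondecreasing_fun L} by move=> s t _ _; exact: Lm.
apply: (sub_countable _ (discontinuity_countable nd)).
apply: subset_card_le => t /= [/andP[t0 t1] nc].
have tI : t \in `](-1 : R), 2[ by rewrite in_itv /=; apply/andP; split; lra.
split=> //.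
have /andP[tm t2] : (-1 : R) < t < 2 by apply/andP; split; lra.
have cl : cvg (L x @[x --> t^'-]).
  apply: (@nondecreasing_at_left_is_cvgr R L t).
    by apply: nearW => *; move=> ? *; exact: Lm.
  by apply: nearW => x; exists (L t) => ? [y /=]; rewrite in_itv /= => /andP[_ yt] <-; apply/Lm/ltW.
have cr : cvg (L x @[x --> t^'+]).
  apply: (@nondecreasing_at_right_is_cvgr R L t).
    by apply: nearW => *; move=> ? *; exact: Lm.
  by apply: nearW => x; exists (L t) => ? [y /=]; rewrite in_itv /= => /andP[yt _] <-; apply/Lm/ltW.
split=> //; apply/eqP => lr; apply: nc; apply/continuous01P => e e0.
have ll : lim (L x @[x --> t^'-]) <= L t.
  by apply: limr_le => //; near=> x; apply: Lm; apply: ltW; near: x; exact: nbhs_left_lt.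
have lr' : L t <= lim (L x @[x --> t^'+]).
  by apply: limr_ge => //; near=> x; apply: Lm; apply: ltW; near: x; exact: nbhs_right_gt.
have el : lim (L x @[x --> t^'-]) = L t by apply/eqP; rewrite eq_le ll lr.
have er : lim (L x @[x --> t^'+]) = L t by apply/eqP; rewrite eq_le lr' -lr ll.
have eq0 : 0 < e `^ q by exact: powR_gt0.
have root (x : R) : 0 <= x -> x `^ q < e `^ q -> x < e.
  move=> x0; apply: contraTT; rewrite -!leNgt => ex.
  by apply: ge0_ler_powR; rewrite ?nnegrE ?(ltW q0) ?(ltW e0).
have /cvgrPdist_lt/(_ _ eq0)[d1 /= d10 H1] : L x @[x --> t^'-] --> L t by rewrite -el.
have /cvgrPdist_lt/(_ _ eq0)[d2 /= d20 H2] : L x @[x --> t^'+] --> L t by rewrite -er.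
exists (Num.min d1 d2); first by rewrite lt_min d10.
move=> u u0 u1; rewrite lt_min => /andP[ud1 ud2].
have [ut|tu|->] := ltgtP u t; last by rewrite subrr normr0.
  have h := H1 u ud1 ut; have hl : 0 <= L t - L u by rewrite subr_ge0; apply/Lm/ltW.
  have := Lstep u t (ltW ut); rewrite (cid u u0 u1) (cid t t0 t1) => hs.
  by apply: root => //; rewrite (ger0_norm hl) in h; lra.
have h := H2 u ud2 tu; have hl : 0 <= L u - L t by rewrite subr_ge0; apply/Lm/ltW.
have := Lstep t u (ltW tu); rewrite (cid u u0 u1) (cid t t0 t1) => hs.
by rewrite distrC; apply: root => //; rewrite distrC (ger0_norm hl) in h; lra.
Unshelve. all: by end_near. Qed.

End Discontinuities.

(** * Integrability and vanishing of the integrals *)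

Section TreeIntegral.
Context {R : realType} (w : R -> R) (cw : cadlag w).
Context (lam : {measure set (borel_tree w) -> \bar R}) (hlam : length_measure lam).
Context (p q : R) (p1 : 1 <= p) (q1 : 1 <= q) (pq : 1 < p^-1 + q^-1).
Context (V : R) (V0 : 0 < V) (wV : vbounded p w V).
Implicit Types (rho : R -> R) (tau : tree w).

Lemma exponent_gt0 : 0 < 1 - p * (1 - q^-1).
Proof.
have p0 : 0 < p by exact: lt_le_trans ltr01 p1.
rewrite subr_gt0 mulrBr mulr1 ltrBlDr -ltrBlDl.
by have := pq; rewrite -(ltr_pM2l p0) mulrDr divff ?gt_eqF // mulr1; lra.
Qed.

Lemma total_bound (B M : R) rho : vbounded q rho B ->
  (forall t, 0 <= t -> t <= 1 -> `|rho t| <= M) ->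
  measurable_fun (`[0, 1] : set R) rho ->
  (\int[lam]_tau `|Delta rho tau|%:E <=
    (4 / (1 - p * (1 - q^-1)) * V `^ p^-1 * (B `^ q^-1 + M))%:E)%E.
Proof.
move=> rB rM mrho; have g0 := exponent_gt0.
have p0 : 0 < p by exact: lt_le_trans ltr01 p1.
have M0 : 0 <= M by apply: le_trans (rM 0 _ _).
have D0 : 0 < V `^ p^-1 by exact: powR_gt0.
apply: (le_trans (@Delta_bound _ _ cw lam hlam p p1 V V0 wV q B M _ rho setT q1 pq rB rM mrho measurableT D0 _)).
  by move=> N a k a0 ak _; have [] := active_height cw p1 V0 wV a0 ak.
rewrite lee_fin -powRrM.
set g := 1 - p * _ in g0 *; set S := B `^ _ + M.
have S0 : 0 <= S by rewrite addr_ge0 ?powR_ge0.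
(* The exponents of [V] add up to [1/p]; the remaining power of 2 is at most 2, which with the
   factor of [Delta_bound] makes the 4. *)
have E : (2 * V) `^ (1 - q^-1) * V `^ (p^-1 * g) = 2 `^ (1 - q^-1) * V `^ p^-1.
  rewrite powRM ?(ltW V0) // -mulrA -powRD ?(gt_eqF V0) ?implybT //.
  by congr (_ * _ `^ _); rewrite /g; field; rewrite gt_eqF //= gt_eqF // (lt_le_trans ltr01).
have h2 : 2 `^ (1 - q^-1) <= 2 :> R.
  rewrite -[leRHS]powRr1 //; apply: ler_powR; first by rewrite ler1n.
  by rewrite gerBl invr_ge0 (le_trans ler01).
have -> : 2 * (2 * V) `^ (1 - q^-1) * S * (g^-1 * V `^ (p^-1 * g)) =
  2 * ((2 * V) `^ (1 - q^-1) * V `^ (p^-1 * g)) * S * g^-1 by ring.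
rewrite E.
have -> : 2 * (2 `^ (1 - q^-1) * V `^ p^-1) * S * g^-1 =
  2 `^ (1 - q^-1) * (2 * g^-1 * V `^ p^-1 * S) by ring.
have -> : 4 / g * V `^ p^-1 * S = 2 * (2 * g^-1 * V `^ p^-1 * S) by ring.
by rewrite ler_wpM2r // !mulr_ge0 ?invr_ge0 ?powR_ge0 // ltW.
Qed.

Lemma Delta_integrable (B M : R) rho : vbounded q rho B ->
  (forall t, 0 <= t -> t <= 1 -> `|rho t| <= M) ->
  measurable_fun (`[0, 1] : set R) rho -> tree_integrable lam rho.
Proof.
move=> rB rM mrho; apply/integrableP; split.
  by apply/measurable_EFinP; exact: measurable_Delta.
by under eq_integral do rewrite abse_EFin; apply: le_lt_trans (total_bound rB rM mrho) (ltry _).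
Qed.

End TreeIntegral.

Section Vanishing.
Context {R : realType} (w : R -> R) (cw : cadlag w).
Context (lam : {measure set (borel_tree w) -> \bar R}) (hlam : length_measure lam).
Implicit Types (rho : R -> R) (tau : tree w).

Lemma continuous_left_lim u : 0 <= u -> u <= 1 -> continuous01_at w u ->
  left_lim w u = w u.
Proof.
move=> u0 u1 /continuous01P cu; have [->|un0] := eqVneq u 0; first exact: left_lim0.
have {un0}u0' : 0 < u by rewrite lt_neqAle eq_sym un0.
apply/eqP; rewrite -subr_eq0 -normr_le0; apply/ler_addgt0Pr => e e0; rewrite add0r.
have e2 : 0 < e / 2 by rewrite divr_gt0.
have [d d0 Hd] := cu _ e2; have [d' d'0 Hd'] := cadlag_left cw u0' u1 e2.
pose m := Num.min (Num.min d d') u.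
have m0 : 0 < m by rewrite !lt_min d0 d'0.
have [md md' mu] : [/\ m <= d, m <= d' & m <= u].
  by rewrite /m; split; rewrite !ge_min lexx ?orbT.
pose v := u - m / 2.
have h1 : `|w u - w v| < e / 2.
  by apply: Hd; rewrite /v; [lra|lra|rewrite opprB addrCA subrr addr0 ger0_norm; lra].
have h2 : `|left_lim w u - w v| < e / 2 by apply: Hd'; rewrite /v; lra.
rewrite (_ : left_lim w u - w u = (left_lim w u - w v) - (w u - w v)); last by lra.
by apply: (le_trans (ler_normB _ _)); lra.
Qed.

Lemma continuous_time_node tau u : 0 <= u -> u <= 1 -> continuous01_at w u ->
  fibre tau (u, level tau) -> tau = node w u.
Proof.
move=> u0 u1 cu F; have /andP[] := fibre_lower cw F.
have cl := continuous_left_lim u0 u1 cu.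
have [-> ->] := jump_continuous cl.
move=> h1 h2; have E : level tau = w u by apply/eqP; rewrite eq_le h1 h2.
by rewrite E in F; exact: (fibre_eq cw F (fibre_node w u0 u1)).
Qed.

(** At a continuity time of [w] only one point of the tree is visited, so these points form a
    countable set, and single points have length 0. *)
Lemma negligible_times (X : set R) : countable X ->
  (forall u, X u -> [/\ 0 <= u, u <= 1 & continuous01_at w u]) ->
  lam.-negligible [set tau : borel_tree w | X (first_time tau) \/ X (last_time tau)].
Proof.
move=> /countable_injP[f fi] HX.
apply: (@negligibleS _ _ _ lam (\bigcup_n [set tau : borel_tree w | exists u, [/\ X u, f u = n & tau = node w u]])).
  move=> tau [] Xu.
    exists (f (first_time tau)) => //; exists (first_time tau); split=> //.
    have [u0 u1 cu] := HX _ Xu; apply: continuous_time_node => //; exact: fibre_first_time.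
  exists (f (last_time tau)) => //; exists (last_time tau); split=> //.
  have [u0 u1 cu] := HX _ Xu; apply: continuous_time_node => //; exact: fibre_last_time.
apply: negligible_bigcup => n.
have [[u [Xu fu]]|H] := pselect (exists u, X u /\ f u = n).
  exists [set node w u]; split; [exact: measurable_point | exact: lam_point |].
  by move=> tau [v [Xv fv ->]] /=; congr (node w _); apply: fi; rewrite ?inE // fu.
apply: (@negligibleS _ _ _ lam set0); last exact: negligible_set0.
by move=> tau [u [Xu fu _]]; apply: H; exists u.
Qed.

End Vanishing.

Section DeltaVanish.
Context {R : realType} (w : R -> R) (cw : cadlag w).
Context (lam : {measure set (borel_tree w) -> \bar R}) (hlam : length_measure lam).
Context (p q : R) (p1 : 1 <= p) (q1 : 1 <= q) (pq : 1 < p^-1 + q^-1).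
Context (V : R) (V0 : 0 < V) (wV : vbounded p w V).

Lemma Delta_norm_le (M : R) (rho : R -> R) (tau : tree w) :
  (forall t, 0 <= t -> t <= 1 -> `|rho t| <= M) -> `|Delta rho tau| <= 2 * M.
Proof.
move=> rM; have M0 : 0 <= M by apply: le_trans (rM 0 _ _).
have /andP[g0 g1] := first_time01 cw tau; have /andP[d0 d1] := last_time01 cw tau.
have hg := rM _ g0 g1; have hd := rM _ d0 d1.
rewrite /Delta; apply: (le_trans (ler_normB _ _)).
by case: ifP => _; case: ifP => _; rewrite ?normr0; lra.
Qed.

Lemma Delta_vanish (B M : R) (eta : nat -> R -> R) (X : set R) :
  (forall n, vbounded q (eta n) B) ->
  (forall n t, 0 <= t -> t <= 1 -> `|eta n t| <= M) ->
  (forall n, measurable_fun (`[0, 1] : set R) (eta n)) ->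
  countable X -> (forall u, X u -> [/\ 0 <= u, u <= 1 & continuous01_at w u]) ->
  (forall u, 0 <= u -> u <= 1 -> ~ X u -> eta n u @[n --> \oo] --> (0 : R)) ->
  (\int[lam]_tau `|Delta (eta n) tau|%:E)%E @[n --> \oo] --> 0%E.
Proof.
move=> eB eM meta cX HX ecv.
have M0 : 0 <= M by apply: le_trans (eM 0%N 0 _ _).
have mD n : measurable_fun setT (fun tau : borel_tree w => `|Delta (eta n) tau|%:E).
  by apply/measurable_EFinP; apply: measurableT_comp => //; exact: measurable_Delta.
have g0 := exponent_gt0 p1 pq; set g := 1 - p * (1 - q^-1) in g0.
set K := 2 * (2 * V) `^ (1 - q^-1) * (B `^ q^-1 + M).
have K0 : 0 <= K by rewrite !mulr_ge0 ?powR_ge0 // ?addr_ge0 ?powR_ge0 // ltW.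
have deep_cv c : 0 < c ->
    (\int[lam]_(tau in deep (w := w) c) `|Delta (eta n) tau|%:E)%E @[n --> \oo] --> 0%E.
  move=> c0; have mE := measurable_deep cw c.
  have [|||||_ _ H] := @dominated_convergence _ _ _ lam (deep c) mE
    (fun n tau => `|Delta (eta n) tau|%:E) (cst 0%E) (cst (2 * M)%:E).
  - by move=> n; exact: measurable_funS (mD n).
  - exact: measurable_cst.
  - apply: (@negligibleS _ _ _ lam [set tau : borel_tree w | X (first_time tau) \/ X (last_time tau)]);
      last exact: negligible_times.
    move=> tau /= /not_implyP[_ H]; apply: contrapT => /not_orP[nf nl]; apply: H.
    have /andP[f0 f1] := first_time01 cw tau; have /andP[l0 l1] := last_time01 cw tau.
    have hf := ecv _ f0 f1 nf; have hl := ecv _ l0 l1 nl.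
    suff : Delta (eta n) tau @[n --> \oo] --> (0 : R).
      by move=> h; apply/cvg_EFin; [exact: nearW | rewrite /= -(@normr0 _ R); exact: cvg_norm].
    have cv_if (b : bool) (a : nat -> R) : a n @[n --> \oo] --> (0 : R) ->
        (if b then 0 else a n) @[n --> \oo] --> (0 : R).
      by case: b => // _; exact: cvg_cst.
    by rewrite -(subrr (0 : R)) /Delta; apply: cvgB; exact: cv_if.
  - apply/integrableP; split; first exact: measurable_cst.
    rewrite (eq_integral (cst (2 * M)%:E)); last first.
      by move=> tau _; rewrite /= ger0_norm // mulr_ge0.
    rewrite integral_cst //; apply: lte_mul_pinfty; rewrite ?lee_fin ?mulr_ge0 //.
    exact: (lam_deep_fin cw hlam p1 V0 wV c0).
  - apply: aeW => tau n _; rewrite /= normr_id lee_fin; exact: Delta_norm_le (eM n).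
  by move: H; rewrite integral0.
have split_int n c : (\int[lam]_tau `|Delta (eta n) tau|%:E =
    \int[lam]_(tau in deep (w := w) c) `|Delta (eta n) tau|%:E +
    \int[lam]_(tau in ~` deep (w := w) c) `|Delta (eta n) tau|%:E)%E.
  have mE := measurable_deep cw c.
  rewrite -ge0_integral_setU ?setUv //; first exact: measurableC.
  by rewrite disj_set2E setICr.
have small e : 0 < e -> exists2 c, 0 < c & forall n,
    (\int[lam]_(tau in ~` deep (w := w) c) `|Delta (eta n) tau|%:E <= e%:E)%E.
  (* At height [c] with [c ^ g = d] the bound is [K / g * d = e * (K / (K + 1))], at most [e]; the
     [+ 1] covers [K = 0]. *)
  move=> e0; pose d := e * g / (K + 1).
  have d0 : 0 < d by rewrite divr_gt0 ?mulr_gt0 // ltr_wpDl.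
  have c0 : 0 < d `^ g^-1 by exact: powR_gt0.
  exists (d `^ g^-1) => // n.
  have mE := measurableC (measurable_deep cw (d `^ g^-1)).
  apply: (le_trans (Delta_bound cw hlam p1 V0 wV q1 pq (eB n) (eM n) (meta n) mE c0 _)).
    by move=> N a k a0 ak; exact: shallow_active.
  rewrite lee_fin -/K -/g -powRrM mulVf ?gt_eqF // powRr1 ?(ltW d0) //.
  rewrite mulrA /d; have -> : K / g * (e * g / (K + 1)) = e * (K / (K + 1)).
    by field; rewrite !gt_eqF // ltr_wpDl.
  rewrite ger_pMr // ler_pdivrMr ?mul1r ?lerDl // ltr_wpDl //.
apply/fine_cvgP; split.
  apply: nearW => n; rewrite ge0_fin_numE; last by apply: integral_ge0.
  apply: le_lt_trans (total_bound cw hlam p1 q1 pq V0 wV (eB n) (eM n) (meta n)) (ltry _).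
apply/cvgrPdist_le => e e0.
have e2 : 0 < e / 2 by rewrite divr_gt0.
have [c c0 Hc] := small _ e2.
have /fine_cvgP[fin1 /cvgrPdist_le/(_ _ e2) cv1] := deep_cv c c0.
near=> n.
have fn : (\int[lam]_(tau in deep (w := w) c) `|Delta (eta n) tau|%:E)%E \is a fin_num.
  by near: n; exact: fin1.
have dn : `|0 - fine (\int[lam]_(tau in deep (w := w) c) `|Delta (eta n) tau|%:E)%E| <= e / 2.
  by near: n; exact: cv1.
have h2 := Hc n.
have fn2 : (\int[lam]_(tau in ~` deep (w := w) c) `|Delta (eta n) tau|%:E)%E \is a fin_num.
  by rewrite ge0_fin_numE ?integral_ge0 //; exact: le_lt_trans h2 (ltry _).
rewrite /= (split_int n c) fineD // sub0r normrN ger0_norm; last first.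
  by rewrite addr_ge0 // fine_ge0 // integral_ge0.
rewrite sub0r normrN ger0_norm in dn; last by rewrite fine_ge0 // integral_ge0.
have : fine (\int[lam]_(tau in ~` deep (w := w) c) `|Delta (eta n) tau|%:E)%E <= e / 2.
  by rewrite -lee_fin fineK.
by move: dn; set A := fine _; set A' := fine _; lra.
Unshelve. all: by end_near. Qed.

End DeltaVanish.

(** * Young's inequality *)

Section Young.
Context {R : realType}.

Definition zsum (th : R) (n : nat) : R := \sum_(0 <= k < n) k.+1%:R `^ (- th).

(** Discrete comparison with an integral: each term after the first is below a telescoping
    difference of powers [- b]. That inequality follows from [exp x >= 1 + x] and
    [ln (1 - 1/m) <= - 1/m]. *)
Lemma zsum_le (th : R) n : 1 < th -> zsum th n <= 1 + (th - 1)^-1.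
Proof.
move=> th1; set b := th - 1; have b0 : 0 < b by rewrite subr_gt0.
case: n => [|n]; first by rewrite /zsum big_geq // addr_ge0 // invr_ge0 ltW.
suff H : zsum th n.+1 <= 1 + b^-1 * (1 - n.+1%:R `^ (- b)).
  by apply: (le_trans H); rewrite lerD2l ger_pMr ?invr_gt0 // gerBl powR_ge0.
elim: n => [|n IH].
  by rewrite /zsum big_nat1 !powR1 subrr mulr0 addr0.
rewrite /zsum big_nat_recr //= -/(zsum th n.+1).
suff key : n.+2%:R `^ (- th) <= b^-1 * (n.+1%:R `^ (- b) - n.+2%:R `^ (- b)) :> R.
  have : b^-1 * (1 - n.+1%:R `^ (- b)) + b^-1 * (n.+1%:R `^ (- b) - n.+2%:R `^ (- b)) =
    b^-1 * (1 - n.+2%:R `^ (- b)) :> R by ring.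
  by lra.
have m0 : (0 : R) < n.+1%:R by rewrite ltr0n.
have m20 : (0 : R) < n.+2%:R by rewrite ltr0n.
have -> : - th = - b - 1 by rewrite /b; lra.
rewrite ler_pdivlMl // powRD ?(gt_eqF m20) ?implybT //.
rewrite powR_inv1 ?(ltW m20) //.
set y := n.+2%:R `^ (- b).
have y0 : 0 < y by exact: powR_gt0.
suff h : 1 + b / n.+2%:R <= n.+1%:R `^ (- b) / y.
  rewrite ler_pdivlMr // in h.
  have -> : b * (y * n.+2%:R^-1) = (1 + b / n.+2%:R) * y - y by ring.
  by rewrite lerD2r.
have -> : n.+1%:R `^ (- b) / y = expR (- b * ln (n.+1%:R / n.+2%:R)).
  rewrite /y -[in RHS]ln_powR lnK; last by rewrite posrE powR_gt0 // divr_gt0.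
  rewrite powRM ?invr_ge0 ?(ltW m0) ?(ltW m20) //; congr (_ * _).
  by rewrite -[in RHS]powR_inv1 ?(ltW m20) // -powRrM mulN1r opprK powRN invrK.
apply: le_trans (expR_ge1Dx _).
rewrite lerD2l -mulrN1 -mulrA mulrA [b * -1 * _](_ : _ = b * - ln (n.+1%:R / n.+2%:R)); last by ring.
rewrite ler_pM2l //.
have := @le_ln1Dx R (- n.+2%:R^-1).
have -> : 1 + - n.+2%:R^-1 = n.+1%:R / n.+2%:R :> R.
  have n2 : n.+2%:R != 0 :> R by rewrite gt_eqF.
  by apply: (mulIf n2); rewrite mulrDl mul1r mulNr mulVf // divfK // -natr1 addrK.
by move=> /(_ _) h; rewrite lerNr; apply: h; rewrite ltrN2 invf_lt1 // ltr1n.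
Qed.

Lemma exists_le_mean n (c : nat -> R) (S : R) :
  \sum_(0 <= i < n.+1) c i <= S -> exists2 i, (i < n.+1)%N & c i <= S / n.+1%:R.
Proof.
move=> cS; apply: contrapT => H.
have h i : (i < n.+1)%N -> S / n.+1%:R < c i.
  by move=> hi; rewrite ltNge; apply/negP => ci; apply: H; exists i.
have : \sum_(0 <= i < n.+1) (S / n.+1%:R) < \sum_(0 <= i < n.+1) c i.
  rewrite !big_mkord; apply: ltr_sum => [|i _]; last exact: h.
  by apply/hasP; exists ord0; rewrite ?mem_index_enum.
rewrite sumr_const_nat subn0 -[_ *+ _]mulr_natr divfK ?pnatr_eq0 //.
by rewrite ltNge cS.
Qed.

Definition skip (x : nat -> R) (i j : nat) : R := if (j <= i)%N then x j else x j.+1.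

Lemma sum_skip (F : R -> R -> R) (x : nat -> R) n i : (i < n.+1)%N ->
  \sum_(0 <= j < n.+2) F (x j) (x j.+1) =
  \sum_(0 <= j < n.+1) F (skip x i j) (skip x i j.+1) +
  (F (x i) (x i.+1) + F (x i.+1) (x i.+2) - F (x i) (x i.+2)).
Proof.
move=> ni.
rewrite (@big_cat_nat _ _ _ i.+2) //= big_nat_recr //= big_nat_recr //=.
rewrite [in RHS](@big_cat_nat _ _ _ i.+1) //= [in RHS]big_nat_recr //=.
have -> : \sum_(0 <= j < i) F (skip x i j) (skip x i j.+1) =
    \sum_(0 <= j < i) F (x j) (x j.+1).
  by apply: eq_big_nat => j /andP[_ ji]; rewrite /skip (ltnW ji) ji.
have -> : \sum_(i.+1 <= j < n.+1) F (skip x i j) (skip x i j.+1) =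
    \sum_(i.+2 <= j < n.+2) F (x j) (x j.+1).
  rewrite [RHS]big_add1 /=; apply: eq_big_nat => j /andP[ij _].
  have -> : skip x i j = x j.+1 by rewrite /skip leqNgt ij.
  by rewrite /skip leqNgt (ltnW ij : (i < j.+1)%N).
by rewrite /skip leqnn ltnn; ring.
Qed.

Context (p q : R) (p1 : 1 <= p) (q1 : 1 <= q).
Context (w rho : R -> R) (s t A B : R).
(** Infinite, weakly increasing sequences keep this form when shifted or when a point is skipped;
    finite sums read only an initial segment. *)
Let chain (x : nat -> R) := forall i, s <= x i /\ x i <= x i.+1 /\ x i.+1 <= t.
Context (wA : forall n x, chain x ->
  \sum_(0 <= i < n) `|w (x i.+1) - w (x i)| `^ p <= A).
Context (rB : forall n x, chain x ->
  \sum_(0 <= i < n) `|rho (x i.+1) - rho (x i)| `^ q <= B).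
Context (A0 : 0 <= A) (B0 : 0 <= B).

Lemma chain_skip x i : chain x -> chain (skip x i).
Proof.
move=> cx j; rewrite /skip; have [h1 [h2 h3]] := cx j; have [k1 [k2 k3]] := cx j.+1.
case: (ltngtP j i) => ji //=.
by split=> //; split=> //; exact: le_trans h2 k2.
Qed.

Lemma young_remove n x : chain x -> exists2 i, (i < n.+1)%N &
  `|rho (x i.+1) - rho (x i)| * `|w (x i.+2) - w (x i.+1)| <=
  (2 / n.+1%:R) `^ (p^-1 + q^-1) * (A `^ p^-1 * B `^ q^-1).
Proof.
move=> cx; have p0 : 0 < p by exact: lt_le_trans ltr01 p1.
have q0 : 0 < q by exact: lt_le_trans ltr01 q1.
pose a i := `|w (x i.+2) - w (x i.+1)|; pose b i := `|rho (x i.+1) - rho (x i)|.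
have cx1 : chain (fun i => x i.+1) by move=> i; exact: (cx i.+1).
have hA := wA n.+1 cx1; have hB := rB n.+1 cx.
have rhs0 : 0 <= (2 / n.+1%:R) `^ (p^-1 + q^-1) * (A `^ p^-1 * B `^ q^-1).
  by rewrite !mulr_ge0 ?powR_ge0.
have zero (f : nat -> R) (r : R) : 0 < r -> (forall i, 0 <= f i) ->
    \sum_(0 <= i < n.+1) f i `^ r <= 0 -> f 0%N = 0.
  move=> r0 f0; rewrite big_nat_recl // => h; apply: (@powR_eq0_eq0 _ _ r).
  have : 0 <= \sum_(0 <= i < n) f i.+1 `^ r by apply: sumr_ge0 => i _; exact: powR_ge0.
  by have := powR_ge0 (f 0%N) r; lra.
have [AE|An] := eqVneq A 0.
  exists 0%N => //; have -> : `|w (x 2%N) - w (x 1%N)| = 0.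
    by rewrite AE in hA; apply: (zero a p p0) => [i|]; [exact: normr_ge0 | exact: hA].
  by rewrite mulr0.
have [BE|Bn] := eqVneq B 0.
  exists 0%N => //; have -> : `|rho (x 1%N) - rho (x 0%N)| = 0.
    by rewrite BE in hB; apply: (zero b q q0) => [i|]; [exact: normr_ge0 | exact: hB].
  by rewrite mul0r.
have {An}A0' : 0 < A by rewrite lt_neqAle eq_sym An.
have {Bn}B0' : 0 < B by rewrite lt_neqAle eq_sym Bn.
(* Both normalized sums are at most 1, so for some [i] both increments are small at once, at most
   the share [2 / n.+1] of [A] and of [B]. *)
have [|i ni hi] := @exists_le_mean n (fun i => a i `^ p / A + b i `^ q / B) 2.
  rewrite big_split /= -!mulr_suml.
  have : (\sum_(0 <= i < n.+1) a i `^ p) / A <= 1 by rewrite ler_pdivrMr // mul1r.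
  have : (\sum_(0 <= i < n.+1) b i `^ q) / B <= 1 by rewrite ler_pdivrMr // mul1r.
  by lra.
exists i => //.
have n0 : (0 : R) < 2 / n.+1%:R by rewrite divr_gt0.
have ha : a i `^ p <= 2 / n.+1%:R * A.
  rewrite -ler_pdivrMr //; apply: le_trans hi.
  by rewrite lerDl divr_ge0 // powR_ge0.
have hb : b i `^ q <= 2 / n.+1%:R * B.
  rewrite -ler_pdivrMr //; apply: le_trans hi.
  by rewrite lerDr divr_ge0 // powR_ge0.
have root (r y D : R) : 0 < r -> 0 <= y -> 0 <= D -> y `^ r <= D -> y <= D `^ r^-1.
  move=> r0 y0 D0 h; have := @ge0_ler_powR _ r^-1 _ (y `^ r) D.
  rewrite !nnegrE -powRrM divff ?gt_eqF // powRr1 //; apply=> //.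
  - by rewrite invr_ge0 ltW.
  - exact: powR_ge0.
have {}ha : a i <= (2 / n.+1%:R * A) `^ p^-1.
  by apply: (root _ _ _ p0 (normr_ge0 _) _ ha); apply: mulr_ge0 => //; exact: ltW.
have {}hb : b i <= (2 / n.+1%:R * B) `^ q^-1.
  by apply: (root _ _ _ q0 (normr_ge0 _) _ hb); apply: mulr_ge0 => //; exact: ltW.
apply: (@le_trans _ _ ((2 / n.+1%:R * B) `^ q^-1 * (2 / n.+1%:R * A) `^ p^-1)).
  by apply: ler_pM.
move: (2 / n.+1%:R) n0 => e n0.
rewrite !powRM ?(ltW n0) // powRD ?(gt_eqF n0) ?implybT //.
by rewrite le_eqVlt; apply/orP; left; apply/eqP; ring.
Qed.

(** Interior points are removed one at a time, each chosen by [young_remove]: dropping [x i.+1]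
    changes the sum by exactly the product bounded there. The costs add up to a partial zeta sum,
    and a single interval remains. *)
Lemma young_diff n x : chain x ->
  `|\sum_(0 <= i < n.+1) rho (x i) * (w (x i.+1) - w (x i)) -
    rho (x 0%N) * (w (x n.+1) - w (x 0%N))| <=
  2 `^ (p^-1 + q^-1) * zsum (p^-1 + q^-1) n * (A `^ p^-1 * B `^ q^-1).
Proof.
elim: n x => [|n IH] x cx.
  by rewrite big_nat1 subrr normr0 !mulr_ge0 ?powR_ge0 // /zsum big_geq.
have [i ni hi] := young_remove n cx.
rewrite (sum_skip (fun a b => rho a * (w b - w a)) x ni).
have := IH _ (chain_skip i cx).
have -> : skip x i 0 = x 0%N by [].
have -> : skip x i n.+1 = x n.+2 by rewrite /skip leqNgt ni.
set S := \sum_(0 <= j < n.+1) _ => hS.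
have -> : rho (x i) * (w (x i.+1) - w (x i)) + rho (x i.+1) * (w (x i.+2) - w (x i.+1)) -
    rho (x i) * (w (x i.+2) - w (x i)) =
    (rho (x i.+1) - rho (x i)) * (w (x i.+2) - w (x i.+1)) by ring.
have -> : zsum (p^-1 + q^-1) n.+1 = zsum (p^-1 + q^-1) n + n.+1%:R `^ (- (p^-1 + q^-1)).
  by rewrite /zsum big_nat_recr.
rewrite [in leRHS]mulrDr [in leRHS]mulrDl.
rewrite addrAC; apply: (le_trans (ler_normD _ _)); rewrite lerD // normrM.
apply: (le_trans hi).
have -> : (2 / n.+1%:R) `^ (p^-1 + q^-1) =
    2 `^ (p^-1 + q^-1) * n.+1%:R `^ (- (p^-1 + q^-1)) :> R.
  by rewrite powRM ?invr_ge0 // -[n.+1%:R^-1]powR_inv1 // -powRrM mulN1r.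
by [].
Qed.

Lemma young_bound n x (M : R) : 1 < p^-1 + q^-1 -> chain x ->
  (forall u, s <= u -> u <= t -> `|rho u| <= M) ->
  `|\sum_(0 <= i < n) rho (x i) * (w (x i.+1) - w (x i))| <=
  A `^ p^-1 * (2 `^ (p^-1 + q^-1) * (1 + (p^-1 + q^-1 - 1)^-1) * B `^ q^-1 + M).
Proof.
move=> th1 cx rM; have p0 : 0 < p by exact: lt_le_trans ltr01 p1.
have [s0 [s1 s2]] := cx 0%N.
have M0 : 0 <= M by apply: le_trans (rM (x 0%N) s0 (le_trans s1 s2)).
have z0 : 0 <= 1 + (p^-1 + q^-1 - 1)^-1 by rewrite addr_ge0 // invr_ge0 subr_ge0 ltW.
case: n => [|n].
  by rewrite big_geq // normr0 mulr_ge0 ?addr_ge0 // ?mulr_ge0 ?powR_ge0.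
have h1 := young_diff n cx.
have h2 : `|rho (x 0%N) * (w (x n.+1) - w (x 0%N))| <= M * A `^ p^-1.
  rewrite normrM ler_pM //; first exact: rM (le_trans s1 s2).
  (* The hypothesis on [w] applied to this two-valued chain bounds the increment over the whole
     range. *)
  pose y i := if i is 0%N then x 0%N else x n.+1.
  have mono i : x 0%N <= x i by elim: i => // i IH; have [_ [? _]] := cx i; exact: le_trans IH _.
  have cy : chain y.
    have [? [? h]] := cx n; case=> [|i] /=.
      by split; [exact: s0 | split; [exact: mono | exact: h]].
    by split; [exact: le_trans s0 (mono _) | split; [exact: lexx | exact: h]].
  have := wA 1 cy; rewrite big_nat1 /= => h.
  have := @ge0_ler_powR _ p^-1 _ (`|w (x n.+1) - w (x 0%N)| `^ p) A.
  rewrite !nnegrE -powRrM divff ?gt_eqF // powRr1 //; apply=> //.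
  by rewrite invr_ge0 ltW.
set S := \sum_(0 <= i < n.+1) _ in h1 *; set T := rho _ * _ in h1 h2.
have h3 : `|S| <= `|S - T| + `|T| by rewrite -[X in `|X| <= _](subrK T); exact: ler_normD.
have h4 : 2 `^ (p^-1 + q^-1) * zsum (p^-1 + q^-1) n * (A `^ p^-1 * B `^ q^-1) <=
    2 `^ (p^-1 + q^-1) * (1 + (p^-1 + q^-1 - 1)^-1) * (A `^ p^-1 * B `^ q^-1).
  rewrite ler_wpM2r ?mulr_ge0 ?powR_ge0 // ler_wpM2l ?powR_ge0 //.
  exact: zsum_le.
apply: (le_trans h3); apply: (le_trans (lerD (le_trans h1 h4) h2)).
by rewrite le_eqVlt; apply/orP; left; apply/eqP; ring.
Qed.

End Young.

Opaque Delta.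

(** * Riemann sums *)

Section StepFunctions.
Context {R : realType}.
Implicit Types (x c : nat -> R) (rho : R -> R) (u v : R).

Definition stepfun rho x c (m : nat) (u : R) : R :=
  \sum_(0 <= i < m) rho (c i) * \1_`]x i, x i.+1] u.

Definition tagged x c (m : nat) : Prop :=
  (forall i, x i <= x i.+1) /\ (forall i, (i < m)%N -> x i <= c i <= x i.+1).

Lemma homo_points x : (forall i, x i <= x i.+1) ->
  forall i j, (i <= j)%N -> x i <= x j.
Proof.
move=> H i j; elim: j => [|j IH]; first by rewrite leqn0 => /eqP ->.
rewrite leq_eqVlt => /orP[/eqP -> //|]; rewrite ltnS => /IH h.
exact: le_trans h (H j).
Qed.

Lemma locate x m u : (forall i, x i <= x i.+1) -> x 0%N < u -> u <= x m ->
  exists i, [/\ (i < m)%N, x i < u & u <= x i.+1].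
Proof.
move=> H; elim: m => [|m IH] u0 um; first by move: u0; rewrite ltNge um.
have [h|h] := leP u (x m).
  by have [i [im xi xi1]] := IH u0 h; exists i; split=> //; exact: ltnW.
by exists m.
Qed.

Lemma locate_uniq x u i j : (forall i, x i <= x i.+1) ->
  x i < u -> u <= x i.+1 -> x j < u -> u <= x j.+1 -> i = j.
Proof.
move=> H xi ui xj uj; apply/eqP; rewrite eqn_leq; apply/andP; split.
  rewrite leqNgt; apply/negP => ji.
  by have := homo_points H ji; have := lt_le_trans xi uj; rewrite ltNge => /negP.
rewrite leqNgt; apply/negP => ij.
by have := homo_points H ij; have := lt_le_trans xj ui; rewrite ltNge => /negP.
Qed.

Lemma indic_ocE (a b u : R) : \1_`]a, b] u = ((a < u) && (u <= b))%:R :> R.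
Proof. by rewrite indicE mem_setE in_itv. Qed.

Lemma stepfunE rho x c m i u : (forall i, x i <= x i.+1) -> (i < m)%N ->
  x i < u -> u <= x i.+1 -> stepfun rho x c m u = rho (c i).
Proof.
move=> H im xi ui; rewrite /stepfun big_mkord (bigD1 (Ordinal im)) //=.
rewrite indic_ocE xi ui mulr1 big1 ?addr0 // => j ji.
rewrite indic_ocE; case: andP => [[xj uj]|_]; last by rewrite mulr0.
by case/eqP: ji; apply: val_inj => /=; exact: (locate_uniq H xj uj xi ui).
Qed.

Lemma stepfun_out rho x c m u : (forall i, x i <= x i.+1) ->
  ~ (x 0%N < u /\ u <= x m) -> stepfun rho x c m u = 0.
Proof.
move=> H hu; rewrite /stepfun big_mkord big1 // => i _.
rewrite indic_ocE; case: andP => [[xi ui]|_]; last by rewrite mulr0.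
exfalso; apply: hu; split.
  exact: le_lt_trans (homo_points H (leq0n _)) xi.
exact: le_trans ui (homo_points H (ltn_ord i)).
Qed.

(** A monotone change of time: on []x 0, x m]] the step function is [rho] composed with it, so its
    variation there is controlled by that of [rho] whatever the subdivision. The constant values
    outside preserve monotonicity. *)
Definition tagof x c m u : R :=
  if u <= x 0%N then x 0%N else if u <= x m then
    c (xget 0%N [set i | [/\ (i < m)%N, x i < u & u <= x i.+1]]) else x m.

Lemma tagof_left x c m u : u <= x 0%N -> tagof x c m u = x 0%N.
Proof. by rewrite /tagof => ->. Qed.

Lemma tagof_right x c m u : x 0%N < u -> x m < u -> tagof x c m u = x m.
Proof. by rewrite /tagof !ltNge => /negbTE -> /negbTE ->. Qed.

Lemma tagofE x c m u : (forall i, x i <= x i.+1) -> x 0%N < u -> u <= x m ->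
  exists i, [/\ (i < m)%N, x i < u, u <= x i.+1 & tagof x c m u = c i].
Proof.
move=> H u0 um; rewrite /tagof leNgt u0 um /=.
case: xgetP => [i _ [im xi ui]|/= Hn]; first by exists i.
by have [i hi] := locate H u0 um; case: (Hn i).
Qed.

Lemma stepfun_tagof rho x c m u : tagged x c m ->
  stepfun rho x c m u = rho (tagof x c m u) * \1_`]x 0%N, x m] u.
Proof.
move=> [H _]; rewrite indic_ocE; case: andP => [[u0 um]|hu].
  have [i [im xi ui ->]] := tagofE c H u0 um.
  by rewrite mulr1 (stepfunE _ _ H im xi ui).
by rewrite mulr0 stepfun_out.
Qed.

Lemma tagof_bounds x c m u : tagged x c m -> x 0%N <= tagof x c m u <= x m.
Proof.
move=> [H Hc]; have H0m := homo_points H (leq0n m).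
have [u0|u0] := leP u (x 0%N); first by rewrite tagof_left // lexx.
have [um|um] := leP u (x m); last by rewrite tagof_right // H0m lexx.
have [i [im xi ui ->]] := tagofE c H u0 um; have /andP[c1 c2] := Hc i im.
rewrite (le_trans (homo_points H (leq0n _)) c1) /=.
exact: le_trans c2 (homo_points H im).
Qed.

Lemma tagof_mono x c m u v : tagged x c m -> u <= v -> tagof x c m u <= tagof x c m v.
Proof.
move=> T uv; have [H Hc] := T; have /andP[_ bu] := tagof_bounds u T.
have /andP[bv _] := tagof_bounds v T.
have [u0|u0] := leP u (x 0%N); first by rewrite (tagof_left c m u0).
have [vm|vm] := leP v (x m); last first.
  by rewrite (tagof_right c (lt_le_trans u0 uv) vm).
have [i [im xi ui ->]] := tagofE c H u0 (le_trans uv vm).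
have [j [jm xj vj ->]] := tagofE c H (lt_le_trans u0 uv) vm.
have /andP[ci1 ci2] := Hc i im; have /andP[cj1 cj2] := Hc j jm.
have [ij|ji|->//] := ltngtP i j.
  by apply: (le_trans ci2); apply: le_trans cj1; exact: homo_points.
by have := homo_points H ji; rewrite leNgt (lt_le_trans xi (le_trans uv vj)).
Qed.

Lemma tagof_near x c m u (d : R) : tagged x c m ->
  (forall i, (i < m)%N -> x i.+1 - x i <= d) -> x 0%N < u -> u <= x m ->
  `|u - tagof x c m u| <= d.
Proof.
move=> [H Hc] Hd u0 um; have [i [im xi ui ->]] := tagofE c H u0 um.
have /andP[c1 c2] := Hc i im; have := Hd i im.
by rewrite ler_norml => *; apply/andP; split; lra.
Qed.

Lemma measurable_stepfun rho x c m (D : set R) : measurable_fun D (stepfun rho x c m).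
Proof.
by apply: measurable_sum => i; apply: measurable_funM => //; exact: measurable_indic.
Qed.

End StepFunctions.

Section RiemannSums.
Context {R : realType} (w : R -> R) (cw : cadlag w).
Context (lam : {measure set (borel_tree w) -> \bar R}) (hlam : length_measure lam).
Context (p q : R) (p1 : 1 <= p) (q1 : 1 <= q) (pq : 1 < p^-1 + q^-1).
Context (V : R) (V0 : 0 < V) (wV : vbounded p w V).

Let q0 : 0 < q. Proof. exact: lt_le_trans ltr01 q1. Qed.

Lemma vbounded_indic (s t : R) : s <= t ->
  vbounded q (\1_`]s, t] : R -> R) (2 * 1 `^ q).
Proof.
move=> st; have c0 : vbounded q (fun _ : R => 1 : R) 0.
  move=> x l _ _ _; elim: l x => //= y l IH x.
  by rewrite subrr normr0 powR0 ?gt_eqF // add0r.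
have c1 (x : R) : 0 <= x -> x <= 1 -> `|(fun _ : R => 1 : R) x| <= 1 by rewrite normr1.
have := vbounded_restrict q0 c0 ler01 st c1; rewrite add0r.
by rewrite (_ : (fun x => 1 * \1_`]s, t] x) = \1_`]s, t]) //; apply/funext => x; rewrite mul1r.
Qed.

Lemma indic_bound (s t u : R) : `|\1_`]s, t] u| <= 1 :> R.
Proof. by rewrite indicE; case: (_ \in _); rewrite ?normr1 ?normr0. Qed.

Lemma indic_integrable (s t : R) : s <= t -> tree_integrable lam (\1_`]s, t] : R -> R).
Proof.
move=> st; apply: (Delta_integrable cw hlam p1 q1 pq V0 wV (vbounded_indic st)).
  by move=> u _ _; exact: indic_bound.
exact: measurable_indic.
Qed.

Lemma stepfun_integral rho x c m : tagged x c m -> 0 <= x 0%N -> x m <= 1 ->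
  tree_integrable lam (stepfun rho x c m) /\
  tree_integral lam (stepfun rho x c m) =
  \sum_(0 <= i < m) rho (c i) * (w (x i.+1) - w (x i)).
Proof.
move=> [H _] x0; elim: m => [|m IH] xm.
  rewrite big_geq //.
  have E (tau : tree w) : Delta (stepfun rho x c 0) tau = 0.
    rewrite (_ : stepfun rho x c 0 = (fun u => 0 * (fun=> 0) u)) ?DeltaZ ?mul0r //.
    by apply/funext => u; rewrite /stepfun big_geq // mul0r.
  rewrite /tree_integrable /tree_integral; split.
    rewrite (_ : (fun _ => _) = cst 0%E); last by apply/funext => tau; rewrite E.
    exact: integrable0.
  rewrite /Rintegral (eq_integral (cst 0%E)); last by move=> tau _; rewrite E.
  by rewrite integral0.
have [IH1 IH2] := IH (le_trans (H m) xm).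
have E (tau : tree w) : Delta (stepfun rho x c m.+1) tau =
    Delta (stepfun rho x c m) tau + rho (c m) * Delta (\1_`]x m, x m.+1] : R -> R) tau.
  rewrite -DeltaZ -DeltaD; congr (Delta _ tau); apply/funext => u.
  by rewrite /stepfun big_nat_recr.
have I1 := indic_integrable (H m).
have I2 : lam.-integrable setT (fun tau : borel_tree w =>
    (rho (c m) * Delta (\1_`]x m, x m.+1] : R -> R) tau)%:E).
  rewrite (_ : (fun _ => _) = (fun tau : borel_tree w =>
    (rho (c m))%:E * (Delta (\1_`]x m, x m.+1] : R -> R) tau)%:E)%E) //.
  exact: integrableZl.
rewrite /tree_integrable /tree_integral; split.
  rewrite (_ : (fun _ => _) = (fun tau : borel_tree w => (Delta (stepfun rho x c m) tau)%:E +
    (rho (c m) * Delta (\1_`]x m, x m.+1] : R -> R) tau)%:E)%E).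
    exact: integrableD.
  by apply/funext => tau; rewrite E EFinD.
rewrite big_nat_recr //= -IH2.
under eq_Rintegral do rewrite E.
rewrite RintegralD // RintegralZl //; congr (_ + _ * _).
rewrite /Rintegral step_integral //.
exact: le_trans x0 (homo_points H (leq0n _)).
Qed.

End RiemannSums.

Transparent Delta.

Section RiemannConvergence.
Context {R : realType} (w : R -> R) (cw : cadlag w).
Context (lam : {measure set (borel_tree w) -> \bar R}) (hlam : length_measure lam).

Lemma Delta_ext (r r' : R -> R) (tau : tree w) :
  (forall t, 0 <= t -> t <= 1 -> r t = r' t) -> Delta r tau = Delta r' tau.
Proof.
move=> e; have /andP[g0 g1] := first_time01 cw tau.
have /andP[d0 d1] := last_time01 cw tau.
by rewrite /Delta (e _ g0 g1) (e _ d0 d1).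
Qed.

(** On [[0, 1]] the two functions differ only at time 0, by a multiple of the indicator of [u <= 0],
    and [Delta_le] at time 0 gives 0 off one point. *)
Lemma Delta_restrict01 (rho : R -> R) (tau : tree w) : tau <> node w 0 ->
  Delta rho tau = Delta (fun u => rho u * \1_`]0, 1] u) tau.
Proof.
move=> ne; apply/eqP; rewrite -subr_eq0 -DeltaB; apply/eqP.
rewrite (@Delta_ext _ (fun u => rho 0 * (u <= 0)%R%:R)); last first.
  move=> u u0 u1 /=; rewrite indic_ocE u1 andbT.
  have [ul|ul] := leP u 0; last by rewrite mulr1 mulr0 subrr.
  by rewrite mulr0 mulr1 subr0; congr rho; apply/eqP; rewrite eq_le ul.
by rewrite DeltaZ (Delta_le cw (lexx 0) ler01 ne) subrr mulr0.
Qed.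

Section Integrand.
Context (p q : R) (p1 : 1 <= p) (q1 : 1 <= q) (pq : 1 < p^-1 + q^-1).
Context (V : R) (V0 : 0 < V) (wV : vbounded p w V).
Context (rho : R -> R) (B M : R) (rB : vbounded q rho B).
Context (rM : forall t, 0 <= t -> t <= 1 -> `|rho t| <= M).
Context (mrho : measurable_fun (`[0, 1] : set R) rho).

Let q0 : 0 < q. Proof. exact: lt_le_trans ltr01 q1. Qed.
Let M0 : 0 <= M. Proof. exact: le_trans (normr_ge0 _) (rM (lexx 0) ler01). Qed.

Lemma restrict_integrable s t : s <= t ->
  tree_integrable lam (fun u => rho u * \1_`]s, t] u).
Proof.
move=> st; apply: (Delta_integrable cw hlam p1 q1 pq V0 wV (vbounded_restrict q0 rB M0 st rM)
  (M := M)).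
  move=> u u0 u1; rewrite normrM -[leRHS]mulr1.
  by apply: ler_pM => //; [exact: rM | exact: indic_bound].
by apply: measurable_funM => //; exact: measurable_indic.
Qed.

Lemma rho_integrable : tree_integrable lam rho.
Proof. exact: (Delta_integrable cw hlam p1 q1 pq V0 wV rB rM mrho). Qed.

Lemma tree_integral_01 : tree_integral lam rho = tree_integral_on lam rho 0 1.
Proof.
rewrite /tree_integral_on /tree_integral /Rintegral; congr fine.
apply: ae_eq_integral => //.
- by have /integrableP[] := rho_integrable.
- by have /integrableP[] := restrict_integrable ler01.
exists [set node w 0]; split; [exact: measurable_point | exact: lam_point | ].
by move=> tau /= H; apply: contrapT => ne; apply: H => _; rewrite Delta_restrict01.
Qed.

Lemma tree_integral_on_chasles s u t : s <= u -> u <= t ->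
  tree_integral_on lam rho s t =
  tree_integral_on lam rho s u + tree_integral_on lam rho u t.
Proof.
move=> su ut; rewrite /tree_integral_on /tree_integral.
rewrite -RintegralD //; [|exact: restrict_integrable|exact: restrict_integrable].
apply: eq_Rintegral => tau _; rewrite -DeltaD; congr (Delta _ tau); apply/funext => v /=.
rewrite -mulrDr; congr (_ * _); rewrite !indic_ocE.
have [vu|vu] := leP v u; first by rewrite (le_trans vu ut) /= addr0.
by rewrite (le_lt_trans su vu) /= add0r.
Qed.

Context (hcont : forall t, 0 <= t <= 1 -> ~ continuous01_at w t -> continuous01_at rho t).

(** The error is the integral of [eta n], the restriction to []s, t]] of [rho \o kap n] minus [rho].
    As [kap n] is monotone, the [q]-variation of [eta n] is bounded uniformly in [n], and [eta n]
    tends to 0 wherever [rho] is continuous, since [kap n] tends to the identity. *)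
Lemma riemann_cvg (s t : R) (x c : nat -> nat -> R) (m : nat -> nat) (d : nat -> R) :
  0 <= s -> s <= t -> t <= 1 -> (forall n, tagged (x n) (c n) (m n)) ->
  (forall n, x n 0%N = s) -> (forall n, x n (m n) = t) ->
  (forall n i, (i < m n)%N -> x n i.+1 - x n i <= d n) -> d n @[n --> \oo] --> (0 : R) ->
  \sum_(0 <= i < m n) rho (c n i) * (w (x n i.+1) - w (x n i)) @[n --> \oo] -->
    tree_integral_on lam rho s t.
Proof.
move=> s0 st t1 T xs xt mesh d0.
pose kap n u := tagof (x n) (c n) (m n) u.
have kst n u : s <= kap n u <= t by have := tagof_bounds u (T n); rewrite xs xt.
have k01 n u : 0 <= kap n u /\ kap n u <= 1.
  by have /andP[h1 h2] := kst n u; split; [exact: le_trans h1 | exact: le_trans t1].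
pose eta n := stepfun rho (x n) (c n) (m n) \- (fun u => rho u * \1_`]s, t] u).
have etaE n : eta n = (fun u => ((rho \o kap n) \- rho) u * \1_`]s, t] u).
  apply/funext => u; rewrite /eta /= (stepfun_tagof _ _ (T n)) xs xt mulrBl //.
have eB n : vbounded q (eta n) (2 `^ q * (B + B) + 2 * (M + M) `^ q).
  rewrite etaE; apply: vbounded_restrict => //.
  - apply: vbounded_sub => //; apply: vbounded_comp => //.
    by move=> u v _ uv _; exact: tagof_mono.
  - by rewrite addr_ge0.
  - move=> u u0 u1 /=; apply: (le_trans (ler_normB _ _)).
    by have [? ?] := k01 n u; rewrite lerD // rM.
have eM n u : 0 <= u -> u <= 1 -> `|eta n u| <= M + M.
  move=> u0 u1; rewrite etaE normrM -[leRHS]mulr1.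
  apply: ler_pM => //; last exact: indic_bound.
  apply: (le_trans (ler_normB _ _)).
  by have [? ?] := k01 n u; rewrite lerD // rM.
have meta n : measurable_fun (`[0, 1] : set R) (eta n).
  apply: measurable_funB; first exact: measurable_stepfun.
  by apply: measurable_funM => //; exact: measurable_indic.
have cX := countable_discontinuity01 q0 rB.
(* Here the continuity of [rho] at the jumps of [w] is used: the exceptional times are continuity
   times of [w]. *)
have HX u : [set u | 0 <= u <= 1 /\ ~ continuous01_at rho u] u ->
    [/\ 0 <= u, u <= 1 & continuous01_at w u].
  by move=> /= [/andP[u0 u1] nr]; split=> //; apply: contrapT => nw; apply: nr;
    apply: hcont => //; rewrite u0.
have ecv u : 0 <= u -> u <= 1 -> ~ [set u | 0 <= u <= 1 /\ ~ continuous01_at rho u] u ->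
    eta n u @[n --> \oo] --> (0 : R).
  move=> u0 u1 /= nX.
  have /continuous01P cu : continuous01_at rho u.
    by apply: contrapT => h; apply: nX; rewrite u0 u1.
  apply/cvgrPdist_lt => e e0; have [dl dl0 Hdl] := cu e e0.
  have /cvgrPdist_lt/(_ _ dl0) hd := d0.
  near=> n; rewrite sub0r normrN etaE indic_ocE.
  have [/= /andP[su ut]|_] := boolP (_ && _); last by rewrite mulr0 normr0.
  rewrite mulr1 distrC; have [k0 k1] := k01 n u; apply: Hdl => //.
  have hm : `|u - kap n u| <= d n.
    by apply: tagof_near; rewrite ?xs ?xt //; exact: mesh.
  apply: (le_lt_trans hm); apply: (le_lt_trans (ler_norm _)).
  by have : `|0 - d n| < dl; [near: n | rewrite sub0r normrN].
have Hv := Delta_vanish cw hlam p1 q1 pq V0 wV eB eM meta cX HX ecv.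
have I1 := restrict_integrable st.
have hdist n : `|\sum_(0 <= i < m n) rho (c n i) * (w (x n i.+1) - w (x n i)) -
    tree_integral_on lam rho s t| <= fine (\int[lam]_tau `|Delta (eta n) tau|%:E)%E.
  have [||I2 <-] := stepfun_integral cw hlam p1 q1 pq V0 wV rho (T n); rewrite ?xs ?xt //.
  rewrite /tree_integral_on /tree_integral -RintegralB //.
  have I3 : lam.-integrable setT (EFin \o (fun tau : borel_tree w =>
      Delta (stepfun rho (x n) (c n) (m n)) tau - Delta (fun u => rho u * \1_`]s, t] u) tau)).
    rewrite (_ : EFin \o _ = (fun tau : borel_tree w => (Delta (stepfun rho (x n) (c n) (m n)) tau)%:E -
      (Delta (fun u => rho u * \1_`]s, t] u) tau)%:E)%E) //.
    exact: integrableB.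
  apply: (le_trans (le_normr_Rintegral measurableT I3)).
  rewrite /Rintegral le_eqVlt; apply/orP; left; apply/eqP; congr fine.
  by apply: eq_integral => tau _; rewrite -DeltaB.
apply/cvgrPdist_le => e e0.
have /fine_cvgP[_ /cvgrPdist_le/(_ _ e0) h] := Hv.
near=> n; rewrite distrC; apply: (le_trans (hdist n)).
apply: (le_trans (ler_norm _)).
have : `|0 - fine (\int[lam]_tau `|Delta (eta n) tau|%:E)%E| <= e by near: n; exact: h.
by rewrite sub0r normrN.
Unshelve. all: by end_near. Qed.

End Integrand.
End RiemannConvergence.

(** * From local bounds to variation *)

Section Chains.
Context {R : realType} (p : R) (p0 : 0 < p) (f : R -> R) (B : R) (fB : vbounded p f B).

Lemma sum_chain_lvar (s t : R) (x : nat -> R) n : 0 <= s -> s <= t -> t <= 1 ->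
  (forall i, s <= x i /\ x i <= x i.+1 /\ x i.+1 <= t) ->
  \sum_(0 <= i < n) `|f (x i.+1) - f (x i)| `^ p <= lvar p f s t.
Proof.
move=> s0 st t1 cx.
have xs i : s <= x i by case: (cx i).
have xt i : x i <= t by have [_ [h1 h2]] := cx i; exact: le_trans h2.
have x0 i : 0 <= x i by exact: le_trans (xs i).
have x1 i : x i <= 1 by exact: le_trans t1.
have xm i : x i <= x i.+1 by have [_ []] := cx i.
have mono i : x 0%N <= x i by elim: i => // i IH; exact: le_trans IH (xm i).
have H k : \sum_(0 <= i < k) `|f (x i.+1) - f (x i)| `^ p <= lvar p f (x 0%N) (x k).
  elim: k => [|k IH]; first by rewrite big_geq // (lvar_ge0 fB).
  rewrite big_nat_recr //=.
  apply: le_trans (lvar_add fB (x0 0%N) (mono k) (xm k) (x1 _)).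
  by rewrite lerD // (lvar_step fB).
apply: (le_trans (H n)).
have h1 := lvar_add fB s0 (xs 0%N) (mono n) (x1 n).
have h2 := lvar_add fB s0 (xs n) (xt n) t1.
have h3 := lvar_ge0 fB s0 (xs 0%N) (x1 _).
have h4 := lvar_ge0 fB (x0 n) (xt n) t1.
lra.
Qed.

(* Superadditivity of the local variation turns a local bound on the increments
   of [g] into a bound on its global variation. *)
Lemma vbounded_of_local (g : R -> R) (K : R) : 0 <= K ->
  (forall x y, 0 <= x -> x <= y -> y <= 1 ->
     `|g y - g x| <= K * lvar p f x y `^ p^-1) ->
  vbounded p g (K `^ p * B).
Proof.
move=> K0 Hg x l x0 xl ll.
suff H : x <= last x l /\ vsum p g x l <= K `^ p * lvar p f x (last x l).
  have [h1 h2] := H; apply: (le_trans h2).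
  by rewrite ler_wpM2l ?powR_ge0 // (lvar_le fB).
elim: l x x0 xl ll => [|y l IH] x x0 /=.
  by move=> _ x1; split=> //; rewrite mulr_ge0 ?powR_ge0 // (lvar_ge0 fB).
move=> /andP[xy yl] ll; have y0 := le_trans x0 xy.
have [h1 h2] := IH y y0 yl ll; split; first exact: le_trans h1.
have y1 := le_trans h1 ll.
have h3 : `|g y - g x| `^ p <= K `^ p * lvar p f x y.
  have lv := lvar_ge0 fB x0 xy y1.
  apply: (@le_trans _ _ ((K * lvar p f x y `^ p^-1) `^ p)).
    apply: ge0_ler_powR; rewrite ?nnegrE ?(ltW p0) ?mulr_ge0 ?powR_ge0 //.
    exact: Hg.
  by rewrite powRM ?powR_ge0 // -powRrM mulVf ?gt_eqF // powRr1.
have h4 := lvar_add fB x0 xy h1 ll.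
apply: (@le_trans _ _ (K `^ p * (lvar p f x y + lvar p f y (last y l)))).
  by rewrite mulrDr lerD.
by rewrite ler_wpM2l ?powR_ge0.
Qed.

End Chains.

Section Subdivisions.
Context {R : realType}.

Lemma subdiv_pt_end (s : seq R) i : itv_partition 0 1 s -> (size s <= i)%N ->
  subdiv_pt s i = 1.
Proof.
move=> [_ /eqP ls] si; rewrite /subdiv_pt.
have [->|ne] := eqVneq i (size s); last first.
  by rewrite nth_default // /= ltn_neqAle eq_sym ne.
by rewrite -[in X in nth _ _ X](erefl : (size (0 :: s)).-1 = size s) nth_last.
Qed.

Lemma subdiv_pt_mono (s : seq R) i : itv_partition 0 1 s ->
  subdiv_pt s i <= subdiv_pt s i.+1.
Proof.
move=> P; have [si|si] := leqP (size s) i.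
  by rewrite !subdiv_pt_end // ltnW.
by case: P => /(pathP 1) H _; apply/ltW/H.
Qed.

(** The minimum freezes the sequence at [t] after index [n.+1], which makes it a chain for all
    indices. *)
Definition uniform (s t : R) (n i : nat) : R :=
  s + (t - s) * ((minn i n.+1)%:R / n.+1%:R).

Lemma uniform_chain s t n i : s <= t ->
  s <= uniform s t n i /\ uniform s t n i <= uniform s t n i.+1 /\ uniform s t n i.+1 <= t.
Proof.
move=> st; have ts : 0 <= t - s by rewrite subr_ge0.
split; [|split].
- by rewrite lerDl mulr_ge0 // divr_ge0.
- rewrite lerD2l ler_wpM2l // ler_pM2r ?invr_gt0 ?ltr0n // ler_nat.
  by rewrite leq_min (leq_trans (geq_minl _ _)) // geq_minr.
- rewrite /uniform -lerBrDl ler_piMr // ler_pdivrMr ?ltr0n // mul1r ler_nat.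
  exact: geq_minr.
Qed.

Lemma uniform0 s t n : uniform s t n 0 = s.
Proof. by rewrite /uniform min0n mul0r mulr0 addr0. Qed.

Lemma uniform_end s t n : uniform s t n n.+1 = t.
Proof. by rewrite /uniform minnn divff ?pnatr_eq0 // mulr1 addrC subrK. Qed.

Lemma uniform_mesh s t n i : 0 <= s -> s <= t -> t <= 1 -> (i < n.+1)%N ->
  uniform s t n i.+1 - uniform s t n i <= n.+1%:R^-1.
Proof.
move=> s0 st t1 im; rewrite /uniform (minn_idPl im) (minn_idPl (ltnW im)).
have -> : s + (t - s) * (i.+1%:R / n.+1%:R) - (s + (t - s) * (i%:R / n.+1%:R)) =
    (t - s) * n.+1%:R^-1.
  by rewrite -natr1; ring.
by rewrite ler_piMl ?invr_ge0 //; lra.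
Qed.

End Subdivisions.

Section Conclusions.
Context {R : realType} (w : R -> R) (cw : cadlag w).
Context (lam : {measure set (borel_tree w) -> \bar R}) (hlam : length_measure lam).
Context (p q : R) (p1 : 1 <= p) (q1 : 1 <= q) (pq : 1 < p^-1 + q^-1).
Context (V : R) (V0 : 0 < V) (wV : vbounded p w V).
Context (rho : R -> R) (B M : R) (rB : vbounded q rho B).
Context (rM : forall t, 0 <= t -> t <= 1 -> `|rho t| <= M).
Context (mrho : measurable_fun (`[0, 1] : set R) rho).
Context (hcont : forall t, 0 <= t <= 1 -> ~ continuous01_at w t -> continuous01_at rho t).

Lemma harmonic_cvg : (n.+1%:R^-1 : R) @[n --> \oo] --> (0 : R).
Proof. exact: cvg_harmonic. Qed.

Lemma riemann_stieltjes : riemann_stieltjes_lim rho w (tree_integral lam rho).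
Proof.
rewrite (tree_integral_01 cw hlam p1 q1 pq V0 wV rB rM mrho).
(* The limit along the mesh is reduced to a sequence: a failure at [e] provides, for every [n], a
   tagged subdivision of mesh below [1 / n.+1] with error at least [e], against [riemann_cvg]. *)
move=> e e0; apply: contrapT => H.
have bad n : {sc : seq R * (nat -> R) | [/\ itv_partition 0 1 sc.1,
    forall i, (i < size sc.1)%N -> subdiv_pt sc.1 i.+1 - subdiv_pt sc.1 i < n.+1%:R^-1,
    forall i, (i < size sc.1)%N -> subdiv_pt sc.1 i <= sc.2 i <= subdiv_pt sc.1 i.+1 &
    e <= `|riemann_sum rho w sc.1 sc.2 - tree_integral_on lam rho 0 1| ]}.
  apply: cid; apply: contrapT => Hn; apply: H; exists n.+1%:R^-1; first by rewrite invr_gt0.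
  move=> s c P mesh tags; rewrite ltNge; apply/negP => h; apply: Hn.
  by exists (s, c).
pose x n := subdiv_pt (sval (bad n)).1.
pose c n := (sval (bad n)).2; pose m n := size (sval (bad n)).1.
have P n : itv_partition 0 1 (sval (bad n)).1 by case: (svalP (bad n)).
have T n : tagged (x n) (c n) (m n).
  by split=> i; [exact: subdiv_pt_mono | case: (svalP (bad n)) => _ _ + _; exact].
have x1 n : x n (m n) = 1 by exact: subdiv_pt_end.
have mesh n i : (i < m n)%N -> x n i.+1 - x n i <= n.+1%:R^-1.
  by case: (svalP (bad n)) => _ h _ _ im; exact/ltW/h.
have := @riemann_cvg _ _ cw _ hlam p q p1 q1 pq V V0 wV rho B M rB rM mrho hcont
  0 1 x c m (fun n => n.+1%:R^-1) (lexx 0) ler01 (lexx 1) T (fun=> erefl) x1 mesh harmonic_cvg.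
move=> /cvgrPdist_lt/(_ _ e0)[N _ /(_ N (leqnn N))] /=.
rewrite distrC => h; case: (svalP (bad N)) => _ _ _.
by rewrite leNgt /riemann_sum h.
Qed.

Let K : R := 2 `^ (p^-1 + q^-1) * (1 + (p^-1 + q^-1 - 1)^-1) * B `^ q^-1 + M.
Let p0 : 0 < p. Proof. exact: lt_le_trans ltr01 p1. Qed.
Let B0 : 0 <= B. Proof. exact: vbounded_ge0 rB. Qed.
Let M0 : 0 <= M. Proof. exact: le_trans (normr_ge0 _) (rM (lexx 0) ler01). Qed.

Lemma young_constant_ge0 : 0 <= K.
Proof.
rewrite addr_ge0 // mulr_ge0 ?powR_ge0 // mulr_ge0 ?powR_ge0 //.
by rewrite addr_ge0 // invr_ge0 subr_ge0 ltW.
Qed.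

(** Riemann sums on uniform subdivisions of [[s, t]] obey Young's bound with the variation of [w] on
    [[s, t]] only, and the bound passes to the limit. *)
Lemma tree_integral_on_local s t : 0 <= s -> s <= t -> t <= 1 ->
  `|tree_integral_on lam rho s t| <= K * lvar p w s t `^ p^-1.
Proof.
move=> s0 st t1; pose x := uniform s t.
have cx n : forall i, s <= x n i /\ x n i <= x n i.+1 /\ x n i.+1 <= t.
  by move=> i; exact: uniform_chain.
have T n : tagged (x n) (x n) n.+1.
  split=> [i|i _]; have [_ [h _]] := cx n i; first exact: h.
  by rewrite lexx.
have mesh n i : (i < n.+1)%N -> x n i.+1 - x n i <= n.+1%:R^-1.
  exact: uniform_mesh.
have := @riemann_cvg _ _ cw _ hlam p q p1 q1 pq V V0 wV rho B M rB rM mrho hcont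
  s t x x succn (fun n => n.+1%:R^-1) s0 st t1 T (uniform0 s t) (uniform_end s t) mesh harmonic_cvg.
move=> /cvgrPdist_le h; apply/ler_addgt0Pr => e e0.
have [N _ /(_ N (leqnn N)) /= {}h] := h e e0.
have wA n y : (forall i, s <= y i /\ y i <= y i.+1 /\ y i.+1 <= t) ->
    \sum_(0 <= i < n) `|w (y i.+1) - w (y i)| `^ p <= lvar p w s t.
  by move=> cy; exact: (sum_chain_lvar wV).
have rA n y : (forall i, s <= y i /\ y i <= y i.+1 /\ y i.+1 <= t) ->
    \sum_(0 <= i < n) `|rho (y i.+1) - rho (y i)| `^ q <= B.
  by move=> cy; apply: le_trans (lvar_le rB s0 st t1); exact: (sum_chain_lvar rB).
have rM' u : s <= u -> u <= t -> `|rho u| <= M.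
  by move=> su ut; apply: rM; [exact: le_trans su | exact: le_trans t1].
have := young_bound p1 q1 wA rA (lvar_ge0 wV s0 st t1) B0 N.+1 pq (cx N) rM'.
rewrite [leRHS]mulrC -/K; set S := \sum_(_ <= _ < _) _ in h * => hS.
set I := tree_integral_on _ _ _ _ in h *.
have h2 : `|I| <= `|S| + `|I - S| by rewrite -[X in `|X| <= _](subrK S) addrC; exact: ler_normD.
by apply: (le_trans h2); exact: lerD.
Qed.

Lemma vbounded_tree_integral : vbounded p (tree_integral_on lam rho 0) (K `^ p * V).
Proof.
apply: (vbounded_of_local p0 wV young_constant_ge0) => x y x0 xy y1.
rewrite (tree_integral_on_chasles cw hlam p1 q1 pq V0 wV rB rM mrho x0 xy).
by rewrite addrC addKr; exact: tree_integral_on_local.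
Qed.

End Conclusions.

(** * Variation indices and constants *)

Section Exponents.
Context {R : realType}.
Implicit Types f g : R -> R.

Lemma var_index_ge1 f : (1 <= var_index f)%E.
Proof. by apply: le_ereal_inf_tmp => _ [p [p1 _] <-]; rewrite lee_fin. Qed.

Lemma pvar_fin f (p : R) : 0 < p -> (pvar p f < +oo)%E ->
  exists2 V, pvar p f = V%:E & vbounded p f V.
Proof.
move=> p0 fin; have fn : pvar p f \is a fin_num by rewrite ge0_fin_numE ?pvar_ge0.
by exists (fine (pvar p f)); rewrite ?fineK //; apply/(pvar_vbounded p0); rewrite fineK.
Qed.

(** An admissible [p < a + e] suffices: if [p >= a], then [1/a - 1/p = (p - a) / (a p)] is at most
    [p - a], because [a] and [p] are at least 1. *)
Lemma exponent_near f (a e : R) : var_index f = a%:E -> 0 < e ->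
  exists p V, [/\ 1 <= p, a^-1 - e < p^-1 & vbounded p f V].
Proof.
move=> fa e0; have a1 : 1 <= a by have := var_index_ge1 f; rewrite fa lee_fin.
have fin : var_index f \is a fin_num by rewrite fa.
have [_ [p [p1 fp] <-]] := lb_ereal_inf_adherent e0 fin.
rewrite -/(var_index f) fa -EFinD lte_fin => pa.
have p0 : 0 < p by exact: lt_le_trans ltr01 p1.
have a0 : 0 < a by exact: lt_le_trans ltr01 a1.
have [V _ fV] := pvar_fin p0 fp; exists p, V; split=> //.
have [ap|ap] := ltP p a.
  have : a^-1 < p^-1 by rewrite ltf_pV2.
  by lra.
have : a^-1 - p^-1 = (p - a) * (a^-1 * p^-1).
  by field; rewrite !gt_eqF.
have ia : a^-1 * p^-1 <= 1 by apply: mulr_ile1; rewrite ?invr_ge0 ?invf_le1 // ltW.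
have h : (p - a) * (a^-1 * p^-1) <= p - a by rewrite ler_piMr // subr_ge0.
lra.
Qed.

(** An infinite index contributes 0 and any index contributes at most 1, so both are finite; the
    slack in the strict inequality is then shared equally between the two exponents. *)
Lemma exponents_of_index f g : (1 < (var_index f)^-1 + (var_index g)^-1)%E ->
  exists p q V W, [/\ 1 <= p, 1 <= q, 1 < p^-1 + q^-1, vbounded p f V & vbounded q g W].
Proof.
move=> H; have f1 := var_index_ge1 f; have g1 := var_index_ge1 g.
case fa : (var_index f) f1 H => [a| |] //; case gb : (var_index g) g1 => [b| |] //.
- rewrite !lee_fin => b1 a1.
  have a0 : a != 0 by rewrite gt_eqF // (lt_le_trans ltr01).
  have b0 : b != 0 by rewrite gt_eqF // (lt_le_trans ltr01).
  rewrite !inver (negPf a0) (negPf b0) -EFinD lte_fin => ab.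
  have e0 : 0 < (a^-1 + b^-1 - 1) / 2 by lra.
  have [p [V [p1 pa fV]]] := exponent_near fa e0.
  have [q [W [q1 qb gW]]] := exponent_near gb e0.
  by exists p, q, V, W; split=> //; lra.
- rewrite lee_fin invey adde0 => _ a1.
  have a0 : a != 0 by rewrite gt_eqF // (lt_le_trans ltr01).
  rewrite inver (negPf a0) lte_fin invf_gt1 ?(lt_le_trans ltr01 a1) // ltNge a1 //.
- rewrite lee_fin invey add0e => b1 _.
  have b0 : b != 0 by rewrite gt_eqF // (lt_le_trans ltr01).
  rewrite inver (negPf b0) lte_fin invf_gt1 ?(lt_le_trans ltr01 b1) // ltNge b1 //.
- by rewrite invey adde0 lte_fin ltr10.
Qed.

End Exponents.

Section Estimates.
Context {R : realType} (w rho : R -> R).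
Context (nw : nonconstant w) (brho : bounded_borel rho).

Lemma sup_norm_fin : exists2 M, sup_norm rho = M%:E &
  forall t, 0 <= t -> t <= 1 -> `|rho t| <= M.
Proof.
have [[N [_ HN]] _] := brho.
have le t : 0 <= t -> t <= 1 -> (`|rho t|%:E <= sup_norm rho)%E.
  by move=> t0 t1; apply: ereal_sup_ubound; exists t => //=; rewrite in_itv /= t0.
have fin : sup_norm rho \is a fin_num.
  rewrite ge0_fin_numE; last by apply: le_trans (le 0 (lexx 0) ler01); rewrite lee_fin.
  apply: (@le_lt_trans _ _ (N + 1)%:E); last exact: ltry.
  apply: ge_ereal_sup => _ [t t01 <-]; rewrite lee_fin.
  by apply: (HN (N + 1)) => //; lra.
exists (fine (sup_norm rho)); rewrite ?fineK // => t t0 t1.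
by rewrite -lee_fin fineK // le.
Qed.

Lemma variation_gt0 (p V : R) : vbounded p w V -> 0 < V.
Proof.
move=> wV; have [t [u [t01 u01 tu]]] := nw.
apply: lt_le_trans (vbounded_step wV u01 t01).
by rewrite powR_gt0 // normr_gt0 subr_eq0.
Qed.

Definition young_rhs (C p q : R) : \bar R :=
  (C%:E * pvar p w `^ p^-1 * (pvar q rho `^ q^-1 + sup_norm rho))%E.

(** Reduces an extended-real estimate to finite variations: if one variation is infinite the right
    side is infinite, because the other factor is positive, [w] being nonconstant. This fails for
    [rho = 0], where the product can be [+oo * 0 = 0]; the first hypothesis on [X] covers that
    case. *)
Lemma le_young_rhs (C p q : R) (X : \bar R) : 1 <= p -> 1 <= q -> 0 < C ->
  ((forall t, 0 <= t -> t <= 1 -> rho t = 0) -> (X <= 0)%E) ->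
  (forall V B M, 0 < V -> vbounded p w V -> vbounded q rho B ->
     (forall t, 0 <= t -> t <= 1 -> `|rho t| <= M) ->
     (X <= (C * V `^ p^-1 * (B `^ q^-1 + M))%:E)%E) ->
  (X <= young_rhs C p q)%E.
Proof.
move=> p1 q1 C0 H0 H.
have p0 : 0 < p by exact: lt_le_trans ltr01 p1.
have q0 : 0 < q by exact: lt_le_trans ltr01 q1.
have [M sM rM] := sup_norm_fin; rewrite /young_rhs sM.
have M0 : 0 <= M by apply: le_trans (rM 0 (lexx 0) ler01).
have [Mz|Mz] := eqVneq M 0.
  apply: (@le_trans _ _ 0%E); last first.
    by rewrite !mule_ge0 ?adde_ge0 ?poweR_ge0 ?lee_fin ?(ltW C0).
  by apply: H0 => t t0 t1; apply/eqP; rewrite -normr_le0 -Mz rM.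
have Mp : 0 < M by rewrite lt_neqAle eq_sym Mz.
have ip : p^-1 != 0 by rewrite invr_neq0 // gt_eqF.
have iq : q^-1 != 0 by rewrite invr_neq0 // gt_eqF.
have C0' : (0 < C%:E)%E by rewrite lte_fin.
have sp : (0 < pvar q rho `^ q^-1 + M%:E)%E.
  by rewrite (@lt_le_trans _ _ M%:E) ?lte_fin // leeDr // poweR_ge0.
have [wy|wy] := eqVneq (pvar p w) +oo%E.
  by rewrite wy poweRyr // gt0_muley // gt0_mulye // leey.
have [V Ve wV] : exists2 V, pvar p w = V%:E & vbounded p w V.
  by apply: pvar_fin => //; rewrite ltey.
have V0 := variation_gt0 wV; rewrite Ve poweR_EFin -EFinM.
have Cp : 0 < C * V `^ p^-1 by rewrite mulr_gt0 // powR_gt0.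
have [ry|ry] := eqVneq (pvar q rho) +oo%E.
  by rewrite ry poweRyr // addye // gt0_muley ?lte_fin // leey.
have [B Be rB] : exists2 B, pvar q rho = B%:E & vbounded q rho B.
  by apply: pvar_fin => //; rewrite ltey.
by rewrite Be poweR_EFin -EFinD -EFinM; exact: H.
Qed.

End Estimates.

Section Constant.
Context {R : realType}.

Definition young_factor (p q : R) : R :=
  2 `^ (p^-1 + q^-1) * (1 + (p^-1 + q^-1 - 1)^-1).

(** The first summand is the constant of the total bound, the second dominates Young's local bound;
    their sum serves all three estimates. *)
Definition tree_constant (p q : R) : R :=
  4 / (1 - p * (1 - q^-1)) + (young_factor p q + 1).

Context (p q : R) (p1 : 1 <= p) (q1 : 1 <= q) (pq : 1 < p^-1 + q^-1).

Lemma young_factor_ge0 : 0 <= young_factor p q.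
Proof. by rewrite mulr_ge0 ?powR_ge0 // addr_ge0 // invr_ge0 subr_ge0 ltW. Qed.

Lemma total_constant_gt0 : 0 < 4 / (1 - p * (1 - q^-1)).
Proof. by rewrite divr_gt0 // exponent_gt0. Qed.

Lemma tree_constant_gt0 : 0 < tree_constant p q.
Proof. by rewrite addr_gt0 ?total_constant_gt0 // ltr_wpDl // young_factor_ge0. Qed.

Lemma total_constant_le (v b M : R) : 0 <= v -> 0 <= b -> 0 <= M ->
  4 / (1 - p * (1 - q^-1)) * v * (b + M) <= tree_constant p q * v * (b + M).
Proof.
move=> v0 b0 M0; apply: ler_wpM2r; first exact: addr_ge0.
by apply: ler_wpM2r => //; rewrite lerDl addr_ge0 // young_factor_ge0.
Qed.

Lemma young_constant_le (v b M : R) : 0 <= v -> 0 <= b -> 0 <= M ->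
  (young_factor p q * b + M) * v <= tree_constant p q * v * (b + M).
Proof.
move=> v0 b0 M0; rewrite [leRHS]mulrAC ler_wpM2r //.
have h := total_constant_gt0; have y0 := young_factor_ge0.
have h1 : 0 <= 4 / (1 - p * (1 - q^-1)) * (b + M) by rewrite mulr_ge0 ?addr_ge0 // ltW.
have h2 : 0 <= young_factor p q * M by rewrite mulr_ge0.
have -> : tree_constant p q * (b + M) = 4 / (1 - p * (1 - q^-1)) * (b + M) +
  (young_factor p q * b + young_factor p q * M + b + M) by rewrite /tree_constant; ring.
lra.
Qed.

End Constant.

Section Zero.
Context {R : realType} (w : R -> R) (cw : cadlag w).
Context (lam : {measure set (borel_tree w) -> \bar R}).
Context (rho : R -> R) (rho0 : forall t, 0 <= t -> t <= 1 -> rho t = 0).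

Lemma Delta_zero (tau : tree w) : Delta rho tau = 0.
Proof. by rewrite (@Delta_ext _ _ cw _ (fun=> 0)) // /Delta !if_same subrr. Qed.

Lemma tree_integral_zero : tree_integral lam rho = 0.
Proof.
rewrite /tree_integral /Rintegral (eq_integral (fun=> 0%E)) ?integral0 //.
by move=> tau _; rewrite Delta_zero.
Qed.

End Zero.

Lemma pvar_zero (R : realType) (p : R) (f : R -> R) : 0 < p ->
  (forall t, 0 <= t -> t <= 1 -> f t = 0) -> pvar p f = 0%E.
Proof.
move=> p0 f0; apply/eqP; rewrite eq_le pvar_ge0 // andbT.
apply/(pvar_vbounded p0) => x l; elim: l x => //= y l IH x x0 /andP[xy yl] l1.
have h : y <= last y l.
  by elim: l y {IH xy l1} yl => //= z l IH y /andP[yz zl]; exact: le_trans yz (IH _ zl).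
have y1 := le_trans h l1; have y0 := le_trans x0 xy.
rewrite !f0 // ?(le_trans xy) // powR_diff0 // add0r; exact: IH.
Qed.

Section TreeIntegral.
Context {R : realType} (w : R -> R) (lam : {measure set (borel_tree w) -> \bar R}).
Context (rho : R -> R).
Context (cw : cadlag w) (nw : nonconstant w) (hlam : length_measure lam).
Context (brho : bounded_borel rho).

Lemma total_estimate (p q : R) : 1 <= p -> 1 <= q -> 1 < p^-1 + q^-1 ->
  (\int[lam]_tau `|Delta rho tau|%:E <= young_rhs w rho (tree_constant p q) p q)%E.
Proof.
move=> p1 q1 pq; have mrho := brho.2; apply: le_young_rhs => //.
- exact: tree_constant_gt0.
- move=> rho0; rewrite (eq_integral (fun=> 0%E)) ?integral0 //.
  by move=> tau _; rewrite Delta_zero // normr0.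
- move=> V B M V0 wV rB rM.
  have M0 : 0 <= M by apply: le_trans (rM 0 (lexx 0) ler01).
  apply: (le_trans (total_bound cw hlam p1 q1 pq V0 wV rB rM mrho)).
  by rewrite lee_fin total_constant_le ?powR_ge0.
Qed.

Lemma integral_estimate (p q : R) : tree_integrable lam rho ->
  1 <= p -> 1 <= q -> 1 < p^-1 + q^-1 ->
  (`|tree_integral lam rho|%:E <= young_rhs w rho (tree_constant p q) p q)%E.
Proof.
move=> ilam p1 q1 pq; apply: le_trans (total_estimate p1 q1 pq).
rewrite EFin_normr_Rintegral //; apply: le_trans (le_abse_integral _ _ _) _ => //.
by have /integrableP[] := ilam.
Qed.

Context (hcont : forall t, 0 <= t <= 1 -> ~ continuous01_at w t -> continuous01_at rho t).

Lemma variation_estimate (p q : R) : 1 <= p -> 1 <= q -> 1 < p^-1 + q^-1 ->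
  (pvar p (tree_integral_on lam rho 0%R) `^ p^-1 <=
    young_rhs w rho (tree_constant p q) p q)%E.
Proof.
move=> p1 q1 pq; have mrho := brho.2; have p0 : 0 < p by exact: lt_le_trans ltr01 p1.
have ip : p^-1 != 0 by rewrite invr_neq0 // gt_eqF.
apply: le_young_rhs => //.
- exact: tree_constant_gt0.
- move=> rho0; rewrite pvar_zero ?poweR0r // => t t0 t1.
  by apply: tree_integral_zero => // u u0 u1; rewrite rho0 // mul0r.
- move=> V B M V0 wV rB rM.
  have M0 : 0 <= M by apply: le_trans (rM 0 (lexx 0) ler01).
  have := young_constant_le p1 pq (powR_ge0 V p^-1) (powR_ge0 B q^-1) M0.
  rewrite -lee_fin => leC; apply: le_trans leC.
  have /(pvar_vbounded p0) := vbounded_tree_integral cw hlam p1 q1 pq V0 wV rB rM mrho hcont.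
  have := young_constant_ge0 pq B rM; rewrite -/(young_factor p q).
  set K := _ + M => K0 le_var.
  have KV : 0 <= K `^ p * V by rewrite mulr_ge0 ?powR_ge0 ?ltW.
  apply: (@le_trans _ _ ((K `^ p * V)%:E `^ p^-1)%E).
    apply: gt0_ler_poweR => //; first by rewrite invr_ge0 ltW.
      by rewrite in_itv /= leey pvar_ge0.
    by rewrite in_itv /= leey lee_fin KV.
  rewrite poweR_EFin powRM ?powR_ge0 ?(ltW V0) // -powRrM divff ?gt_eqF //.
  by rewrite powRr1.
Qed.

End TreeIntegral.

Theorem theorem4p5 (R : realType) :
  exists C : R -> R -> R,
  forall (w : R -> R) (lam : {measure set (borel_tree w) -> \bar R})
         (rho : R -> R),
    cadlag w -> nonconstant w -> length_measure lam ->
    bounded_borel rho ->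
    (forall t, 0 <= t <= 1 ->
       ~ continuous01_at w t -> continuous01_at rho t) ->
    (forall p q : R, 1 <= p -> 1 <= q -> 1 < p^-1 + q^-1 ->
       (\int[lam]_tau `|Delta rho tau|%:E <=
        (C p q)%:E * pvar p w `^ p^-1
          * (pvar q rho `^ q^-1 + sup_norm rho))%E) /\
    ((1 < (var_index w)^-1 + (var_index rho)^-1)%E ->
     [/\ tree_integrable lam rho,
       forall p q : R, 1 <= p -> 1 <= q -> 1 < p^-1 + q^-1 ->
         (`|tree_integral lam rho|%:E <=
          (C p q)%:E * pvar p w `^ p^-1
            * (pvar q rho `^ q^-1 + sup_norm rho))%E,
       riemann_stieltjes_lim rho w (tree_integral lam rho) &
       [/\ forall s t : R, 0 <= s -> s <= t -> t <= 1 ->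
             tree_integrable lam (fun x => rho x * \1_`]s, t] x),
           forall s u t : R, 0 <= s -> s <= u -> u <= t -> t <= 1 ->
             tree_integral_on lam rho s t =
             tree_integral_on lam rho s u + tree_integral_on lam rho u t &
           forall p q : R, 1 <= p -> 1 <= q -> 1 < p^-1 + q^-1 ->
             (pvar p (tree_integral_on lam rho 0%R) `^ p^-1 <=
              (C p q)%:E * pvar p w `^ p^-1
                * (pvar q rho `^ q^-1 + sup_norm rho))%E ]]).
Proof.
exists (@tree_constant R) => w lam rho cw nw hlam brho hcont; split.
  exact: total_estimate.
(* One admissible pair gives integrability, the Riemann sums and Chasles; the estimates hold for
   every pair [p'], [q'], even when a variation is infinite. *)
move=> /exponents_of_index[p [q [V [B [p1 q1 pq wV rB]]]]].
have V0 := variation_gt0 nw wV; have mrho := brho.2.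
have [M _ rM] := sup_norm_fin brho.
have ilam := rho_integrable cw hlam p1 q1 pq V0 wV rB rM mrho.
split=> //.
- by move=> p' q'; exact: integral_estimate.
- exact: (riemann_stieltjes cw hlam p1 q1 pq V0 wV rB rM mrho hcont).
split.
- by move=> s t _ st _; exact: (restrict_integrable cw hlam p1 q1 pq V0 wV rB rM mrho st).
- move=> s u t _ su ut _.
  exact: (tree_integral_on_chasles cw hlam p1 q1 pq V0 wV rB rM mrho su ut).
- by move=> p' q'; exact: variation_estimate.
Qed.
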